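(* Let $(\Sigma,\boldsymbol\beta,\boldsymbol\alpha,\mathbf z)$ be the (multi-)pointed Heegaard diagram obtained from an open book diagram $(S,\varphi,\mathbf a)$ with $\mathbf a=\{a_1,\dots,a_N\}$, and let $\mathbf x=\{x_1,\dots,x_N\}$ and $\mathbf y=\{y_1,\dots,y_N\}$ be two generators. Suppose that $\widehat{\pi}_2(\mathbf x,\mathbf y)\neq\emptyset$ and let $k$ denote the number of contact intersection points in $\mathbf y$ that are not in $\mathbf x$. Then there are at most $2^k$ positive domains in $\widehat{\pi}_2(\mathbf x,\mathbf y)$.
   Context: An open book diagram $(S,\varphi,\mathbf a)$ consists of an abstract open book $(S,\varphi)$ ($S$ the page, a compact oriented surface with non-empty boundary, $\varphi$ the monodromy, a diffeomorphism of $S$ that is the identity near $\partial S$) and a collection $\mathbf a=\{a_1,\dots,a_N\}$ of pairwise disjoint, properly embedded oriented arcs on $S$ cutting it open into a disjoint union of disks. It yields a weakly admissible (multi-)pointed Heegaard diagram $(\Sigma,\boldsymbol\beta,\boldsymbol\alpha,\mathbf z)$ as follows (Honda–Kazez–Matić construction). - $\Sigma=S_{1/2}\cup_{\partial S}-S_0$, the union along the boundary of two copies $S_{1/2}$, $-S_0$ of the page (the latter with reversed orientation). - $\boldsymbol\alpha=\{\alpha_1,\dots,\alpha_N\}$ with $\alpha_i=a_i\cup -a_i$ (the first arc in $S_{1/2}$, the second in $-S_0$). - $\boldsymbol\beta=\{\beta_1,\dots,\beta_N\}$ with $\beta_i=b_i\cup-\varphi(b_i)$, where each $b_i$ is a Hamiltonian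 isotopic copy of $a_i$ that intersects $a_i$ positively in one distinguished point $x_\xi^i\in\mathrm{int}(S_{1/2})$, called a contact intersection point. - $\mathbf z=\{z_1,\dots,z_m\}$, where each $z_j$ lies in the interior of a distinct connected component of $S_{1/2}\setminus\bigcup_{i=1}^N a_i$ (one per component), outside the thin strips between $a_i$ and $b_i$. Regions are the closures of the subsurfaces into which the $\boldsymbol\alpha$- and $\boldsymbol\beta$-curves divide $\Sigma$; a region is unpointed if it contains no $z_j$. A generator is a set of $N$ intersection points between $\boldsymbol\alpha$- and $\boldsymbol\beta$-curves that determines a one-to-one pairing between the $\boldsymbol\alpha$-curves and the $\boldsymbol\beta$-curves. For generators $\mathbf x,\mathbf y$, $\widehat{\pi}_2(\mathbf x,\mathbf y)$ is the set of 2-chains $D$ that are formal integer linear sums of unpointed regions such that $\partial(\partial|_{\boldsymbol\beta}D)=\mathbf y-\mathbf x$, where $\partial|_{\boldsymbol\beta}D$ is the part of $\partial D$ along the $\boldsymbol\beta$-curves and $\mathbf x,\mathbf y$ are considered as 0-chains. Such 2-chains are called domains; a domain is positive if its multiplicity in every unpointed region is non-negative. *)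

(* Defs.v *)
(* Contents: smooth compact oriented surfaces with boundary, arcs on them,    *)
(* open book diagrams, the Honda-Kazez-Matic multi-pointed Heegaard diagram   *)
(* of an open book diagram, its generators and its domains.                   *)
(*                                                                            *)
(* Curves are maps R -> S considered on [0, 1] only, and local inverses are   *)
(* total maps considered on their stated domain only.                         *)
From HB Require Import structures.
From mathcomp Require Import all_boot all_order all_algebra all_fingroup.
From mathcomp Require Import all_classical all_reals all_analysis.
Import Order.TTheory GRing.Theory Num.Theory.
Import numFieldNormedType.Exports.

Set Implicit Arguments.
Unset Strict Implicit.
Unset Printing Implicit Defensive.

Local Open Scope classical_set_scope.
Local Open Scope card_scope.
Local Open Scope ring_scope.

Section SmoothMaps.
Context {R : realType}.

(* In finite dimension, f is C^n on the open set U if its iterated            *)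
(* directional derivatives of order at most n exist and are continuous on U.  *)
Fixpoint Ck (V W : normedModType R) (n : nat) (U : set V) (f : V -> W) : Prop :=
  {in U, continuous f} /\
  if n is k.+1 then
    forall v, (forall p, U p -> derivable f p v) /\ Ck k U ('D_v f)
  else True.

Definition smooth_ext (V W : normedModType R) (A : set V) (f : V -> W) (p : V)
    (g : V -> W) : Prop :=
  exists U : set V, [/\ open U, U p, (forall n, Ck n U g) &
    forall q, A q -> U q -> f q = g q].

Definition smooth_on (V W : normedModType R) (A : set V) (f : V -> W) : Prop :=
  forall p, A p -> exists g, smooth_ext A f p g.

Definition e1 : R * R := (1, 0).
Definition e2 : R * R := (0, 1).

Definition det2 (v w : R * R) : R := v.1 * w.2 - v.2 * w.1.

(* rotation by a quarter turn, to the left *)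
Definition turn (v : R * R) : R * R := (- v.2, v.1).

Definition jac (f : R * R -> R * R) (p : R * R) : R :=
  det2 ('D_e1 f p) ('D_e2 f p).

Definition oriented_smooth_on (A : set (R * R)) (f : R * R -> R * R) : Prop :=
  forall p, A p -> exists2 g, smooth_ext A f p g & 0 < jac g p.

Definition half_plane : set (R * R) := [set u | 0 <= u.2].

Definition disk : set (R * R) := [set u | u.1 ^+ 2 + u.2 ^+ 2 <= 1].
Definition circle : set (R * R) := [set u | u.1 ^+ 2 + u.2 ^+ 2 = 1].

Definition band : set (R * R) := [set u | -1 < u.1 < 1 /\ 0 <= u.2 <= 1].

End SmoothMaps.

Record chart (R : realType) (S : topologicalType) := Chart {
  chart_dom : set S;
  chart_map : S -> R * R;
  chart_inv : R * R -> S }.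

Section Charts.
Context {R : realType} {S : topologicalType}.

Definition chart_axiom (c : chart R S) : Prop :=
  [/\ open (chart_dom c),
      exists2 W : set (R * R), open W &
        chart_map c @` chart_dom c = W `&` half_plane,
      {within chart_dom c, continuous (chart_map c)},
      {within chart_map c @` chart_dom c, continuous (chart_inv c)} &
      {in chart_dom c, cancel (chart_map c) (chart_inv c)}].

Definition compatible (c c' : chart R S) : Prop :=
  oriented_smooth_on (chart_map c @` (chart_dom c `&` chart_dom c'))
    (chart_map c' \o chart_inv c).

End Charts.

(* Smooth compact oriented surfaces with (possibly empty) boundary; they need *)
(* not be connected. Compatibility of charts includes positivity of Jacobians *)
(* of the transition maps, whence the orientation.                            *)
Record surface (R : realType) := Surface {
  carrier :> topologicalType;
  atlas : set (chart R carrier);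
  surf_hausdorff : hausdorff_space carrier;
  surf_compact : compact [set: carrier];
  surf_chart : forall c, atlas c -> chart_axiom c;
  surf_cover : forall p : carrier, exists2 c, atlas c & chart_dom c p;
  surf_compat : forall c c', atlas c -> atlas c' -> compatible c c' }.

Section OnSurface.
Context {R : realType} {S : surface R}.

Definition bd : set S :=
  [set p | exists c, [/\ atlas c, chart_dom c p & (chart_map c p).2 = 0]].

Definition smooth_into (V : normedModType R) (A : set V) (f : V -> S) : Prop :=
  {within A, continuous f} /\
  forall c, atlas c -> smooth_on (A `&` f @^-1` chart_dom c) (chart_map c \o f).

Definition smooth_from (W : normedModType R) (U : set S) (f : S -> W) : Prop :=
  forall c, atlas c ->
    smooth_on (chart_map c @` (chart_dom c `&` U)) (f \o chart_inv c).

Definition smooth_self (f : S -> S) : Prop :=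
  forall c, atlas c ->
    smooth_into (chart_map c @` chart_dom c) (f \o chart_inv c).

Definition diffeo (f : S -> S) : Prop :=
  exists g : S -> S,
    [/\ smooth_self f, smooth_self g, cancel f g & cancel g f].

Definition trace (g : R -> S) : set S := g @` `[0, 1].

(* v is the velocity at time t of g, read in the chart c; at 0 and 1 this is  *)
(* the one-sided velocity.                                                    *)
Definition velocity (g : R -> S) (t : R) (c : chart R S) (v : R * R) : Prop :=
  [/\ atlas c, chart_dom c (g t) &
    exists2 h : R -> R * R,
      smooth_ext (`[0, 1] `&` g @^-1` chart_dom c) (chart_map c \o g) t h &
      v = 'D_1 h t].

(* properly embedded arcs: smooth embeddings of [0, 1] meeting the boundary   *)
(* of S exactly in the endpoints, and transversally so.                       *)
Definition proper_arc (g : R -> S) : Prop :=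
  [/\ smooth_into (`[0, 1] : set R) g,
      {in `[0, 1] &, injective g},
      forall (t : R) c v, t \in `[0, 1] -> velocity g t c v -> v != 0,
      forall t : R, t \in `[0, 1] -> (bd (g t) <-> t = 0 \/ t = 1) &
      forall (t : R) c v, t = 0 \/ t = 1 -> velocity g t c v -> v.2 != 0].

(* Cutting S open along A (a disjoint union of proper arcs) yields a disjoint *)
(* union of n closed disks: q is the map regluing the cut-open surface. It is *)
(* one-to-one off A and two-to-one over A, and the boundary of the cut-open   *)
(* surface is what lies over the boundary of S or over A.                     *)
Definition cuts_into_disks (A : set S) : Prop :=
  exists (n : nat) (q : 'I_n -> R * R -> S),
    [/\ forall j, {within disk, continuous (q j)},
        forall p, exists j, (q j @` disk) p,
        forall j u, disk u -> (circle u <-> bd (q j u) \/ A (q j u)),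
        forall j j' u u', disk u -> disk u' -> ~ A (q j u) ->
          q j u = q j' u' -> j = j' /\ u = u' &
        forall p, A p ->
          [set w : 'I_n * (R * R) | disk w.2 /\ q w.1 w.2 = p] #= `I_2].

(* An area form, as its density with respect to dx /\ dy in each chart.       *)
Definition area_form (w : chart R S -> R * R -> R) : Prop :=
  [/\ forall c, atlas c ->
        smooth_on (chart_map c @` chart_dom c) (w c : _ -> R^o),
      forall c p, atlas c -> chart_dom c p -> 0 < w c (chart_map c p) &
      forall c c' p g, atlas c -> atlas c' -> chart_dom c p -> chart_dom c' p ->
        smooth_ext (chart_map c @` (chart_dom c `&` chart_dom c'))
          (chart_map c' \o chart_inv c) (chart_map c p) g ->
        w c (chart_map c p) = w c' (chart_map c' p) * jac g (chart_map c p)].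

(* psi is the flow, over the time interval [0, 1], of a time-dependent        *)
(* Hamiltonian H with respect to w: the vector field X_s generating psi       *)
(* satisfies w(X_s, -) = dH_s, which for w = f dx /\ dy reads                 *)
(* f * X_s.1 = dH_s/dy and f * X_s.2 = - dH_s/dx.                             *)
Definition hamiltonian_isotopy (w : chart R S -> R * R -> R)
    (psi : R -> S -> S) : Prop :=
  [/\ forall p, psi 0 p = p,
      forall s : R, s \in `[0, 1] -> diffeo (psi s),
      forall c, atlas c ->
        smooth_into ([set u : R * (R * R) | 0 <= u.1 <= 1 /\
                                            (chart_map c @` chart_dom c) u.2])
                    (fun u : R * (R * R) => psi u.1 (chart_inv c u.2)) &
      exists H : R -> S -> R,
        (forall c, atlas c ->
          smooth_on ([set u : R * (R * R) | 0 <= u.1 <= 1 /\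
                                            (chart_map c @` chart_dom c) u.2])
                    (fun u : R * (R * R) => H u.1 (chart_inv c u.2) : R^o)) /\
        (forall (s : R) p c v h, s \in `[0, 1] ->
          velocity (fun s' => psi s' p) s c v ->
          let u0 := chart_map c (psi s p) in
          smooth_ext (chart_map c @` chart_dom c)
            (fun u => H s (chart_inv c u) : R^o) u0 h ->
          w c u0 * v.1 = 'D_e2 h u0 /\ w c u0 * v.2 = - 'D_e1 h u0)].

(* An orientation-preserving diffeomorphism nu, with inverse rho, from        *)
(* ]-1, 1[ x [0, 1] onto a neighbourhood of the proper arc g, which           *)
(* corresponds to {0} x [0, 1].                                               *)
Definition tubular (g : R -> S) (nu : R * R -> S) (rho : S -> R * R) : Prop :=
  [/\ open (nu @` band) /\ {in band, cancel nu rho},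
      smooth_into band nu /\ smooth_from (nu @` band) rho,
      forall c, atlas c ->
        oriented_smooth_on (band `&` nu @^-1` chart_dom c) (chart_map c \o nu),
      forall u, band u -> (bd (nu u) <-> u.2 = 0 \/ u.2 = 1) &
      forall t : R, t \in `[0, 1] -> nu (0, t) = g t].

End OnSurface.
Arguments bd {R} S.

Record open_book (R : realType) := OpenBook {
  page :> surface R;
  page_bd : bd page !=set0;
  monodromy : page -> page;
  monodromy_diffeo : diffeo monodromy;
  monodromy_id : exists U : set page,
    [/\ open U, bd page `<=` U & forall p, U p -> monodromy p = p] }.

Arguments monodromy {R} o p.

Record open_book_diagram (R : realType) (N : nat) := OpenBookDiagram {
  ob :> open_book R;
  cut_arc : 'I_N -> R -> ob;
  arc_proper : forall i, proper_arc (cut_arc i);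
  arc_disjoint : forall i j, i != j ->
    trace (cut_arc i) `&` trace (cut_arc j) = set0;
  arc_cut : cuts_into_disks (\bigcup_i trace (cut_arc i)) }.

(* The double: (p, true) is in the copy S_{1/2} of the page, (p, false) is in *)
(* -S_0, and the two copies are glued along the boundary of the page.         *)
Section Double.
Context {R : realType} (S : surface R).

Definition glued (u v : S * bool) : bool :=
  (u.1 == v.1) && ((u.2 == v.2) || `[< bd S u.1 >]).

Lemma glued_refl : reflexive glued.
Proof. by move=> u; rewrite /glued !eqxx. Qed.

Lemma glued_sym : symmetric glued.
Proof.
move=> u v; rewrite /glued eq_sym; case: eqP => //= ->.
by rewrite eq_sym.
Qed.

Lemma glued_trans : transitive glued.
Proof.
move=> v u w /andP[/eqP uv b_uv] /andP[/eqP vw b_vw].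
rewrite /glued uv vw eqxx /=; move: b_uv b_vw; rewrite uv vw.
by case: `[< _ >]; rewrite ?orbT // !orbF => /eqP->.
Qed.

Definition glued_equiv : equiv_rel (S * bool)%type :=
  EquivRel glued glued_refl glued_sym glued_trans.

Definition doubled : topologicalType :=
  quotient_topology {eq_quot glued_equiv}%qT.

Definition copy (h : bool) (p : S) : doubled :=
  \pi_({eq_quot glued_equiv}%qT)%qT (p, h).

Definition copy_sign (h : bool) : int := if h then 1 else -1.

End Double.

(* The choices made in the construction of the Heegaard diagram.              *)
(* The isotopy from a_i to b_i is small: b_i lies in a tubular neighbourhood  *)
(* of a_i, where it is a graph over a_i; these neighbourhoods are disjoint.   *)
(* The thin strips between a_i and b_i are the points of the neighbourhood    *)
(* lying weakly between a_i and this graph. Positivity means a_i . b_i = +1,  *)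
(* i.e. the endpoints of a_i move in the direction of the oriented boundary   *)
(* of the page. Transversality of phi(b_i) and a_j is the genericity implicit *)
(* in a Heegaard diagram.                                                     *)
Record hkm_data (R : realType) (N m : nat) (D : open_book_diagram R N) :=
  HKMData {
  area : chart R D -> R * R -> R;
  area_axiom : area_form area;
  nu : 'I_N -> R * R -> D;
  rho : 'I_N -> D -> R * R;
  nu_tubular : forall i, tubular (cut_arc D i) (nu i) (rho i);
  nu_disjoint : forall i j, i != j -> nu i @` band `&` nu j @` band = set0;
  barc : 'I_N -> R -> D;
  barc_isotopic : forall i, exists2 psi, hamiltonian_isotopy area psi &
    forall t : R, t \in `[0, 1] -> barc i t = psi 1 (cut_arc D i t);
  barc_near : forall i, trace (barc i) `<=` nu i @` band;
  barc_graph : forall i (s t : R), s \in `[0, 1] -> t \in `[0, 1] -> s < t ->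
    (rho i (barc i s)).2 < (rho i (barc i t)).2;
  xi : 'I_N -> D;
  xi_unique : forall i, trace (cut_arc D i) `&` trace (barc i) = [set xi i];
  xi_interior : forall i, ~ bd D (xi i);
  xi_positive : forall i (s t : R) c v w, s \in `[0, 1] -> t \in `[0, 1] ->
    cut_arc D i s = xi i -> barc i t = xi i ->
    velocity (cut_arc D i) s c v -> velocity (barc i) t c w -> 0 < det2 v w;
  monodromy_transverse : forall i j (s t : R) c v w,
    s \in `[0, 1] -> t \in `[0, 1] ->
    cut_arc D i s = monodromy D (barc j t) ->
    velocity (cut_arc D i) s c v ->
    velocity (monodromy D \o barc j) t c w -> det2 v w != 0;
  strips : set D := [set p | exists i, (nu i @` band) p /\
    exists2 t : R, t \in `[0, 1] &
      (rho i (barc i t)).2 = (rho i p).2 /\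
      (0 <= (rho i p).1 <= (rho i (barc i t)).1 \/
       (rho i (barc i t)).1 <= (rho i p).1 <= 0)];
  basept : 'I_m -> D;
  basept_interior : forall j,
    [/\ ~ bd D (basept j), ~ (\bigcup_i trace (cut_arc D i)) (basept j) &
        ~ strips (basept j)];
  basept_component : forall p, ~ (\bigcup_i trace (cut_arc D i)) p ->
    exists! j,
      connected_component (~` \bigcup_i trace (cut_arc D i)) p (basept j) }.

Section HeegaardDiagram.
Context {R : realType} {N m : nat} {D : open_book_diagram R N}
  (H : hkm_data m D).
Local Notation Sigma := (doubled D).

(* the arc of beta_i contained in each of the two copies of the page *)
Definition half_beta (h : bool) (i : 'I_N) : R -> D :=
  if h then barc H i else monodromy D \o barc H i.

Definition alpha (i : 'I_N) : set Sigma :=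
  copy true @` trace (cut_arc D i) `|` copy false @` trace (cut_arc D i).
Definition beta (i : 'I_N) : set Sigma :=
  copy true @` trace (half_beta true i) `|`
  copy false @` trace (half_beta false i).
Definition curves : set Sigma := \bigcup_i (alpha i `|` beta i).

Definition contact (i : 'I_N) : Sigma := copy true (xi H i).

Definition generator (x : set Sigma) : Prop :=
  exists (s : {perm 'I_N}) (p : 'I_N -> Sigma),
    x = range p /\ forall i, (alpha i `&` beta (s i)) (p i).

(* For p on a curve, this is the empty set, which is not a region. *)
Definition region_at (p : Sigma) : set Sigma :=
  closure (connected_component (~` curves) p).

Definition region (r : set Sigma) : Prop :=
  exists2 p, ~ curves p & r = region_at p.

Definition unpointed (r : set Sigma) : Prop :=
  region r /\ forall j, ~ r (copy true (basept H j)).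

(* Formal integer sums of unpointed regions, as coefficient functions. *)
Definition chain2 (P : set Sigma -> int) : Prop :=
  finite_set [set r | P r != 0] /\ forall r, P r != 0 -> unpointed r.

(* n is the coefficient in the boundary of P of the part of beta_i near       *)
(* copy h (half_beta h i t), directed as half_beta h i: the multiplicity of P *)
(* on the left minus the one on the right. The sides are read in an oriented  *)
(* chart of the page, and the orientation of the copy false is the opposite.  *)
Definition beta_coef (P : set Sigma -> int) (h : bool) (i : 'I_N) (t : R)
    (n : int) : Prop :=
  let g := half_beta h i in
  let mult c u := P (region_at (copy h (chart_inv c u))) in
  forall c v, velocity g t c v ->
    \forall e \near 0^'+,
      n = copy_sign h * (mult c (chart_map c (g t) + e *: turn v) -
                         mult c (chart_map c (g t) - e *: turn v)).

(* n is the coefficient of the point copy h (half_beta h i t), a vertex       *)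
(* dividing beta_i, in the boundary of the beta-part of the boundary of P:    *)
(* the boundary of a directed edge is its head minus its tail.                *)
Definition vertex_coef (P : set Sigma -> int) (h : bool) (i : 'I_N) (t : R)
    (n : int) : Prop :=
  exists n_in n_out : int,
    [/\ \forall s \near t^'-, beta_coef P h i s n_in,
        \forall s \near t^'+, beta_coef P h i s n_out &
        n = n_in - n_out].

(* The vertices of the beta-curves are their intersection points with the     *)
(* alpha-curves, none of which lies on the boundary of the page.              *)
Definition pi2hat (x y : set Sigma) : set (set Sigma -> int) :=
  [set P | chain2 P /\
    forall h i (t : R), t \in `]0, 1[ ->
      let q := copy h (half_beta h i t) in
      (\bigcup_j alpha j) q ->
      vertex_coef P h i t ((q \in y)%:Z - (q \in x)%:Z)].

Definition positive (P : set Sigma -> int) : Prop :=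
  forall r, unpointed r -> 0 <= P r.

End HeegaardDiagram.

(* Main.v *)
Require Import Defs.
From HB Require Import structures.
From mathcomp Require Import all_boot all_order all_algebra.
From mathcomp Require Import all_classical all_reals all_analysis.
From mathcomp Require Import ring lra zify.
Import Order.TTheory GRing.Theory Num.Theory.
Import numFieldNormedType.Exports.
Set Implicit Arguments.
Unset Strict Implicit.
Unset Printing Implicit Defensive.
Local Open Scope classical_set_scope.
Local Open Scope card_scope.
Local Open Scope ring_scope.

(** Let P1 and P2 be two positive domains from x to y. A domain is determined by
its multiplicities off the curves, which are read here on the page, once for each
of the two copies, and its coefficient along a beta-arc is, up to sign, the jump
of the multiplicity across that arc. The theorem says that P1 = P2 as soon as P1
and P2 agree on one bit for each of the k contact points in y and not in x.

The bits. A point of S_{1/2} off the a-arcs and off the thin strips can be moved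
to a base point without crossing a curve, because a path avoiding the a-arcs can
be pushed out of the strips; so all multiplicities vanish there
([mu_off_strips]). The arcs a_i and b_i cross at the contact point, positively,
which puts the right of b_i just before the contact point and its left just after
it outside the strips ([contact_offsets]). Hence the coefficient of the domain on
the edge of beta_i entering the contact point is the multiplicity on its left,
thus at least 0, and the coefficient on the edge leaving it is minus the
multiplicity on its right, thus at most 0. Their difference is prescribed: 1 if
the contact point is in y and not in x, and at most 0 otherwise. So the entering
coefficient is 0 or 1 in the first case and 0 in the second
([incoming_exists]).

The bits determine the domain ([domain_eq]). Suppose P1 and P2 have the same
entering coefficient at every contact point, and let Q = P1 - P2. At each vertex
the coefficients of Q on the entering and on the leaving edge are equal, so if Q
does not jump across an open beta-arc at one place, it jumps nowhere across it
([zero_jump_propagates]). On S_{1/2} this applies to all b_i, starting from the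
contact points. Then Q is constant across b_i, and as it vanishes on the outer
side of b_i, it vanishes in the strips as well ([diff_mu_true_zero]). The
monodromy is the identity near the boundary, so there the other copy of the page
carries the same curves, whence Q = 0 near the ends of the arcs phi(b_i)
([diff_mu_near_end]). By propagation again, Q does not jump across phi(b_i), hence
it is constant on each component of the page cut along the a-arcs. Each of these
components meets the boundary, because the a-arcs cut the page into disks
([component_meets_bd]), and on the boundary Q has the values found on S_{1/2},
namely 0 ([diff_mu_false_zero]).

The jump is meaningful because a beta-arc has two sides: locally, at a point
outside the a-arcs, its complement is the union of two connected sets, one
containing the points slightly to the left of the arc and one containing those
slightly to its right ([two_sides], [sides_at]). *)

(** * Calculus in the plane *)

Section Calculus.
Context {R : realType}.

Lemma is_derive_line (V W : normedModType R) (f : V -> W) (p v : V) (s : R) :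
  derivable f (s *: v + p) v ->
  is_derive s 1 (fun r : R => f (r *: v + p)) ('D_v f (s *: v + p)).
Proof.
have E : (fun h : R => h^-1 *: (((fun r : R => f (r *: v + p)) \o shift s)
     (h *: (1 : R)) - f (s *: v + p))) =
  (fun h : R => h^-1 *: ((f \o shift (s *: v + p)) (h *: v) - f (s *: v + p))).
  apply/funext => h /=; congr (_ *: (f _ - _)).
  by rewrite [h%:A]mulr1 scalerDl addrA.
move=> df; apply: DeriveDef; first by rewrite /derivable E.
by rewrite /derive E.
Qed.

(** The mean value theorem on the segment from p to x *: v + p, with the
approximate slope L taken out. *)
Lemma mvt_line (V : normedModType R) (f : V -> R) (p v : V) (x L eps : R) :
  (forall s : R, `|s| <= `|x| -> derivable f (s *: v + p) v /\
    `|'D_v f (s *: v + p) - L| <= eps) ->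
  `|f (x *: v + p) - f p - x * L| <= eps * `|x|.
Proof.
move=> Hf; pose g := fun r : R => f (r *: v + p).
have dg (s : R) : `|s| <= `|x| -> is_derive s 1 g ('D_v f (s *: v + p)).
  by move=> /Hf[ds _]; exact: is_derive_line.
have cg (a b : R) : `|a| <= `|x| -> `|b| <= `|x| -> {within `[a, b], continuous g}.
  move=> ax bx; apply: derivable_within_continuous => s; rewrite in_itv/= => /andP[s1 s2].
  have sx : `|s| <= `|x| by move: ax bx; rewrite !ler_norml; lra.
  by have := dg _ sx => -[].
have g0 : g 0 = f p by rewrite /g scale0r add0r.
rewrite -g0 -[f _]/(g x).
have [x0|x0|x0] := ltgtP x 0; last first.
- by rewrite x0 subrr mul0r subr0 normr0 mulr0.
- have dgi s : s \in `]0, x[ -> is_derive s 1 g ('D_v f (s *: v + p)).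
    by rewrite in_itv/= => /andP[s1 s2]; apply: dg; rewrite !gtr0_norm// ltW.
  have cgi : {within `[0, x], continuous g} by apply: cg; rewrite ?normr0.
  have [c] := MVT x0 dgi cgi.
  rewrite in_itv/= => /andP[c1 c2]; rewrite subr0 => ->.
  rewrite [x * L]mulrC -mulrBl normrM ler_wpM2r//.
  by apply: (Hf c _).2; rewrite !gtr0_norm// ltW.
have dgi s : s \in `]x, 0[ -> is_derive s 1 g ('D_v f (s *: v + p)).
  by rewrite in_itv/= => /andP[s1 s2]; apply: dg; rewrite !ltr0_norm// lerN2 ltW.
have cgi : {within `[x, 0], continuous g} by apply: cg; rewrite ?normr0.
have [c] := MVT x0 dgi cgi.
rewrite in_itv/= => /andP[c1 c2]; rewrite sub0r => gE.
have -> : g x - g 0 - x * L = x * ('D_v f (c *: v + p) - L).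
  by rewrite -[g x - g 0]opprB gE; ring.
rewrite normrM mulrC ler_wpM2r//.
by apply: (Hf c _).2; rewrite !ltr0_norm// lerN2 ltW.
Qed.

Lemma differentiable_of_linear (V W : normedModType R) (f df : V -> W) (p : V) :
  linear df -> continuous df ->
  (forall eps : R, 0 < eps ->
    \forall x \near (0 : V), `|f (x + p) - (f p + df x)| <= eps * `|x|) ->
  differentiable f p.
Proof.
move=> lin_df cdf H.
pose dfM := GRing.isLinear.Build _ _ _ _ _ lin_df.
pose dfL : {linear V -> W} := HB.pack df dfM.
suff E : f \o shift p = cst (f p) + dfL +o_ (0 : V) id.
  by apply/diff_locallyP; rewrite (@diff_unique _ _ _ _ dfL _ cdf E).
by apply/eqaddoP => eps eps0; exact: H.
Qed.

Lemma near_ball_norm (V : normedModType R) (p : V) (P : V -> Prop) :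
  (\forall q \near p, P q) -> exists2 r : R, 0 < r & forall q, `|p - q| < r -> P q.
Proof. by move=> /nbhs_normP[r /= r0 H]; exists r. Qed.

Lemma ball_norm_near (V : normedModType R) (p : V) (P : V -> Prop) (r : R) :
  0 < r -> (forall q, `|p - q| < r -> P q) -> \forall q \near p, P q.
Proof. by move=> r0 H; apply/nbhs_normP; exists r => //= q; exact: H. Qed.

Lemma near_dist_le (V W : normedModType R) (g : V -> W) (p : V) (eps : R) :
  0 < eps -> {for p, continuous g} -> \forall q \near p, `|g q - g p| <= eps.
Proof.
by move=> e0 /cvgrPdist_le /(_ _ e0); apply: filterS => q; rewrite distrC.
Qed.

Lemma pair_basis (v : R * R) : v = v.1 *: e1 + v.2 *: e2.
Proof.
case: v => a b; congr pair => /=.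
- by rewrite -[RHS]/(a * 1 + b * 0) mulr1 mulr0 addr0.
- by rewrite -[RHS]/(a * 0 + b * 1) mulr1 mulr0 add0r.
Qed.

(** Continuous partial derivatives give a differential: the increment is split into
a horizontal and a vertical step, and the mean value theorem applies to each. *)
Lemma differentiable_scalar_R2 (f : R * R -> R) (p : R * R) :
  (\forall q \near p, derivable f q e1) -> (\forall q \near p, derivable f q e2) ->
  {for p, continuous ('D_e1 f)} -> {for p, continuous ('D_e2 f)} ->
  differentiable f p.
Proof.
move=> d1 d2 c1 c2.
pose df (x : R * R) : R := x.1 * 'D_e1 f p + x.2 * 'D_e2 f p.
have lin_df : linear df.
  move=> a u v.
  by rewrite /df -[_.1]/(a * u.1 + v.1) -[_.2]/(a * u.2 + v.2) -[a *: _]/(a * _); ring.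
have cdf : continuous df.
  move=> x; apply: (@continuousD _ _ _ (fun x : R * R => x.1 * 'D_e1 f p)
    (fun x : R * R => x.2 * 'D_e2 f p)).
    by apply: (@continuousM _ _ (fun x : R * R => x.1)); [exact: cvg_fst|exact: cvg_cst].
  by apply: (@continuousM _ _ (fun x : R * R => x.2)); [exact: cvg_snd|exact: cvg_cst].
apply: (differentiable_of_linear lin_df cdf) => eps eps0.
have e20 : 0 < eps / 2 by rewrite divr_gt0.
have [r r0 Hr] := near_ball_norm (filterI (filterI d1 d2)
  (filterI (near_dist_le e20 c1) (near_dist_le e20 c2))).
apply: (ball_norm_near r0) => x; rewrite sub0r normrN => xr.
rewrite /df.
have x1 : `|x.1| <= `|x| by rewrite prod_normE le_max lexx.
have x2 : `|x.2| <= `|x| by rewrite prod_normE le_max lexx orbT.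
pose p2 := x.2 *: e2 + p.
have n1 : `|e1 : R * R| = 1 by rewrite prod_normE /= normr1 normr0 max_l ?ler01.
have n2 : `|e2 : R * R| = 1 by rewrite prod_normE /= normr1 normr0 max_r ?ler01.
have H2 : `|f (x.2 *: e2 + p) - f p - x.2 * 'D_e2 f p| <= eps / 2 * `|x.2|.
  apply: mvt_line => s sx.
  have h : `|p - (s *: e2 + p)| < r.
    rewrite opprD addrCA subrr addr0 normrN normrZ n2 mulr1.
    exact: le_lt_trans (le_trans sx x2) xr.
  by have [[_ ?] [_ ?]] := Hr _ h; split.
have H1 : `|f (x.1 *: e1 + p2) - f p2 - x.1 * 'D_e1 f p| <= eps / 2 * `|x.1|.
  apply: mvt_line => s sx.
  have h : `|p - (s *: e1 + p2)| < r.
    rewrite /p2 addrA opprD addrCA subrr addr0 normrN prod_normE /e1 /e2 gt_max.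
    rewrite -[X in `|X|]/(s * 1 + x.2 * 0) -[X in _ && (`|X| < _)]/(s * 0 + x.2 * 1).
    rewrite !mulr0 !mulr1 addr0 add0r (le_lt_trans x2 xr) andbT.
    exact: le_lt_trans (le_trans sx x1) xr.
  by have [[? _] [? _]] := Hr _ h; split.
have -> : x + p = x.1 *: e1 + p2.
  by rewrite /p2 addrA -pair_basis.
have -> : f (x.1 *: e1 + p2) - (f p + (x.1 * 'D_e1 f p + x.2 * 'D_e2 f p)) =
  (f (x.1 *: e1 + p2) - f p2 - x.1 * 'D_e1 f p) + (f p2 - f p - x.2 * 'D_e2 f p) by ring.
apply: (le_trans (ler_normD _ _)).
rewrite [leRHS](_ : _ = eps / 2 * `|x| + eps / 2 * `|x|); last by rewrite -mulrDl -splitr.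
apply: lerD; first by apply: (le_trans H1); rewrite ler_wpM2l// ltW.
by apply: (le_trans H2); rewrite ler_wpM2l// ltW.
Qed.

Lemma derivable_fst (V : normedModType R) (G : V -> R * R) (q v : V) :
  derivable G q v ->
  derivable (fun x => (G x).1) q v /\ 'D_v (fun x => (G x).1) q = ('D_v G q).1.
Proof.
move=> dG.
have dG' : (fun h : R => h^-1 *: ((G \o shift q) (h *: v) - G q)) @ 0^' --> 'D_v G q := dG.
have c : (fun h : R => (h^-1 *: ((G \o shift q) (h *: v) - G q)).1) @ 0^' --> ('D_v G q).1.
  exact: (cvg_comp _ _ dG' cvg_fst).
split; first by apply: cvgP c.
exact: (cvg_lim _ c).
Qed.

Lemma derivable_snd (V : normedModType R) (G : V -> R * R) (q v : V) :
  derivable G q v ->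
  derivable (fun x => (G x).2) q v /\ 'D_v (fun x => (G x).2) q = ('D_v G q).2.
Proof.
move=> dG.
have dG' : (fun h : R => h^-1 *: ((G \o shift q) (h *: v) - G q)) @ 0^' --> 'D_v G q := dG.
have c : (fun h : R => (h^-1 *: ((G \o shift q) (h *: v) - G q)).2) @ 0^' --> ('D_v G q).2.
  exact: (cvg_comp _ _ dG' cvg_snd).
split; first by apply: cvgP c.
exact: (cvg_lim _ c).
Qed.

Lemma continuous_at_eq (V W : normedModType R) (f g : V -> W) (p : V) :
  (\forall q \near p, f q = g q) -> {for p, continuous f} -> {for p, continuous g}.
Proof.
move=> E cf; change (g @ p --> g p); rewrite -(nbhs_singleton E).
by apply: cvg_trans cf; exact: near_eq_cvg.
Qed.

(** [Ck] only provides directional derivatives; this is what turns them into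
differentials, and so gives access to the chain rule. *)
Lemma Ck1_differentiable (U : set (R * R)) (G : R * R -> R * R) (p : R * R) :
  open U -> U p -> Ck 1 U G -> differentiable G p.
Proof.
move=> oU Up [cG dG].
have nU : \forall q \near p, U q by exact: open_nbhs_nbhs.
have d v : \forall q \near p, derivable G q v.
  by apply: filterS nU => q Uq; exact: (dG v).1.
have c v : {for p, continuous ('D_v G)}.
  by have [c _] := (dG v).2; apply: c; rewrite inE.
have D1 : differentiable (fun x => (G x).1) p.
  apply: differentiable_scalar_R2.
  - by apply: filterS (d e1) => q /derivable_fst[].
  - by apply: filterS (d e2) => q /derivable_fst[].
  - apply: (@continuous_at_eq _ _ (fun x => ('D_e1 G x).1)).
      by apply: filterS (d e1) => q /derivable_fst[].
    exact: (cvg_comp _ _ (c e1) cvg_fst).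
  - apply: (@continuous_at_eq _ _ (fun x => ('D_e2 G x).1)).
      by apply: filterS (d e2) => q /derivable_fst[].
    exact: (cvg_comp _ _ (c e2) cvg_fst).
have D2 : differentiable (fun x => (G x).2) p.
  apply: differentiable_scalar_R2.
  - by apply: filterS (d e1) => q /derivable_snd[].
  - by apply: filterS (d e2) => q /derivable_snd[].
  - apply: (@continuous_at_eq _ _ (fun x => ('D_e1 G x).2)).
      by apply: filterS (d e1) => q /derivable_snd[].
    exact: (cvg_comp _ _ (c e1) cvg_snd).
  - apply: (@continuous_at_eq _ _ (fun x => ('D_e2 G x).2)).
      by apply: filterS (d e2) => q /derivable_snd[].
    exact: (cvg_comp _ _ (c e2) cvg_snd).
have -> : G = (fun x => ((G x).1, (G x).2)) by apply/funext => x; case: (G x).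
exact: differentiable_pair.
Qed.

Lemma derive_comp (U V W : normedModType R) (f : U -> V) (g : V -> W) (a v : U) :
  differentiable f a -> differentiable g (f a) ->
  'D_v (g \o f) a = 'D_('D_v f a) g (f a).
Proof.
move=> df dg; rewrite deriveE; last exact: differentiable_comp.
by rewrite diff_comp// (deriveE _ dg) (deriveE _ df).
Qed.

Lemma derive_basis (W : normedModType R) (G : R * R -> W) (p v : R * R) :
  differentiable G p -> 'D_v G p = v.1 *: 'D_e1 G p + v.2 *: 'D_e2 G p.
Proof.
move=> dG; rewrite !(deriveE _ dG) [in LHS](pair_basis v).
by rewrite linearD !linearZ.
Qed.

Lemma Ck_sub (V W : normedModType R) n (U U' : set V) (f : V -> W) :
  U' `<=` U -> Ck n U f -> Ck n U' f.
Proof.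
move=> UU'; elim: n f => [|n IH] f [cf df]; split=> //.
- by move=> p; rewrite inE => /UU' Up; apply: cf; rewrite inE.
- by move=> p; rewrite inE => /UU' Up; apply: cf; rewrite inE.
- by move=> v; have [d c] := df v; split; [move=> p /UU'/d|exact: IH].
Qed.

Lemma Ck_eq (V W : normedModType R) n (U : set V) (f g : V -> W) :
  open U -> (forall p, U p -> f p = g p) -> Ck n U f -> Ck n U g.
Proof.
move=> oU; elim: n f g => [|n IH] f g E [cf df].
all: have En p : U p -> \forall q \near p, f q = g q
  by move=> Up; apply: filterS (open_nbhs_nbhs (conj oU Up)) => q /E.
all: split=> //.
- move=> p pU; have := cf _ pU; move: pU; rewrite inE => Up.
  rewrite /continuous_at -(E _ Up) => c; apply: cvg_trans c.
  by apply: near_eq_cvg; apply: En.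
- move=> p pU; have := cf _ pU; move: pU; rewrite inE => Up.
  rewrite /continuous_at -(E _ Up) => c; apply: cvg_trans c.
  by apply: near_eq_cvg; apply: En.
- move=> v; have [d c] := df v; split.
    by move=> p Up; apply: near_eq_derivable (d _ Up); exact: En.
  by apply: IH c => p Up; apply: near_eq_derive; exact: En.
Qed.

Lemma CkW (V W : normedModType R) n (U : set V) (f : V -> W) :
  Ck n.+1 U f -> Ck n U f.
Proof.
elim: n f => [|n IH] f [cf df]; split=> // v.
by have [d c] := df v; split => //; exact: IH.
Qed.

Lemma CkD (V W : normedModType R) n (U : set V) (f g : V -> W) :
  open U -> Ck n U f -> Ck n U g -> Ck n U (fun x => f x + g x).
Proof.
move=> oU; elim: n f g => [|n IH] f g [cf df] [cg dg]; split=> //.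
- by move=> p pU; apply: continuousD; [exact: cf|exact: cg].
- by move=> p pU; apply: continuousD; [exact: cf|exact: cg].
move=> v; have [d c] := df v; have [d' c'] := dg v; split.
  by move=> p Up; apply: derivableD; [exact: d|exact: d'].
apply: Ck_eq oU _ (IH _ _ c c') => p Up.
by rewrite deriveD//; [exact: d|exact: d'].
Qed.

Lemma cvg_line (V : normedModType R) (u v : V) :
  (fun s : R => s *: v + u) @ (0 : R) --> u.
Proof.
rewrite -[X in _ --> X](add0r u) -[X in _ --> X + _](scale0r v).
by apply: cvgD; [apply: cvgZr_tmp; exact: cvg_id|exact: cvg_cst].
Qed.

Lemma derive_scale (V W : normedModType R) (k : V -> R) (f : V -> W) (p v : V) :
  {for p, continuous k} -> derivable k p v -> derivable f p v ->
  derivable (fun x => k x *: f x) p v /\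
  'D_v (fun x => k x *: f x) p = k p *: 'D_v f p + 'D_v k p *: f p.
Proof.
move=> ck dk df.
have cl : (fun h : R => h *: v + p) @ 0^' --> p.
  by apply: cvg_trans (@cvg_line V p v); apply: cvg_app; exact: cvg_within.
have c : (fun h : R => h^-1 *: (((fun x => k x *: f x) \o shift p) (h *: v) - k p *: f p))
    @ 0^' --> k p *: 'D_v f p + 'D_v k p *: f p.
  have -> : (fun h : R => h^-1 *: (((fun x => k x *: f x) \o shift p) (h *: v) - k p *: f p))
   = (fun h : R => k (h *: v + p) *: (h^-1 *: ((f \o shift p) (h *: v) - f p)) +
       (h^-1 *: ((k \o shift p) (h *: v) - k p)) *: f p).
    apply/funext => h /=; rewrite -[h^-1 *: (_ - k p)]/(h^-1 * (_ - k p)).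
    rewrite -(scalerA h^-1 _ (f p)) [k (_ + _) *: (_ *: _)]scalerA [X in X *: (f _ - _)]mulrC.
    rewrite -(scalerA h^-1 _ (_ - _)) -[RHS]scalerDr; congr (_ *: _).
    by rewrite scalerBr scalerBl addrA subrK.
  have A1 : (fun h : R => k (h *: v + p) *: (h^-1 *: ((f \o shift p) (h *: v) - f p)))
      @ 0^' --> k p *: 'D_v f p by apply: cvgZ df; exact: (cvg_comp _ _ cl ck).
  have A2 : (fun h : R => (h^-1 *: ((k \o shift p) (h *: v) - k p)) *: f p)
      @ 0^' --> 'D_v k p *: f p by apply: cvgZ dk _; exact: cvg_cst.
  exact: (cvgD A1 A2).
split; first by apply: cvgP c.
exact: (cvg_lim _ c).
Qed.

Lemma CkZ (V W : normedModType R) n (U : set V) (k : V -> R) (f : V -> W) :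
  open U -> Ck n U k -> Ck n U f -> Ck n U (fun x => k x *: f x).
Proof.
move=> oU; elim: n k f => [|n IH] k f Hk Hf.
  case: Hk Hf => [ck _] [cf _]; split=> // p pU.
  by apply: continuousZ; [exact: ck|exact: cf].
have [Wk Wf] := (CkW Hk, CkW Hf).
case: Hk Hf => [ck dk] [cf df]; split.
  by move=> p pU; apply: continuousZ; [exact: ck|exact: cf].
move=> v; have [d c] := dk v; have [d' c'] := df v.
have H p : U p -> _ := fun Up => @derive_scale _ _ k f p v (ck p (mem_set Up)) (d _ Up) (d' _ Up).
split; first by move=> p /H[].
apply: Ck_eq oU _ (CkD oU (IH _ _ Wk c') (IH _ _ c Wf)) => p Up.
by have [_ ->] := H p Up.
Qed.

Lemma Ck_fst (V : normedModType R) n (U : set V) (G : V -> R * R) :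
  open U -> Ck n U G -> Ck n U (fun x => (G x).1).
Proof.
move=> oU; elim: n G => [|n IH] G [cG dG]; split=> //.
- by move=> p pU; exact: (cvg_comp _ _ (cG p pU) cvg_fst).
- by move=> p pU; exact: (cvg_comp _ _ (cG p pU) cvg_fst).
move=> v; have [d c] := dG v; split; first by move=> p /d/derivable_fst[].
by apply: Ck_eq oU _ (IH _ c) => p /d/derivable_fst[].
Qed.

Lemma Ck_snd (V : normedModType R) n (U : set V) (G : V -> R * R) :
  open U -> Ck n U G -> Ck n U (fun x => (G x).2).
Proof.
move=> oU; elim: n G => [|n IH] G [cG dG]; split=> //.
- by move=> p pU; exact: (cvg_comp _ _ (cG p pU) cvg_snd).
- by move=> p pU; exact: (cvg_comp _ _ (cG p pU) cvg_snd).
move=> v; have [d c] := dG v; split; first by move=> p /d/derivable_snd[].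
by apply: Ck_eq oU _ (IH _ c) => p /d/derivable_snd[].
Qed.

(** By induction on n, from the formula D_v (G o h) = h_1' (D_e1 G o h) + h_2' (D_e2 G o h).
The hypotheses ask for one derivative more than the conclusion gives, because
the formula comes from the differentials of h and G. *)
Lemma Ck_comp n (U : set R) (Om : set (R * R)) (h : R -> R * R) (G : R * R -> R * R) :
  open U -> open Om -> Ck n.+1 U h -> Ck n.+1 Om G -> U `<=` h @^-1` Om ->
  Ck n U (G \o h).
Proof.
move=> oU oOm; elim: n G => [|n IH] G Hh HG UOm.
  split=> // p pU; apply: continuous_comp; first exact: (Hh.1 p pU).
  by apply: HG.1; rewrite inE; apply: UOm; rewrite -inE.
have dh t : U t -> differentiable h t.
  by move=> Ut; apply/derivable1_diffP; exact: (Hh.2 1).1.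
have HG1 : Ck 1 Om G.
  by case: HG => cG dG; split => // v; have [d [c _]] := dG v.
have dG t : U t -> differentiable G (h t).
  by move=> Ut; apply: (Ck1_differentiable oOm (UOm _ Ut) HG1).
split.
  move=> p pU; apply: continuous_comp; first exact: (Hh.1 p pU).
  by apply: HG.1; rewrite inE; apply: UOm; rewrite -inE.
move=> v; split.
  by move=> t Ut; apply: diff_derivable; apply: differentiable_comp; [exact: dh|exact: dG].
have Hv : Ck n.+1 U ('D_v h) := (Hh.2 v).2.
have Hh' : Ck n.+1 U h := CkW Hh.
have C1 := IH _ Hh' (HG.2 e1).2 UOm.
have C2 := IH _ Hh' (HG.2 e2).2 UOm.
apply: Ck_eq oU _ (CkD oU (CkZ oU (Ck_fst oU (CkW Hv)) C1) (CkZ oU (Ck_snd oU (CkW Hv)) C2)).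
move=> t Ut; rewrite (derive_comp _ (dh _ Ut) (dG _ Ut)).
by rewrite (derive_basis _ (dG _ Ut)).
Qed.

End Calculus.

(** * Smooth maps and curves on a surface *)

Section SurfaceSmooth.
Context {R : realType} {S : surface R}.
Implicit Types (c : chart R S) (f k : S -> S) (p q : S).

Lemma chart_map_continuous c p : atlas c -> chart_dom c p ->
  {for p, continuous (chart_map c)}.
Proof.
move=> /surf_chart[oc _ cc _ _] dp.
by move: cc; rewrite continuous_open_subspace// => /(_ p (mem_set dp)).
Qed.

Lemma chart_dom_near c p : atlas c -> chart_dom c p ->
  \forall q \near p, chart_dom c q.
Proof. by move=> /surf_chart[oc _ _ _ _] dp; exact: open_nbhs_nbhs. Qed.

Lemma chart_mapK c p : atlas c -> chart_dom c p ->
  chart_inv c (chart_map c p) = p.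
Proof. by move=> /surf_chart[_ _ _ _ K] dp; apply: K; rewrite inE. Qed.

Lemma chart_half c p : atlas c -> chart_dom c p -> 0 <= (chart_map c p).2.
Proof.
move=> /surf_chart[_ [W _ E] _ _ _] dp.
have : (chart_map c @` chart_dom c) (chart_map c p) by exists p.
by rewrite E => -[].
Qed.

Lemma chart_image_near c p : atlas c -> chart_dom c p -> (chart_map c p).2 != 0 ->
  \forall u \near chart_map c p, (chart_map c @` chart_dom c) u.
Proof.
move=> ac dp n0; have /surf_chart[_ [W oW E] _ _ _] := ac.
have W0 : W (chart_map c p).
  have : (chart_map c @` chart_dom c) (chart_map c p) by exists p.
  by rewrite E => -[].
have pos : 0 < (chart_map c p).2 by rewrite lt0r n0 chart_half.
rewrite E; apply: filterI; first exact: open_nbhs_nbhs.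
have : \forall u \near (chart_map c p).2, 0 <= u.
  by apply: filterS (lt_nbhsr pos) => u /ltW.
exact: (@cvg_snd _ _ _ _ _ _).
Qed.

Lemma within_near (T U : topologicalType) (A : set T) (g : T -> U) (x : T) (B : set U) :
  {within A, continuous g} -> A x -> nbhs (g x) B ->
  \forall y \near x, A y -> B (g y).
Proof. by move=> /subspace_continuousP H Ax Bx; have /(_ B Bx) := H x Ax. Qed.

Lemma near_open (T : topologicalType) (x : T) (P : set T) : nbhs x P ->
  exists V, [/\ open V, V x & V `<=` P].
Proof. by rewrite nbhsE => -[V [oV Vx] VP]; exists V. Qed.

Lemma cts_near (T U : topologicalType) (g : T -> U) (x : T) (P : set U) :
  {for x, continuous g} -> (\forall y \near g x, P y) -> \forall z \near x, P (g z).
Proof. by move=> cg; exact: cg. Qed.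

Lemma smooth_self_continuous f : smooth_self f -> continuous f.
Proof.
move=> sf p B Bp; have [c ac dp] := surf_cover p.
have [cf _] := sf c ac.
have im : (chart_map c @` chart_dom c) (chart_map c p) by exists p.
have := @within_near _ _ _ _ _ B cf im; rewrite /= (chart_mapK ac dp) => /(_ Bp) H.
have H' := chart_map_continuous ac dp H.
apply: filterS (filterI (chart_dom_near ac dp) H') => q [dq] /=.
by rewrite (chart_mapK ac dq); apply; exists q.
Qed.

(** A smooth self-map read in charts is only known on the image of a chart, which near
the boundary is not open in the plane; G is an extension to an open set. *)
Lemma smooth_self_ext f c c' p : smooth_self f -> atlas c -> atlas c' ->
  chart_dom c p -> chart_dom c' (f p) ->
  exists G, [/\ exists2 U, open U /\ U (chart_map c p) & forall n, Ck n U G,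
    G (chart_map c p) = chart_map c' (f p) &
    \forall u \near chart_map c p, forall q, chart_dom c q -> chart_map c q = u ->
      chart_dom c' (f q) -> G u = chart_map c' (f q)].
Proof.
move=> sf ac ac' dp dfp; have [_ /(_ c' ac') sm] := sf c ac.
have [|G [U [oU Uu CG E]]] := sm (chart_map c p).
  by split; [exists p|rewrite /= (chart_mapK ac dp)].
have E' q : chart_dom c q -> U (chart_map c q) -> chart_dom c' (f q) ->
    G (chart_map c q) = chart_map c' (f q).
  move=> dq Uq dfq; rewrite -E//= ?(chart_mapK ac dq)//.
  by split => //; exists q.
exists G; split; [by exists U|exact: E'|].
apply: filterS (open_nbhs_nbhs (conj oU Uu)) => u {}Uu q dq qu.
by rewrite -qu; apply: E' => //; rewrite qu.
Qed.

(** Smoothness at an interior time, where no extension of the curve is needed. *)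
Definition smooth_at (g : R -> S) (t : R) := forall c, atlas c -> chart_dom c (g t) ->
  exists U : set R, [/\ open U, U t, U `<=` g @^-1` chart_dom c &
    forall n, Ck n U (chart_map c \o g)].

Lemma near_itv01 (t : R) : t \in `]0, 1[ -> \forall s \near t, s \in `]0, 1[.
Proof. exact: near_in_itvoo. Qed.

Lemma itv01W (t : R) : t \in `]0, 1[ -> t \in `[0, 1].
Proof. exact: subset_itv_oo_cc. Qed.

Lemma smooth_into_at (g : R -> S) (t : R) : smooth_into (`[0, 1]%classic : set R) g -> t \in `]0, 1[ ->
  smooth_at g t.
Proof.
move=> [cg sg] t01 c ac dgt.
have It : (`[0, 1]%classic : set R) t by exact: itv01W.
have [|h [U [oU Ut Ch E]]] := sg c ac t.
  by split.
have nd : \forall s \near t, chart_dom c (g s).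
  apply: filterS (filterI (within_near cg It (chart_dom_near ac dgt)) (near_itv01 t01)).
  by move=> s [+ /itv01W]; apply.
have [V [oV Vt VH]] := near_open (filterI (filterI nd (near_itv01 t01)) (open_nbhs_nbhs (conj oU Ut))).
exists V; split => //; first by move=> s /VH[[]].
move=> n; have CV : Ck n V h by apply: Ck_sub (Ch n) => s /VH[].
apply: Ck_eq oV _ CV => s Vs; have [[ds /itv01W s01] Us] := VH _ Vs.
by rewrite -E.
Qed.

Lemma smooth_at_continuous (g : R -> S) (t : R) : smooth_at g t -> {for t, continuous g}.
Proof.
move=> sg B Bg; have [c ac dg] := surf_cover (g t).
have [U [oU Ut Ud CU]] := sg c ac dg.
have /surf_chart[_ _ _ ci _] := ac.
have im : (chart_map c @` chart_dom c) (chart_map c (g t)) by exists (g t).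
have := @within_near _ _ _ _ _ B ci im; rewrite (chart_mapK ac dg) => /(_ Bg) H.
have H' := (CU 0%N).1 t (mem_set Ut) _ H.
apply: filterS (filterI (open_nbhs_nbhs (conj oU Ut)) H') => s [Us] /=.
by rewrite (chart_mapK ac (Ud _ Us)); apply; exists (g s) => //; exact: Ud.
Qed.

Lemma smooth_at_eq (g g' : R -> S) (t : R) : (\forall s \near t, g s = g' s) ->
  smooth_at g t -> smooth_at g' t.
Proof.
move=> E sg c ac; rewrite -(nbhs_singleton E) => dg.
have [U [oU Ut Ud CU]] := sg c ac dg.
have [V [oV Vt VH]] := near_open (filterI (open_nbhs_nbhs (conj oU Ut)) E).
exists V; split => //; first by move=> s /VH[/Ud + sE]; rewrite /= sE.
move=> n; have CV : Ck n V (chart_map c \o g) by apply: Ck_sub (CU n) => s /VH[].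
by apply: Ck_eq oV _ CV => s /VH[_ /= ->].
Qed.

Lemma smooth_at_comp f (g : R -> S) (t : R) : smooth_self f -> smooth_at g t ->
  smooth_at (f \o g) t.
Proof.
move=> sf sg c' ac' dfg; have [c ac dg] := surf_cover (g t).
have [U [oU Ut Ud CU]] := sg c ac dg.
have [G [[Om [oO Og] CG] _ EG]] := smooth_self_ext sf ac ac' dg dfg.
have cg : {for t, continuous (chart_map c \o g)} := (CU 0%N).1 t (mem_set Ut).
have n1 : \forall s \near t, Om (chart_map c (g s)).
  exact: (cg _ (open_nbhs_nbhs (conj oO Og))).
have n2 := cts_near cg EG.
have n3 : \forall s \near t, chart_dom c' (f (g s)).
  have cfg : {for t, continuous (f \o g)}.
    by apply: continuous_comp; [exact: smooth_at_continuous|exact: smooth_self_continuous].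
  exact: (cfg _ (chart_dom_near ac' dfg)).
have [V [oV Vt VH]] := near_open (filterI (filterI (open_nbhs_nbhs (conj oU Ut)) n1) (filterI n2 n3)).
exists V; split => //; first by move=> s /VH[_ []].
move=> n; have CV : Ck n.+1 V (chart_map c \o g) by apply: Ck_sub (CU _) => s /VH[[]].
have VO : V `<=` (chart_map c \o g) @^-1` Om by move=> s /VH[[]].
apply: Ck_eq oV _ (Ck_comp oV oO CV (CG _) VO) => s /VH[[Us Os] [Es ds]].
by apply: (Es (g s)) => //; exact: Ud.
Qed.

(** Whatever G is, the velocity of f o g depends linearly on the one of g; in
particular it vanishes when the latter does. *)
Lemma derive_smooth_comp f (g : R -> S) (t : R) c c' : smooth_self f -> smooth_at g t ->
  atlas c -> atlas c' -> chart_dom c (g t) -> chart_dom c' (f (g t)) ->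
  exists G : R * R -> R * R,
    'D_1 (chart_map c' \o (f \o g)) t = 'D_('D_1 (chart_map c \o g) t) G (chart_map c (g t)).
Proof.
move=> sf sg ac ac' dg dfg.
have [U [oU Ut Ud CU]] := sg c ac dg.
have [G [[Om [oO Og] CG] _ EG]] := smooth_self_ext sf ac ac' dg dfg.
have cg : {for t, continuous (chart_map c \o g)} := (CU 0%N).1 t (mem_set Ut).
have n2 := cts_near cg EG.
have n3 : \forall s \near t, chart_dom c' (f (g s)).
  have cfg : {for t, continuous (f \o g)}.
    by apply: continuous_comp; [exact: smooth_at_continuous|exact: smooth_self_continuous].
  exact: (cfg _ (chart_dom_near ac' dfg)).
have E : \forall s \near t, (G \o (chart_map c \o g)) s = (chart_map c' \o (f \o g)) s.
  apply: filterS (filterI (filterI n2 n3) (open_nbhs_nbhs (conj oU Ut))) => s [[Es ds] Us].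
  by apply: (Es (g s)) => //; exact: Ud.
exists G; rewrite -(near_eq_derive _ E) derive_comp//.
  by apply/derivable1_diffP; exact: ((CU 1%N).2 1).1.
exact: (Ck1_differentiable oO Og (CG 1%N)).
Qed.

Definition regular_at (g : R -> S) (t : R) := forall c, atlas c -> chart_dom c (g t) ->
  'D_1 (chart_map c \o g) t != 0.

(** The velocity of g is obtained from the one of f o g by the inverse of f. *)
Lemma regular_at_comp f (g : R -> S) (t : R) : diffeo f -> smooth_at g t ->
  regular_at g t -> regular_at (f \o g) t.
Proof.
move=> [k [sf sk fK kK]] sg rg c' ac' dfg; have [c ac dg] := surf_cover (g t).
apply/eqP => D0.
have kfg : k \o (f \o g) = g by apply/funext => s /=; rewrite fK.
have dkfg : chart_dom c (k ((f \o g) t)) by rewrite /= fK.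
have [G] := derive_smooth_comp sk (smooth_at_comp sf sg) ac' ac dfg dkfg.
rewrite kfg D0 derive0 => /eqP.
by rewrite (negbTE (rg _ ac dg)).
Qed.

(** At an interior time the velocity does not depend on the chosen extension of
the curve. *)
Lemma velocity_derive (g : R -> S) (t : R) c v : t \in `]0, 1[ -> {for t, continuous g} ->
  velocity g t c v -> v = 'D_1 (chart_map c \o g) t.
Proof.
move=> t01 cg [ac dg [h [U [oU Ut _ E]] ->]]; apply: near_eq_derive.
have nd : \forall s \near t, chart_dom c (g s) := cg _ (chart_dom_near ac dg).
apply: filterS (filterI (filterI nd (near_itv01 t01)) (open_nbhs_nbhs (conj oU Ut))).
by move=> s [[ds /itv01W s01] Us]; rewrite -E.
Qed.

Lemma derive_velocity (g : R -> S) (t : R) c : smooth_at g t -> atlas c ->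
  chart_dom c (g t) -> velocity g t c ('D_1 (chart_map c \o g) t).
Proof.
move=> sg ac dg; have [U [oU Ut Ud CU]] := sg c ac dg.
by split => //; exists (chart_map c \o g) => //; exists U.
Qed.

Lemma smooth_into_regular (g : R -> S) (t : R) : smooth_into (`[0, 1]%classic : set R) g -> t \in `]0, 1[ ->
  (forall (t : R) c v, t \in `[0, 1] -> velocity g t c v -> v != 0) ->
  regular_at g t.
Proof.
move=> sg t01 H c ac dg; apply: (H t c _ (itv01W t01)).
by apply: derive_velocity => //; exact: smooth_into_at.
Qed.

(** The second component has an interior minimum at u. *)
Lemma derive_snd_min (G : R * R -> R * R) (u v : R * R) : differentiable G u ->
  (G u).2 = 0 -> (\forall w \near u, 0 <= (G w).2) -> ('D_v G u).2 = 0.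
Proof.
move=> dG G0 Gmin; pose phi s := (G (s *: v + u)).2.
have [dphi <-] := derivable_snd (@diff_derivable _ _ _ G u v dG).
set L := 'D_v _ _.
have cL : (fun h : R => h^-1 * phi h) @ 0^' --> L.
  have : (fun h : R => h^-1 *: (((fun x => (G x).2) \o shift u) (h *: v) - (G u).2)) @ 0^' --> L.
    exact: dphi.
  by rewrite G0; under eq_fun do rewrite subr0.
have pos : \forall s \near (0 : R), 0 <= phi s.
  have c0 := @cvg_line R _ u v.
  exact: (c0 _ Gmin).
apply/eqP/negPn/negP => L0.
have eL : 0 < `|L| / 2 by rewrite divr_gt0// normr_gt0.
have /cvgrPdist_lt /(_ _ eL) H := cL.
have [r r0 Hr] := near_ball_norm (filterI pos H).
have r2 : `|r / 2| = r / 2 by rewrite ger0_norm// divr_ge0// ltW.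
have rr : r / 2 < r by rewrite ltr_pdivrMr// ltr_pMr// ltr1n.
have rn0 : r / 2 != 0 by rewrite gt_eqF// divr_gt0.
(* the difference quotient is at least 0 at r / 2 and at most 0 at - (r / 2) *)
have [p1 q1] := Hr (r / 2) ltac:(by rewrite sub0r normrN r2).
have [p2 q2] := Hr (- (r / 2)) ltac:(by rewrite sub0r opprK r2).
have {}q1 : `|L - (r / 2)^-1 * phi (r / 2)| < `|L| / 2 by exact: q1.
have {}q2 : `|L - (- (r / 2))^-1 * phi (- (r / 2))| < `|L| / 2.
  by apply: q2; rewrite oppr_eq0.
have i0 : 0 < (r / 2)^-1 by rewrite invr_gt0 divr_gt0.
have m1 : 0 <= (r / 2)^-1 * phi (r / 2) by rewrite mulr_ge0// ltW.
have m2 : 0 <= (r / 2)^-1 * phi (- (r / 2)) by rewrite mulr_ge0// ltW.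
move: q1 q2; rewrite invrN mulNr opprK.
move: m1 m2; set x := _ * phi _; set y := _ * phi _ => x0 y0.
have [Lp|Ln] := lerP 0 L.
  rewrite (ger0_norm Lp) !ltr_norml => /andP[_ _] /andP[_]; lra.
rewrite (ltr0_norm Ln) !ltr_norml => /andP[+ _] /andP[_ _]; lra.
Qed.

Lemma derive_horizontal (W : normedModType R) (G : R * R -> W) (p v : R * R) :
  differentiable G p -> v.2 = 0 -> 'D_v G p = v.1 *: 'D_e1 G p.
Proof. by move=> dG v2; rewrite derive_basis// v2 scale0r addr0. Qed.

Lemma e1_e2_not_parallel (a b : R) (X : R * R) : e1 = a *: X -> e2 = b *: X -> False.
Proof.
case: X => x y [a1 a0] [b0 b1].
have : 1 = (a * x) * (b * y) :> R by rewrite -[a * x]a1 -[b * y]b1 mulr1.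
have -> : (a * x) * (b * y) = (a * y) * (b * x) by ring.
by rewrite -[a * y]a0 mul0r => /eqP; rewrite oner_eq0.
Qed.

(** If f sent an interior point p to the boundary, then, read in charts, the second
component of f would be minimal at p, so that the differential of f would have
rank at most 1 there. The inverse of f read in charts would then send e1 and e2 to
multiples of a single vector, although its composition with f is the identity. *)
Lemma diffeo_boundary f c p : diffeo f -> bd S (f p) -> atlas c -> chart_dom c p ->
  (chart_map c p).2 = 0.
Proof.
move=> [k [sf sk fK kK]] [c' [ac' dfp fp0]] ac dp; apply/eqP/negPn/negP => n0.
have [G [[U [oU Uu] CG] Gu EG]] := smooth_self_ext sf ac ac' dp dfp.
have dkfp : chart_dom c (k (f p)) by rewrite fK.
have [K [[Om [oO Og] CK] _ EK]] := smooth_self_ext sk ac' ac dfp dkfp.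
set u0 := chart_map c p in Uu Gu EG n0.
have dG : differentiable G u0 by exact: (Ck1_differentiable oU Uu (CG 1%N)).
have dK : differentiable K (G u0) by rewrite Gu; exact: (Ck1_differentiable oO Og (CK 1%N)).
have im : \forall u \near u0, exists q, [/\ chart_dom c q, chart_map c q = u & chart_dom c' (f q)].
  have /surf_chart[_ _ _ ci _] := ac.
  have imu : (chart_map c @` chart_dom c) u0 by exists p.
  have nf : \forall q \near p, chart_dom c' (f q).
    exact: (smooth_self_continuous sf (chart_dom_near ac' dfp)).
  have := @within_near _ _ _ _ _ _ ci imu; rewrite (chart_mapK ac dp) => /(_ _ nf) H.
  apply: filterS (filterI (chart_image_near ac dp n0) H) => u [[q dq qu] Hu].
  by exists q; split => //; move: (Hu); rewrite -qu (chart_mapK ac dq); apply; exists q.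
have EKG : \forall u \near u0, (K \o G) u = u.
  have cG : {for u0, continuous G} by exact: differentiable_continuous.
  have EK' : \forall w \near G u0, forall q, chart_dom c' q -> chart_map c' q = w ->
      chart_dom c (k q) -> K w = chart_map c (k q) by rewrite Gu; exact: EK.
  have nK := cts_near cG EK'.
  apply: filterS (filterI (filterI im EG) nK) => u [[[q [dq qu dfq]] EGu] EKu].
  rewrite /= (EKu (f q))// ?fK//; last by rewrite (EGu q).
have G2 : \forall u \near u0, 0 <= (G u).2.
  apply: filterS (filterI im EG) => u [[q [dq qu dfq]] EGu].
  by rewrite (EGu q)// chart_half.
have G0 : (G u0).2 = 0 by rewrite Gu.
have D v : v = ('D_v G u0).1 *: 'D_e1 K (G u0).
  have E1 : 'D_v (K \o G) u0 = v by rewrite (near_eq_derive _ EKG) derive_id.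
  have E2 := derive_comp v dG dK.
  have E3 := derive_horizontal dK (derive_snd_min v dG G0 G2).
  exact: (etrans (esym E1) (etrans E2 E3)).
exact: e1_e2_not_parallel (D e1) (D e2).
Qed.

Lemma diffeo_bd f p : diffeo f -> bd S (f p) <-> bd S p.
Proof.
move=> df; split.
  by move=> bfp; have [c ac dp] := surf_cover p; exists c; split => //; exact: diffeo_boundary bfp _ _.
move=> bp; have [k [sf sk fK kK]] := df.
have dk : diffeo k by exists f.
have [c ac dp] := surf_cover (f p); exists c; split => //.
by apply: (@diffeo_boundary k) => //; rewrite fK.
Qed.

End SurfaceSmooth.

(** * The two sides of a plane curve *)

Section Plane.
Context {R : realType}.

Lemma near_rightP (x : R) (P : R -> Prop) : (\forall e \near x^'+, P e) <->
  exists2 r : R, 0 < r & forall e, x < e < x + r -> P e.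
Proof.
split.
  rewrite near_withinE => /nbhs_normP[r /= r0 H]; exists r => // e /andP[e1 e2].
  by apply: H => //=; rewrite ltr_norml; lra.
move=> [r r0 H]; near=> e; apply: H; apply/andP; split; near: e.
  exact: nbhs_right_gt.
by apply: nbhs_right_lt; rewrite ltrDl.
Unshelve. all: by end_near. Qed.

Lemma near_leftP (x : R) (P : R -> Prop) : (\forall e \near x^'-, P e) <->
  exists2 r : R, 0 < r & forall e, x - r < e < x -> P e.
Proof.
split.
  rewrite near_withinE => /nbhs_normP[r /= r0 H]; exists r => // e /andP[e1 e2].
  by apply: H => //=; rewrite ltr_norml; lra.
move=> [r r0 H]; near=> e; apply: H; apply/andP; split; near: e.
  by apply: nbhs_left_gt; rewrite ltrBlDr ltrDl.
exact: nbhs_left_lt.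
Unshelve. all: by end_near. Qed.

Lemma near_rightI (x : R) (P Q : R -> Prop) : (\forall e \near x^'+, P e) ->
  (\forall e \near x^'+, Q e) -> \forall e \near x^'+, P e /\ Q e.
Proof. by move=> HP HQ; near=> e; split; near: e. Unshelve. all: by end_near. Qed.

Lemma near_rightS (x : R) (P Q : R -> Prop) : (forall e, P e -> Q e) ->
  (\forall e \near x^'+, P e) -> \forall e \near x^'+, Q e.
Proof. by move=> H; apply: filterS. Qed.

Lemma right_proper (t : R) (Q : R -> Prop) : (\forall s \near t^'+, Q s) -> exists s, Q s.
Proof.
move=> /near_rightP[r r0 Hr]; exists (t + r / 2); apply: Hr.
by rewrite ltrDl divr_gt0//= ltrD2l ltr_pdivrMr// ltr_pMr// ltr1n.
Qed.

Lemma left_proper (t : R) (Q : R -> Prop) : (\forall s \near t^'-, Q s) -> exists s, Q s.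
Proof.
move=> /near_leftP[r r0 Hr]; exists (t - r / 2); apply: Hr.
by rewrite ltrD2l ltrN2 ltr_pdivrMr// ltr_pMr// ltr1n/= gtrBl divr_gt0.
Qed.

Lemma near_left_lt (t a : R) : a < t -> \forall s \near t^'-, a < s < t.
Proof.
move=> at_; apply/near_leftP; exists (t - a); first by rewrite subr_gt0.
by move=> s; rewrite opprB addrC subrK.
Qed.

Definition dot (v u : R * R) : R := v.1 * u.1 + v.2 * u.2.

Lemma det2_dot (v u : R * R) : det2 v u = dot (turn v) u.
Proof. rewrite /det2 /dot /turn /=; ring. Qed.

Lemma dotD (v u w : R * R) : dot v (u + w) = dot v u + dot v w.
Proof. rewrite /dot -[(u + w).1]/(u.1 + w.1) -[(u + w).2]/(u.2 + w.2); ring. Qed.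

Lemma dotZ (v u : R * R) (a : R) : dot v (a *: u) = a * dot v u.
Proof. rewrite /dot -[(a *: u).1]/(a * u.1) -[(a *: u).2]/(a * u.2); ring. Qed.

Lemma dotC (u v : R * R) : dot u v = dot v u.
Proof. rewrite /dot; ring. Qed.

Lemma det2_dot_self (v : R * R) : 0 = dot v (turn v).
Proof. rewrite /dot /turn /=; ring. Qed.

Lemma dot_turn (v : R * R) : dot v v = dot (turn v) (turn v).
Proof. rewrite /dot /turn /=; ring. Qed.

Lemma dot_self_gt0 (v : R * R) : v != 0 -> 0 < dot v v.
Proof.
case: v => x y; rewrite /dot /= => v0; have [x0|x0] := eqVneq x 0; last first.
  by rewrite ltr_pwDl// -expr2 ?exprn_even_gt0// sqr_ge0.
rewrite x0 mul0r add0r -expr2 exprn_even_gt0//=.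
by apply: contraNneq v0 => ->; rewrite x0.
Qed.

Lemma dot_det_id (v g z : R * R) :
  det2 v z * dot v g - det2 v g * dot v z = dot v v * det2 g z.
Proof. rewrite /det2 /dot; ring. Qed.

Lemma scalar_id (p q r t sg : R) : r != 0 ->
  sg * (p - q / r * t) = sg * (p * r - q * t) / r.
Proof. by move=> r0; field. Qed.

Lemma dot_cvg (T : Type) (F : set_system T) {FF : Filter F} (g : T -> R * R)
    (l v : R * R) : g @ F --> l -> (fun x => dot v (g x)) @ F --> dot v l.
Proof.
move=> c.
have c1 : (fun x => (g x).1) @ F --> l.1 by exact: (cvg_comp _ _ c cvg_fst).
have c2 : (fun x => (g x).2) @ F --> l.2 by exact: (cvg_comp _ _ c cvg_snd).
have d1 : (fun x => v.1 * (g x).1) @ F --> v.1 * l.1 by exact: cvgMl_tmp.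
have d2 : (fun x => v.2 * (g x).2) @ F --> v.2 * l.2 by exact: cvgMl_tmp.
exact: (cvgD d1 d2).
Qed.

Lemma det2_cvg (T : Type) (F : set_system T) {FF : Filter F} (g : T -> R * R)
    (l v : R * R) : g @ F --> l -> (fun x => det2 v (g x)) @ F --> det2 v l.
Proof.
move=> c; rewrite det2_dot; have -> : (fun x => det2 v (g x)) = (fun x => dot (turn v) (g x)).
  by apply/funext => x; rewrite det2_dot.
exact: dot_cvg.
Qed.

Lemma near_gt (T : Type) (F : set_system T) {FF : Filter F} (f : T -> R) (y z : R) :
  f @ F --> y -> z < y -> \forall x \near F, z < f x.
Proof. by move=> c zy; apply: cvgr_gt c _ zy. Qed.

Lemma near_lt (T : Type) (F : set_system T) {FF : Filter F} (f : T -> R) (y z : R) :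
  f @ F --> y -> y < z -> \forall x \near F, f x < z.
Proof. by move=> c zy; apply: cvgr_lt c _ zy. Qed.

Lemma continuous_fst_comp (f : R -> R) (w : R * R) : {for w.1, continuous f} ->
  (fun x : R * R => f x.1) @ w --> f w.1.
Proof.
move=> cf; have c : {for w, continuous (fst : R * R -> R)} by exact: cvg_fst.
exact: (continuous_comp c cf).
Qed.

Lemma dot_continuous (v : R * R) : continuous (dot v).
Proof. by move=> u; exact: (@dot_cvg _ (nbhs u) _ id u v cvg_id). Qed.

Lemma det2_continuous (v : R * R) : continuous (det2 v).
Proof. by move=> u; exact: (@det2_cvg _ (nbhs u) _ id u v cvg_id). Qed.

Lemma is_derive_dot (v : R * R) (g : R -> R * R) (s : R) : derivable g s 1 ->
  is_derive s 1 (fun r => dot v (g r)) (dot v ('D_1 g s)).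
Proof.
move=> dg; have [d1 e1'] := derivable_fst dg; have [d2 e2'] := derivable_snd dg.
rewrite /dot -e1' -e2'.
have D1 : is_derive s 1 (fun r => v.1 * (g r).1) (v.1 * 'D_1 (fun x => (g x).1) s).
  exact: (is_deriveZ v.1 (derivableP d1)).
have D2 : is_derive s 1 (fun r => v.2 * (g r).2) (v.2 * 'D_1 (fun x => (g x).2) s).
  exact: (is_deriveZ v.2 (derivableP d2)).
exact: (is_deriveD D1 D2).
Qed.

Lemma deriv_est (g : R -> R) (s a eta : R) : is_derive s 1 g a -> 0 < eta ->
  exists2 r : R, 0 < r & forall h, `|h| < r -> `|g (s + h) - g s - a * h| <= eta * `|h|.
Proof.
move=> [dg Dg] eta0.
have c : (fun h : R => h^-1 *: ((g \o shift s) (h *: 1) - g s)) @ 0^' --> a.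
  by rewrite -Dg; exact: dg.
have /cvgrPdist_le /(_ _ eta0) := c.
rewrite near_withinE => /nbhs_normP[r /= r0 H]; exists r => // h hr.
have [->|h0] := eqVneq h 0; first by rewrite addr0 subrr mulr0 subrr !normr0 mulr0.
have := H h; rewrite /= sub0r normrN => /(_ hr h0) {}H.
have -> : g (s + h) - g s - a * h = - (a - h^-1 * (g (h * 1 + s) - g s)) * h.
  by rewrite mulr1 [h + s]addrC; field.
by rewrite normrM normrN ler_wpM2r.
Qed.

(** At first order al (s + h) grows like a h, and az moves by at most O(e), so some s'
at distance O(e) from s satisfies al s' = az e. On that scale ph moves by o(e)
only, while pz grows like f e with f > 0. *)
Lemma offset_aux (al ph az pz : R -> R) (s a b f rho : R) :
  is_derive s 1 al a -> is_derive s 1 ph 0 ->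
  is_derive (0 : R) 1 az b -> is_derive (0 : R) 1 pz f ->
  az 0 = al s -> pz 0 = ph s -> 0 < a -> 0 < f -> 0 < rho ->
  (forall s', `|s' - s| < rho -> {for s', continuous al}) ->
  \forall e \near (0 : R)^'+, exists s', [/\ `|s' - s| < rho, al s' = az e & ph s' < pz e].
Proof.
move=> dal dph daz dpz az0 pz0 a0 f0 rho0 cal.
(* az moves by at most B e, and al takes all these values within C e of s; eta makes
   the variation of ph over that range at most f e / 4 *)
pose B := `|b| + 1; have B0 : 0 < B by rewrite ltr_wpDl.
pose C := 2 * B / a; have C0 : 0 < C by rewrite divr_gt0// mulr_gt0.
pose eta := f / (4 * C); have eta0 : 0 < eta by rewrite divr_gt0// mulr_gt0.
have a20 : 0 < a / 2 by rewrite divr_gt0.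
have f20 : 0 < f / 4 by rewrite divr_gt0.
have [r1 r10 H1] := deriv_est dal a20.
have [r2 r20 H2] := deriv_est dph eta0.
have [r3 r30 H3] := deriv_est daz ltr01.
have [r4 r40 H4] := deriv_est dpz f20.
apply/near_rightP.
pose r := Num.min (Num.min r3 r4) (Num.min rho (Num.min r1 r2) / C).
have r0 : 0 < r by rewrite !lt_min r30 r40/= divr_gt0// !lt_min rho0 r10 r20.
exists r => // e; rewrite add0r => /andP[e0].
rewrite !lt_min ltr_pdivlMr// !lt_min => /andP[/andP[er3 er4] /and3P[eC1 eC2 eC3]].
set h := C * e; have hE : e * C = h by rewrite mulrC.
rewrite hE in eC1 eC2 eC3; have h0 : 0 < h by rewrite mulr_gt0.
have absh : `|h| = h by rewrite gtr0_norm.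
have abse : `|e| = e by rewrite gtr0_norm.
have aeB : `|az e - al s| <= B * e.
  have := H3 e; rewrite abse add0r az0 mul1r => /(_ er3) H.
  have -> : az e - al s = (az e - al s - b * e) + b * e by ring.
  apply: (le_trans (ler_normD _ _)); rewrite normrM abse /B mulrDl mul1r addrC.
  by rewrite lerD2l.
have ah : a / 2 * h = B * e by rewrite /h /C; field; rewrite gt_eqF.
have up : al s + B * e <= al (s + h).
  have := H1 h; rewrite absh => /(_ eC2); rewrite ler_norml => /andP[+ _].
  by rewrite -ah; lra.
have dn : al (s - h) <= al s - B * e.
  have := H1 (- h); rewrite normrN absh => /(_ eC2); rewrite ler_norml => /andP[_].
  by rewrite -ah; lra.
have sh : s - h <= s + h by lra.
have cc : {within `[s - h, s + h], continuous al}.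
  apply: continuous_in_subspaceT => x; rewrite inE /= in_itv/= => /andP[x1 x2].
  by apply: cal; rewrite ltr_norml; lra.
move: aeB; rewrite ler_norml => /andP[ae1 ae2].
have [|s' s'in als'] := IVT (v := az e) sh cc.
  by rewrite ge_min le_max; apply/andP; split; apply/orP; [left|right]; lra.
move: s'in; rewrite in_itv/= => /andP[s1 s2].
have s'h : `|s' - s| <= h by rewrite ler_norml; lra.
exists s'; split => //; first exact: le_lt_trans eC1.
have p1 := H2 _ (le_lt_trans s'h eC3).
have := H4 e; rewrite abse add0r pz0 => /(_ er4); rewrite ler_norml => /andP[p2 _].
move: p1; rewrite [s + _]addrC subrK mul0r subr0 ler_norml => /andP[_ p1].
have p3 : eta * `|s' - s| <= eta * h by rewrite ler_wpM2l// ltW.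
have p4 : eta * h = f / 4 * e by rewrite /eta /h; field; rewrite gt_eqF.
have fe : 0 < f * e by rewrite mulr_gt0.
by lra.
Qed.

(** Take sg = 1. A point z e leaving the curve g to the left ends up above the curve, in
the coordinates dot v and det2 v, in which g is locally a graph over the first
coordinate. This reduces to [offset_aux] by shearing the second coordinate so
that its derivative along g vanishes at s. For sg = -1, left and above become right
and below. *)
Lemma offset (v : R * R) (sg : R) (g z : R -> R * R) (s rho : R) :
  derivable g s 1 -> derivable z 0 1 -> z 0 = g s -> 0 < dot v ('D_1 g s) ->
  0 < sg * det2 ('D_1 g s) ('D_1 z 0) -> 0 < rho ->
  (forall s', `|s' - s| < rho -> {for s', continuous g}) ->
  \forall e \near (0 : R)^'+, exists s', [/\ `|s' - s| < rho, dot v (g s') = dot v (z e) &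
     0 < sg * (det2 v (z e) - det2 v (g s'))].
Proof.
move=> dg dz z0 A0 D0 rho0 cg.
set g' := 'D_1 g s in A0 D0; set z' := 'D_1 z 0 in D0.
(* w is the sheared coordinate det2 v - k * dot v, up to the sign sg *)
pose k := det2 v g' / dot v g'.
pose w := sg *: (turn v - k *: v).
have wE u : dot w u = sg * (det2 v u - k * dot v u).
  by rewrite /w dotC dotZ dotD -scaleNr dotZ det2_dot ![dot u _]dotC mulNr.
have dw : is_derive s 1 (fun r => dot w (g r)) 0.
  have -> : 0 = dot w g' by rewrite wE /k divfK ?gt_eqF// subrr mulr0.
  exact: is_derive_dot.
have nv : 0 < dot v v.
  by apply: dot_self_gt0; apply: contraTneq A0 => ->; rewrite /dot /= !mul0r addr0 ltxx.
have fpos : 0 < dot w z'.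
  have -> : dot w z' = dot v v * (sg * det2 g' z') / dot v g'.
    by rewrite wE /k mulrCA -dot_det_id scalar_id// gt_eqF.
  by rewrite divr_gt0// mulr_gt0.
have cal s' : `|s' - s| < rho -> {for s', continuous (fun r => dot v (g r))}.
  by move=> /cg c; exact: dot_cvg c.
have := @offset_aux _ _ _ _ s _ _ _ rho (is_derive_dot v dg) dw (is_derive_dot v dz)
  (is_derive_dot w dz).
rewrite z0 => /(_ erefl erefl A0 fpos rho0 cal).
apply: filterS => e [s' [s1 s2 s3]]; exists s'; split => //.
by move: s3; rewrite !wE s2 -subr_gt0 -mulrBr opprB addrA subrK.
Qed.

Lemma convex_connected (V : normedModType R) (A : set V) :
  (forall x y, A x -> A y -> forall l : R, 0 <= l <= 1 -> A (l *: (y - x) + x)) ->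
  connected A.
Proof.
move=> cvx; have [[x Ax]|/set0P/negP/negPn/eqP->] := pselect (A !=set0); last exact: connected0.
have -> : A = \bigcup_(y in A) ((fun l : R => l *: (y - x) + x) @` `[0, 1]).
  apply/seteqP; split=> [y Ay|y [z Az [l]]].
    by exists y => //; exists 1; rewrite /= ?in_itv/= ?lexx ?ler01// scale1r subrK.
  by rewrite /= in_itv/= => l01 <-; exact: cvx.
apply: bigcup_connected.
  by exists x => y Ay; exists 0; rewrite /= ?in_itv/= ?lexx ?ler01// scale0r add0r.
move=> y Ay; apply: connected_continuous_connected; first exact: segment_connected.
apply: continuous_subspaceT => l.
by apply: cvgD; [apply: cvgZr_tmp; exact: cvg_id|exact: cvg_cst].
Qed.

(** The point with prescribed products [dot v] and [det2 v]. *)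
Definition frame (v : R * R) (a b : R) : R * R :=
  (dot v v)^-1 *: (a *: v + b *: turn v).

Lemma dot_frame (v : R * R) (a b : R) : 0 < dot v v -> dot v (frame v a b) = a.
Proof.
move=> v0; rewrite dotZ dotD !dotZ -det2_dot_self mulr0 addr0 mulrCA mulVf ?mulr1//.
by rewrite gt_eqF.
Qed.

Lemma det2_frame (v : R * R) (a b : R) : 0 < dot v v -> det2 v (frame v a b) = b.
Proof.
move=> v0; rewrite det2_dot dotZ dotD !dotZ dotC -det2_dot_self mulr0 add0r.
by rewrite -dot_turn mulrCA mulVf ?mulr1// gt_eqF.
Qed.

Lemma frameK (v u : R * R) : 0 < dot v v -> frame v (dot v u) (det2 v u) = u.
Proof.
move=> v0; have vn0 : dot v v != 0 by rewrite gt_eqF.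
case: u v v0 vn0 => [u1 u2] [v1 v2] _; rewrite /frame /dot /det2 /turn /= => vn0.
congr pair.
  rewrite -[LHS]/((v1 * v1 + v2 * v2)^-1 * ((v1 * u1 + v2 * u2) * v1 + (v1 * u2 - v2 * u1) * - v2)).
  by field.
rewrite -[LHS]/((v1 * v1 + v2 * v2)^-1 * ((v1 * u1 + v2 * u2) * v2 + (v1 * u2 - v2 * u1) * v1)).
by field.
Qed.

Lemma frame_cvg (T : Type) (F : set_system T) {FF : Filter F} (v : R * R)
    (f g : T -> R) (a b : R) :
  f @ F --> a -> g @ F --> b -> (fun x => frame v (f x) (g x)) @ F --> frame v a b.
Proof.
move=> fa gb; rewrite /frame; apply: cvgZl_tmp.
have c1 : (fun x => f x *: v) @ F --> a *: v by exact: cvgZr_tmp.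
have c2 : (fun x => g x *: turn v) @ F --> b *: turn v by exact: cvgZr_tmp.
exact: (cvgD c1 c2).
Qed.

(** In the coordinates dot v and det2 v, where v is the velocity at t, the curve is
locally the graph of a function of the first coordinate. The two sides are the
parts of a thin box above and below the graph; they are connected as images of
rectangles. The last clause is [offset], for all times near t at once. *)
Lemma two_sides (U : set R) (g : R -> R * R) (t : R) :
  open U -> U t -> Ck 1 U g -> 'D_1 g t != 0 ->
  exists2 d1 : R, 0 < d1 & forall d, 0 < d <= d1 -> forall Om, nbhs (g t) Om ->
  exists V L Rt : set (R * R),
  [/\ nbhs (g t) V, V `<=` Om, L `|` Rt `<=` V, connected L & connected Rt] /\
  [/\ forall s, `|s - t| < d -> ~ L (g s) /\ ~ Rt (g s),
      forall u, V u -> [\/ L u, Rt u | exists2 s, `|s - t| < d & u = g s] &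
      \forall s \near t, \forall e \near (0 : R)^'+,
        L (g s + e *: turn ('D_1 g s)) /\ Rt (g s - e *: turn ('D_1 g s))].
Proof.
move=> oU Ut [cg dg] Dt0; set v := 'D_1 g t in Dt0.
have vv := dot_self_gt0 Dt0.
have cD : {for t, continuous ('D_1 g)} by have [c _] := (dg 1).2; apply: c; rewrite inE.
have nA : \forall s \near t, 0 < dot v ('D_1 g s).
  have c : (fun s => dot v ('D_1 g s)) @ t --> dot v v by exact: dot_cvg.
  exact: (near_gt c vv).
have [d1 d10 H1] := near_ball_norm (filterI (open_nbhs_nbhs (conj oU Ut)) nA).
have {}H1 s : `|s - t| < d1 -> U s /\ 0 < dot v ('D_1 g s) by rewrite distrC => /H1[].
have ders s : `|s - t| < d1 -> derivable g s 1 by move=> /H1[Us _]; exact: (dg 1).1.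
have cgs s : `|s - t| < d1 -> {for s, continuous g}.
  by move=> /H1[Us _]; apply: cg; rewrite inE.
pose al s := dot v (g s); pose be s := det2 v (g s).
have cal s : `|s - t| < d1 -> {for s, continuous al} by move=> /cgs c; exact: dot_cvg c.
have cbe s : `|s - t| < d1 -> {for s, continuous be}.
  by move=> /cgs c; exact: det2_cvg c.
have inc s s' : `|s - t| < d1 -> `|s' - t| < d1 -> s < s' -> al s < al s'.
  have itvE x : (x \in `]t - d1, t + d1[) = (`|x - t| < d1) by rewrite in_itv/= ltr_distl.
  rewrite -!itvE; apply: gtr0_derive1_lt_oo.
  - by move=> x; rewrite itvE => /ders /(is_derive_dot v)[].
  - move=> x; rewrite itvE => xd; have [_ Ax] := H1 _ xd.
    by have [_ E] := is_derive_dot v (ders _ xd); rewrite derive1E E.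
  - by move=> x; rewrite inE /= itvE => /cal.
have inj s s' : `|s - t| < d1 -> `|s' - t| < d1 -> al s = al s' -> s = s'.
  move=> sd sd' E; have [ss|ss|//] := ltgtP s s'.
    by have := inc _ _ sd sd' ss; rewrite E ltxx.
  by have := inc _ _ sd' sd ss; rewrite E ltxx.
exists d1 => // d /andP[d0 dd1] Om nOm.
set A0 := al t; set B0 := be t.
have [rho rho0 Hrho] : exists2 rho : R, 0 < rho & forall a b,
    `|a - A0| < rho -> `|b - B0| < rho -> Om (frame v a b).
  have c : (fun ab : R * R => frame v ab.1 ab.2) @ (A0, B0) --> g t.
    by rewrite -[g t](frameK _ vv); apply: frame_cvg; [exact: cvg_fst|exact: cvg_snd].
  have [rho rho0 H] := near_ball_norm (c _ nOm).
  exists rho => // a b aA bB; apply: (H (a, b)).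
  by rewrite prod_normE /= gt_max distrC aA distrC bB.
have t0 : `|t - t| < d1 by rewrite subrr normr0.
have [d3 d30 H3] : exists2 d3 : R, 0 < d3 & forall s, `|s - t| < d3 ->
    `|al s - A0| < rho /\ `|be s - B0| < rho.
  have /cvgrPdist_lt /(_ _ rho0) n1 := cal _ t0.
  have /cvgrPdist_lt /(_ _ rho0) n2 := cbe _ t0.
  have [d3 d30 H] := near_ball_norm (filterI n1 n2); exists d3 => // s.
  by rewrite distrC => /H[]; rewrite distrC => -> ; rewrite distrC => ->.
pose d2 := Num.min d d3 / 2.
have d20 : 0 < d2 by rewrite divr_gt0// lt_min d0 d30.
have d2m : d2 < Num.min d d3 by rewrite ltr_pdivrMr// ltr_pMr ?ltr1n// lt_min d0 d30.
have d2d : d2 < d by apply: lt_le_trans d2m _; rewrite ge_min lexx.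
have d2d3 : d2 < d3 by apply: lt_le_trans d2m _; rewrite ge_min lexx orbT.
have d2d1 : d2 < d1 := lt_le_trans d2d dd1.
have sub2 s : `|s - t| < d2 -> `|s - t| < d1 by move=> /lt_trans; apply.
have sub3 s : `|s - t| < d2 -> B0 - rho < be s < B0 + rho.
  by move=> /lt_trans/(_ d2d3)/H3[_]; rewrite ltr_distl.
have tm : `|t - d2 - t| = d2 by rewrite addrAC subrr sub0r normrN gtr0_norm.
have tp : `|t + d2 - t| = d2 by rewrite addrAC subrr add0r gtr0_norm.
have am : al (t - d2) < A0 by apply: inc; rewrite ?tm// gtrBl.
have ap : A0 < al (t + d2) by apply: inc; rewrite ?tp// ltrDl.
pose rect : set (R * R) := [set w | `|w.1 - t| < d2 /\ 0 < w.2 < 1].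
have rect_conn : connected rect.
  apply: convex_connected => -[x1 x2] [y1 y2] [/= X1 X2] [/= Y1 Y2] l /andP[l0 l1].
  have F (a b lo hi : R) : lo < a < hi -> lo < b < hi -> lo < l * (b - a) + a < hi.
    move=> /andP[a1 a2] /andP[b1 b2]; have [->|ln0] := eqVneq l 0.
      by rewrite mul0r add0r a1.
    have lp : 0 < l by rewrite lt0r ln0.
    have l1' : 0 <= 1 - l by rewrite subr_ge0.
    have -> : l * (b - a) + a = l * b + (1 - l) * a by ring.
    have e x : x = l * x + (1 - l) * x :> R by ring.
    by apply/andP; split; [rewrite [ltLHS]e|rewrite [ltRHS]e]; rewrite ltr_leD ?ltr_pM2l// ler_wpM2l// ltW.
  split; last exact: F.
  rewrite -[X in `|X - _|]/(l * (y1 - x1) + x1) ltr_distl; apply: F; rewrite -ltr_distl//.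
(* PhL and PhR fill the box above and below the graph: the second parameter runs
   linearly from the graph to the top, respectively the bottom *)
pose PhL w := frame v (al w.1) (be w.1 + w.2 * (B0 + rho - be w.1)).
pose PhR w := frame v (al w.1) (be w.1 - w.2 * (be w.1 - (B0 - rho))).
have FL (s x : R) : be s < B0 + rho ->
    PhL (s, (x - be s) / (B0 + rho - be s)) = frame v (al s) x.
  move=> b; rewrite /PhL /= divfK ?subr_eq0 ?gt_eqF//.
  by rewrite [be s + _]addrC subrK.
have FR (s x : R) : B0 - rho < be s ->
    PhR (s, (be s - x) / (be s - (B0 - rho))) = frame v (al s) x.
  move=> b; rewrite /PhR /= divfK ?subr_eq0 ?gt_eqF//.
  by rewrite opprB [be s + _]addrC subrK.
have c1 w : rect w -> (fun w : R * R => al w.1) @ w --> al w.1.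
  by move=> [/sub2 w1 _]; exact: continuous_fst_comp (cal _ w1).
have c2 w : rect w -> (fun w : R * R => be w.1) @ w --> be w.1.
  by move=> [/sub2 w1 _]; exact: continuous_fst_comp (cbe _ w1).
exists [set u | al (t - d2) < dot v u < al (t + d2) /\ `|det2 v u - B0| < rho].
exists (PhL @` rect), (PhR @` rect); split; [split|split].
- have cd : (fun u => dot v u) @ g t --> A0 := @dot_continuous v (g t).
  have ce : (fun u => det2 v u) @ g t --> B0 := @det2_continuous v (g t).
  have /cvgrPdist_lt /(_ _ rho0) n3 := ce.
  apply: filterS (filterI (filterI (near_gt cd am) (near_lt cd ap)) n3) => u [[u1 u2] u3].
  by split; [rewrite u1 u2|rewrite distrC].
- move=> u [/andP[u1 u2] u3]; rewrite -(frameK u vv); apply: Hrho => //.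
  have [+ _] := H3 (t - d2) ltac:(by rewrite tm).
  have [+ _] := H3 (t + d2) ltac:(by rewrite tp).
  by rewrite !ltr_distl => /andP[_ x1] /andP[x2 _]; apply/andP; split; [exact: lt_trans u1|exact: lt_trans x1].
- have W w : rect w -> al (t - d2) < al w.1 < al (t + d2).
    move=> [w1 _]; apply/andP; split; apply: inc; rewrite ?tm ?tp ?sub2//;
    by move: w1; rewrite ltr_distl => /andP[].
  move=> u [[w rw <-]|[w rw <-]]; rewrite /= dot_frame// det2_frame//; split; try exact: W.
    have [w1 /andP[w2 w3]] := rw; have /andP[b1 b2] := sub3 _ w1.
    rewrite ltr_distl; apply/andP; split.
      by apply: lt_le_trans b1 _; rewrite lerDl mulr_ge0 ?ltW// subr_gt0.
    rewrite [ltRHS](_ : _ = be w.1 + 1 * (B0 + rho - be w.1)); last by ring.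
    by rewrite ltrD2l ltr_pM2r// subr_gt0.
  have [w1 /andP[w2 w3]] := rw; have /andP[b1 b2] := sub3 _ w1.
  rewrite ltr_distl; apply/andP; split; last first.
    by apply: le_lt_trans b2; rewrite gerBl mulr_ge0 ?ltW// subr_gt0.
  rewrite [ltLHS](_ : _ = be w.1 - 1 * (be w.1 - (B0 - rho))); last by ring.
  by rewrite ltrD2l ltrN2 ltr_pM2r// subr_gt0.
- apply: connected_continuous_connected => //.
  apply: continuous_in_subspaceT => w; rewrite inE => rw.
  apply: frame_cvg; first exact: c1.
  apply: cvgD; first exact: c2.
  by apply: cvgM; [exact: cvg_snd|apply: cvgB; [exact: cvg_cst|exact: c2]].
- apply: connected_continuous_connected => //.
  apply: continuous_in_subspaceT => w; rewrite inE => rw.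
  apply: frame_cvg; first exact: c1.
  apply: cvgB; first exact: c2.
  by apply: cvgM; [exact: cvg_snd|apply: cvgB; [exact: c2|exact: cvg_cst]].
- move=> s /lt_le_trans/(_ dd1) sd; split=> -[w [w1 /andP[w2 w3]] E].
    have E1 := congr1 (dot v) E; have E2 := congr1 (det2 v) E.
    rewrite dot_frame// in E1; rewrite det2_frame// in E2.
    have ws := inj _ _ (sub2 _ w1) sd E1; have /andP[b1 b2] := sub3 _ w1.
    have P : 0 < w.2 * (B0 + rho - be w.1) by rewrite mulr_gt0// subr_gt0.
    by move: P E2; rewrite ws -/(be s); move: (_ * _) => q q0; lra.
  have E1 := congr1 (dot v) E; have E2 := congr1 (det2 v) E.
  rewrite dot_frame// in E1; rewrite det2_frame// in E2.
  have ws := inj _ _ (sub2 _ w1) sd E1; have /andP[b1 b2] := sub3 _ w1.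
  have P : 0 < w.2 * (be w.1 - (B0 - rho)) by rewrite mulr_gt0// subr_gt0.
  by move: P E2; rewrite ws -/(be s); move: (_ * _) => q q0; lra.
- move=> u [/andP[u1 u2]]; rewrite ltr_distl => /andP[u3 u4].
  have tt : t - d2 <= t + d2 by lra.
  have cc : {within `[t - d2, t + d2], continuous al}.
    apply: continuous_in_subspaceT => x; rewrite inE /= in_itv/= => /andP[x1 x2].
    by apply: cal; apply: le_lt_trans d2d1; rewrite ler_norml; lra.
  have [|s sin als] := IVT (v := dot v u) tt cc.
    by rewrite ge_min le_max (ltW u1) (ltW u2) orbT.
  move: sin; rewrite in_itv/= => /andP[s1 s2].
  have sd : `|s - t| < d2.
    have n1 : s != t - d2 by apply: contraTneq u1 => <-; rewrite als ltxx.
    have n2 : s != t + d2 by apply: contraTneq u2 => <-; rewrite als ltxx.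
    by rewrite ltr_distl !lt_neqAle s1 s2 n2 eq_sym n1.
  have /andP[b1 b2] := sub3 _ sd.
  have [lt|lt|E] := ltgtP (be s) (det2 v u).
  + constructor 1; exists (s, (det2 v u - be s) / (B0 + rho - be s)).
      by split => //=; rewrite divr_gt0 ?subr_gt0//= ltr_pdivrMr ?subr_gt0// mul1r ltrD2r.
    by rewrite FL// als frameK.
  + constructor 2; exists (s, (be s - det2 v u) / (be s - (B0 - rho))).
      split => //=; rewrite divr_gt0 ?subr_gt0//= ltr_pdivrMr ?subr_gt0// mul1r.
      by rewrite ltrD2l ltrN2.
    by rewrite FR// als frameK.
  + constructor 3; exists s; first exact: lt_trans d2d.
    by rewrite -(frameK u vv) -als -E /al /be frameK.
have d40 : 0 < d2 / 2 by rewrite divr_gt0.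
have d42 : d2 / 2 < d2 by rewrite ltr_pdivrMr// ltr_pMr// ltr1n.
apply: (ball_norm_near d40) => s; rewrite distrC => st.
have sd1 : `|s - t| < d1 := lt_trans st (lt_trans d42 d2d1).
have As := (H1 _ sd1).2; set w := turn ('D_1 g s).
have dett : 0 < det2 ('D_1 g s) w.
  rewrite det2_dot dot_self_gt0//; apply: contraTneq As => w0.
  have -> : 'D_1 g s = 0.
    by move: w0; rewrite /w /turn; case: ('D_1 g s) => a b [/eqP]; rewrite oppr_eq0 => /eqP -> /= ->.
  by rewrite /dot /= !mulr0 addr0 ltxx.
pose zp (sg : R) e := g s + e *: (sg *: w).
have dzp sg : is_derive (0 : R) 1 (zp sg) (sg *: w).
  have -> : zp sg = cst (g s) + (fun e : R => e *: (sg *: w)) by [].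
  have D2 : is_derive (0 : R) 1 (fun e : R => e *: (sg *: w)) (sg *: w).
    have := @is_derive_line _ _ _ id 0 (sg *: w) 0 (@derivable_id _ _ _ _).
    by rewrite derive_id; under eq_fun do rewrite /= addr0.
  by rewrite -[sg *: w in X in is_derive _ _ _ X]add0r; exact: is_deriveD.
have zp0 sg : zp sg 0 = g s by rewrite /zp scale0r addr0.
have near_s s' : `|s' - s| < d2 / 2 -> `|s' - t| < d2.
  move=> h; apply: (le_lt_trans (ler_distD s _ _)).
  by rewrite [ltRHS]splitr ltrD.
have off (sg : R) : 0 < sg * sg -> \forall e \near (0 : R)^'+, exists s', [/\ `|s' - s| < d2 / 2,
    dot v (g s') = dot v (zp sg e) & 0 < sg * (det2 v (zp sg e) - det2 v (g s'))].
  move=> sg2; have [dz Dz] := dzp sg.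
  have D0 : 0 < sg * det2 ('D_1 g s) ('D_1 (zp sg) 0).
    by rewrite Dz det2_dot dotZ -det2_dot mulrA mulr_gt0.
  have cc s' : `|s' - s| < d2 / 2 -> {for s', continuous g} by move=> /near_s/sub2/cgs.
  exact: (offset (ders _ sd1) dz (zp0 sg) As D0 d40 cc).
have czp sg : (fun e => det2 v (zp sg e)) @ (0 : R)^'+ --> be s.
  have [/derivable1_diffP/differentiable_continuous cz _] := dzp sg.
  have : zp sg @ (0 : R)^'+ --> g s.
    by rewrite -(zp0 sg); apply: cvg_trans cz; apply: cvg_app; exact: cvg_within.
  exact: det2_cvg.
have /andP[bs1 bs2] := sub3 _ (lt_trans st d42).
have n1 : \forall e \near (0 : R)^'+, det2 v (zp 1 e) < B0 + rho by exact: near_lt (czp 1) bs2.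
have n2 : \forall e \near (0 : R)^'+, B0 - rho < det2 v (zp (-1) e) by exact: near_gt (czp (-1)) bs1.
have o1 := off 1 ltac:(by rewrite mulr1).
have o2 := off (-1) ltac:(by rewrite mulrNN mulr1).
apply: near_rightS (near_rightI (near_rightI n1 n2) (near_rightI o1 o2)).
move=> e [[m1 m2] [m3 m4]].
have zp1 : g s + e *: w = zp 1 e by rewrite /zp scale1r.
have zpN : g s - e *: w = zp (-1) e by rewrite /zp scaleN1r scalerN.
rewrite zp1 zpN; split.
  case: m3 => s' [/near_s s1 s2]; rewrite mul1r subr_gt0 => s3.
  exists (s', (det2 v (zp 1 e) - be s') / (B0 + rho - be s')).
    have /andP[c3 c4] := sub3 _ s1.
    by split => //=; rewrite divr_gt0 ?subr_gt0//= ltr_pdivrMr ?subr_gt0// mul1r ltrD2r.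
  have /andP[c3 c4] := sub3 _ s1.
  rewrite (FL _ _ c4).
  exact: (etrans (congr1 (fun a => frame v a _) s2) (frameK _ vv)).
case: m4 => s' [/near_s s1 s2]; rewrite mulN1r opprB subr_gt0 => s3.
have /andP[c3 c4] := sub3 _ s1.
exists (s', (be s' - det2 v (zp (-1) e)) / (be s' - (B0 - rho))).
  split => //=; rewrite divr_gt0 ?subr_gt0//= ltr_pdivrMr ?subr_gt0// mul1r.
  by rewrite ltrD2l ltrN2.
rewrite (FR _ _ c3).
exact: (etrans (congr1 (fun a => frame v a _) s2) (frameK _ vv)).
Qed.

End Plane.

(** * Curves and multiplicities read on the page *)

Section Copies.
Context {R : realType} (S : surface R).

Lemma copy_eq h h' (p p' : S) : copy h p = copy h' p' <->
  p = p' /\ (h = h' \/ bd S p).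
Proof.
transitivity (glued (p, h) (p', h')).
  split=> [E|E].
    by apply/(@eqquotP _ (glued_equiv S)); exact: E.
  have X := elimT (@eqmodP _ (glued_equiv S) (p, h) (p', h')) E.
  exact: X.
rewrite /glued /=; split=> [/andP[/eqP-> /orP[/eqP->|/asboolP]]|[-> [->|b]]];
  by rewrite ?eqxx; auto; rewrite asboolT ?orbT.
Qed.

Lemma copy_surj (q : doubled S) : exists h p, q = copy h p.
Proof.
exists (repr q).2, (repr q).1; rewrite /copy -surjective_pairing.
by rewrite reprK.
Qed.

Lemma copy_continuous h : continuous (copy h : S -> doubled S).
Proof.
move=> p; apply: (@continuous_comp _ _ _ (fun p => (p, h))).
  move=> B [[B1 B2] /= [n1 n2] sB]; apply: filterS n1 => q q1.
  by apply: sB; split => //=; exact: nbhs_singleton n2.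
exact: pi_continuous.
Qed.

End Copies.

Section HalfBeta.
Context {R : realType} {N m : nat} {D : open_book_diagram R N} (H : hkm_data m D).

Lemma itv01P (t : R) : t \in `[0, 1] -> t = 0 \/ t = 1 \/ t \in `]0, 1[.
Proof.
rewrite !in_itv/= => /andP[t0 t1]; have [->|n0] := eqVneq t 0; first by left.
have [->|n1] := eqVneq t 1; first by right; left.
by right; right; rewrite !lt_neqAle t0 t1 eq_sym n0 n1.
Qed.

Lemma regular_at_eq (S : surface R) (g g' : R -> S) (t : R) :
  (\forall s \near t, g s = g' s) -> regular_at g t -> regular_at g' t.
Proof.
move=> E rg c ac; rewrite -(nbhs_singleton E) => /(rg c ac).
rewrite (@near_eq_derive _ _ _ (chart_map c \o g) (chart_map c \o g'))//.
by apply: filterS E => s /= ->.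
Qed.

Lemma barc_diffeo i : exists2 f : D -> D, diffeo f &
  forall t : R, t \in `[0, 1] -> barc H i t = f (cut_arc D i t).
Proof.
have [psi [_ dpsi _ _] E] := barc_isotopic H i; exists (psi 1) => //.
by apply: dpsi; rewrite in_itv/= ler01 lexx.
Qed.

Lemma barc_smooth i (t : R) : t \in `]0, 1[ ->
  smooth_at (barc H i) t /\ regular_at (barc H i) t.
Proof.
move=> t01; have [f df E] := barc_diffeo i; have [k [sf _ _ _]] := df.
have [sa _ ra _ _] := arc_proper D i.
have sat := smooth_into_at sa t01; have rat := smooth_into_regular sa t01 ra.
have En : \forall s \near t, (f \o cut_arc D i) s = barc H i s.
  by apply: filterS (near_itv01 t01) => s /itv01W s01; rewrite E.
split; first exact: smooth_at_eq En (smooth_at_comp sf sat).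
exact: regular_at_eq En (regular_at_comp df sat rat).
Qed.

Lemma half_beta_smooth h i (t : R) : t \in `]0, 1[ ->
  smooth_at (half_beta H h i) t /\ regular_at (half_beta H h i) t.
Proof.
move=> t01; have [sb rb] := barc_smooth i t01; case: h => //.
have dm := monodromy_diffeo D; have [k [sm _ _ _]] := dm.
by split; [exact: smooth_at_comp|exact: regular_at_comp].
Qed.

Lemma half_beta_bd h i (t : R) : t \in `[0, 1] ->
  (bd D (half_beta H h i t) <-> t = 0 \/ t = 1).
Proof.
move=> t01; have [f df E] := barc_diffeo i.
have [_ _ _ /(_ t t01) ba _] := arc_proper D i.
have bb : bd D (barc H i t) <-> t = 0 \/ t = 1 by rewrite E// diffeo_bd.
by case: h => //=; rewrite (diffeo_bd _ (monodromy_diffeo D)).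
Qed.

Lemma diffeo_inj (S : surface R) (f : S -> S) : diffeo f -> injective f.
Proof. by move=> [k [_ _ fK _]]; exact: can_inj fK. Qed.

Lemma barc_inj i : {in `[0, 1] &, injective (barc H i)}.
Proof.
move=> s t s01 t01; have [f df E] := barc_diffeo i; rewrite !E// => /(diffeo_inj df).
by have [_ inj _ _ _] := arc_proper D i; exact: inj.
Qed.

Lemma half_beta_inj h i : {in `[0, 1] &, injective (half_beta H h i)}.
Proof.
move=> s t s01 t01; case: h => /=; first exact: barc_inj.
by move=> /(diffeo_inj (monodromy_diffeo D)); exact: barc_inj.
Qed.

Lemma withinP (T U : topologicalType) (A : set T) (g : T -> U) :
  {within A, continuous g} <-> forall x, A x -> g @ within A (nbhs x) --> g x.
Proof. exact: subspace_continuousP. Qed.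

Lemma barc_within i : {within `[0, 1]%classic, continuous (barc H i)}.
Proof.
have [f [k [sf _ _ _]] E] := barc_diffeo i.
have [[ca _] _ _ _ _] := arc_proper D i.
apply/withinP => t t01; rewrite E//.
have cf : (f \o cut_arc D i) @ within `[0, 1]%classic (nbhs t) --> f (cut_arc D i t).
  have /withinP/(_ t t01) c := ca.
  exact: (cvg_comp _ _ c (@smooth_self_continuous _ _ _ sf _)).
apply: cvg_trans cf; apply: near_eq_cvg; rewrite near_withinE.
by near=> s => s01; rewrite /= E.
Unshelve. all: by end_near. Qed.

Lemma half_beta_within h i : {within `[0, 1]%classic, continuous (half_beta H h i)}.
Proof.
case: h => /=; first exact: barc_within.
have [k [sm _ _ _]] := monodromy_diffeo D.
apply/withinP => t t01.
have /withinP/(_ t t01) c := @barc_within i.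
exact: (cvg_comp _ _ c (@smooth_self_continuous _ _ _ sm _)).
Qed.

Lemma trace_closed (S : surface R) (g : R -> S) (a b : R) :
  {within `[0, 1]%classic, continuous g} -> 0 <= a -> b <= 1 -> closed (g @` `[a, b]).
Proof.
move=> cg a0 b1; apply: compact_closed; first exact: surf_hausdorff.
apply: continuous_compact; last exact: segment_compact.
apply: continuous_subspaceW cg => t /=; rewrite !in_itv/= => /andP[ta tb].
by rewrite (le_trans a0 ta) (le_trans tb b1).
Qed.

Definition arcs : set D := \bigcup_i trace (cut_arc D i).
(** The preimage of the curves under [copy h]. *)
Definition page_curves h : set D := arcs `|` \bigcup_i trace (half_beta H h i).

Lemma arc_closed i : closed (trace (cut_arc D i)).
Proof. by have [[ca _] _ _ _ _] := arc_proper D i; exact: trace_closed. Qed.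

Lemma closed_bigcup_ord (A : 'I_N -> set D) : (forall i, closed (A i)) -> closed (\bigcup_i A i).
Proof. by move=> cA; apply: closed_bigcup => //; exact: finite_finset. Qed.

Lemma arcs_closed : closed arcs.
Proof. by apply: closed_bigcup_ord => i; exact: arc_closed. Qed.

Lemma page_curves_closed h : closed (page_curves h).
Proof.
apply: closedU; first exact: arcs_closed.
by apply: closed_bigcup_ord => i; apply: trace_closed => //; exact: half_beta_within.
Qed.

Lemma band0 (t : R) : t \in `[0, 1] -> band (0, t).
Proof. by rewrite in_itv/= => ?; split => //=; rewrite oppr_lt0 ltr01. Qed.

Lemma arc_band i (t : R) : t \in `[0, 1] -> (nu H i @` band) (cut_arc D i t).
Proof.
by move=> t01; have [_ _ _ _ E] := nu_tubular H i; exists (0, t); [exact: band0|exact: E].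
Qed.

Lemma band_inj i j p : (nu H i @` band) p -> (nu H j @` band) p -> i = j.
Proof.
move=> bi bj; apply/eqP/negPn/negP => /(nu_disjoint H) E.
by have : (set0 : set D) p by rewrite -E; split.
Qed.

Lemma barc_band i (t : R) : t \in `[0, 1] -> (nu H i @` band) (barc H i t).
Proof. by move=> t01; apply: barc_near; exists t. Qed.

Lemma half_beta_disjoint h i j (s t : R) : s \in `[0, 1] -> t \in `[0, 1] ->
  half_beta H h i s = half_beta H h j t -> i = j /\ s = t.
Proof.
move=> s01 t01 E; have E' : barc H i s = barc H j t.
  by case: h E => //= /(diffeo_inj (monodromy_diffeo D)).
have ij : i = j by apply: (@band_inj i j (barc H i s)); [|rewrite E']; exact: barc_band.
by subst j; split => //; exact: barc_inj E'.
Qed.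

(** The tubular neighbourhoods of the arcs are disjoint, so that a_i and b_j can only
meet for i = j, at the contact point. *)
Lemma arc_barc_disjoint i j (s t : R) : s \in `[0, 1] -> t \in `[0, 1] ->
  cut_arc D i s = barc H j t -> i = j /\ barc H j t = xi H i.
Proof.
move=> s01 t01 E.
have ij : i = j by apply: (@band_inj i j (barc H j t)); [rewrite -E; exact: arc_band|exact: barc_band].
subst j; split => //.
have : (trace (cut_arc D i) `&` trace (barc H i)) (barc H i t).
  by split; [exists s|exists t].
by rewrite xi_unique.
Qed.

(** The monodromy is the identity on the boundary, where the two copies are glued. *)
Lemma page_curves_bd p h h' : bd D p -> page_curves h p -> page_curves h' p.
Proof.
have idbd q : bd D q -> monodromy D q = q.
  by have [U [_ bU idU]] := monodromy_id D; move=> /bU; exact: idU.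
have E i (t : R) : t \in `[0, 1] -> bd D (half_beta H h i t) -> half_beta H h' i t = half_beta H h i t.
  move=> t01 b.
  have bb : bd D (barc H i t) := (@half_beta_bd true i t t01).2 ((@half_beta_bd h i t t01).1 b).
  by case: (h); case: (h') => //=; rewrite idbd.
move=> bp [Ap|[i _ [t t01 tp]]]; first by left.
by right; exists i => //; exists t => //; rewrite E// tp.
Qed.

Lemma curves_copy h p : curves H (copy h p) <-> page_curves h p.
Proof.
split.
  have B h' : page_curves h' p -> h' = h \/ bd D p -> page_curves h p.
    by move=> Kp [<-//|bp]; exact: page_curves_bd bp Kp.
  have C h' (A : set D) : (copy h' @` A) (copy h p) -> A p /\ (h' = h \/ bd D p).
    by move=> [q Aq /(copy_eq (S := D))[qp hb]]; rewrite -qp.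
  move=> [i _ [[]|[]]] /C[tp hb].
  - by left; exists i.
  - by left; exists i.
  - by apply: B hb; right; exists i.
  - by apply: B hb; right; exists i.
move=> [[i _ tp]|[i _ tp]]; exists i => //.
  by left; case: h; [left|right]; exists p.
by right; case: h tp; [left|right]; exists p.
Qed.

(** The multiplicity of P at [copy h p]; it is meaningful for p off the curves. *)
Definition mu (P : set (doubled D) -> int) h (p : D) : int := P (region_at H (copy h p)).

Lemma mu_connected P h (E : set D) p q : connected E -> E `<=` ~` page_curves h ->
  E p -> E q -> mu P h p = mu P h q.
Proof.
move=> cE EK Ep Eq; rewrite /mu /region_at.
suff : connected_component (~` curves H) (copy h p) (copy h q).
  by move=> /same_connected_component ->.
have cc : connected (copy h @` E).
  apply: connected_continuous_connected => //.
  by apply: continuous_subspaceT => z; exact: copy_continuous.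
have c1 : (copy h @` E) (copy h p) by exists p.
have c2 : copy h @` E `<=` ~` curves H by move=> _ [z Ez <-] /curves_copy; exact: EK.
by apply: (connected_component_max c1 c2 cc); exists q.
Qed.

(** Along the boundary the two copies of p are the same point of the double. *)
Lemma mu_bd P p : bd D p -> mu P true p = mu P false p.
Proof.
move=> bp; rewrite /mu; congr (P (region_at H _)).
by apply/copy_eq; split => //; right.
Qed.

Lemma chain2_not_region P r : chain2 H P -> ~ region H r -> P r = 0.
Proof. by move=> [_ c] nr; apply/eqP/negPn/negP => /c[]. Qed.

(** This is where the chain being made of unpointed regions is used. *)
Lemma mu_basept P (E : set D) p j : chain2 H P -> connected E ->
  E `<=` ~` page_curves true -> E p -> E (basept H j) -> mu P true p = 0.
Proof.
move=> [_ cP] cE EK Ep Ez; rewrite (mu_connected P cE EK Ep Ez).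
apply/eqP/negPn/negP => /cP[_ /(_ j)]; apply.
apply: subset_closure; apply: connected_component_refl => /curves_copy; exact: EK.
Qed.

End HalfBeta.

(** * The two sides of a beta-arc *)

Section Sides.
Context {R : realType}.

Lemma segment_sub (V : normedModType R) (P x y : V) (l : R) :
  P - (l *: (y - x) + x) = l *: (P - y) + (1 - l) *: (P - x).
Proof.
rewrite [(1 - l) *: _]scalerBl scale1r !scalerBr addrCA opprB.
have -> : l *: P - l *: y + (l *: x - l *: P) = l *: x - l *: y.
  by rewrite addrC addrA subrK.
by rewrite opprD opprB [_ - x]addrC addrA.
Qed.

(** A half-ball in a chart is convex. *)
Lemma locally_connected (S : surface R) (p : S) (Om : set S) : nbhs p Om ->
  exists E, [/\ nbhs p E, connected E & E `<=` Om].
Proof.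
move=> nOm; have [c ac dp] := surf_cover p.
have /surf_chart[_ [W oW im] _ ci _] := ac.
have imp : (chart_map c @` chart_dom c) (chart_map c p) by exists p.
have Wp : W (chart_map c p) by move: imp; rewrite im => -[].
have n1 := @within_near _ _ _ _ _ Om ci imp; rewrite (chart_mapK ac dp) in n1.
have [r r0 Hr] := near_ball_norm (filterI (open_nbhs_nbhs (conj oW Wp)) (n1 nOm)).
pose B := [set u : R * R | `|chart_map c p - u| < r /\ 0 <= u.2].
have Bim : B `<=` chart_map c @` chart_dom c.
  by move=> u [/Hr[Wu _] u2]; rewrite im.
exists (chart_inv c @` B); split.
- have n2 : \forall q \near p, `|chart_map c p - chart_map c q| < r.
    by have /cvgrPdist_lt := chart_map_continuous ac dp; exact.
  apply: filterS (filterI (chart_dom_near ac dp) n2) => q [dq qr].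
  by exists (chart_map c q); [split => //; exact: chart_half|exact: chart_mapK].
- apply: connected_continuous_connected; last exact: continuous_subspaceW ci.
  apply: convex_connected => x y [x1 x2] [y1 y2] l /andP[l0 l1]; split.
    set P := chart_map c p in x1 y1 *.
    have -> : P - (l *: (y - x) + x) = l *: (P - y) + (1 - l) *: (P - x).
      exact: segment_sub.
    apply: (le_lt_trans (ler_normD _ _)); rewrite !normrZ (ger0_norm l0) ger0_norm ?subr_ge0//.
    have -> : r = l * r + (1 - l) * r by ring.
    have [->|ln0] := eqVneq l 0; first by rewrite !mul0r !add0r subr0 !mul1r.
    by rewrite ltr_leD ?ltr_pM2l ?lt0r ?ln0// ler_wpM2l ?subr_ge0// ltW.
  rewrite -[_.2]/(l * (y.2 - x.2) + x.2).
  have -> : l * (y.2 - x.2) + x.2 = l * y.2 + (1 - l) * x.2 by ring.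
  by rewrite addr_ge0// mulr_ge0// subr_ge0.
- by move=> _ [u Bu <-]; have [_] := Hr u Bu.1; apply; exact: Bim.
Qed.

Lemma chart_inv_continuous (S : surface R) (c : chart R S) p : atlas c -> chart_dom c p ->
  (chart_map c p).2 != 0 -> {for chart_map c p, continuous (chart_inv c)}.
Proof.
move=> ac dp p2 B nB; have /surf_chart[_ _ _ ci _] := ac.
have imp : (chart_map c @` chart_dom c) (chart_map c p) by exists p.
by apply: filterS (filterI (chart_image_near ac dp p2) (within_near ci imp nB)) => u [iu]; exact.
Qed.

Lemma offset_near (S : surface R) (c : chart R S) p (B : set S) (w : R * R) :
  atlas c -> chart_dom c p -> (chart_map c p).2 != 0 -> nbhs p B ->
  \forall e \near (0 : R)^'+, B (chart_inv c (chart_map c p + e *: w)).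
Proof.
move=> ac dp p2 nB; have ci := chart_inv_continuous ac dp p2.
have nB' : nbhs (chart_inv c (chart_map c p)) B by rewrite chart_mapK.
have n1 := cts_near ci nB'.
have n2 : \forall e \near (0 : R), B (chart_inv c (e *: w + chart_map c p)).
  by have c0 := @cvg_line R _ (chart_map c p) w; exact: (c0 _ n1).
have [r r0 Hr] := near_ball_norm n2.
apply/near_rightP; exists r => // e; rewrite add0r => /andP[e0 er].
by rewrite addrC; apply: Hr; rewrite sub0r normrN gtr0_norm.
Qed.

Lemma open_disjoint_separated (T : topologicalType) (A B : set T) :
  open A -> open B -> A `&` B = set0 -> separated A B.
Proof.
have F (X Y : set T) : open Y -> X `&` Y = set0 -> closure X `&` Y = set0.
  move=> oY XY; apply/eqP/negPn/negP => /set0P[x [cx Yx]].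
  by have := cx Y (open_nbhs_nbhs (conj oY Yx)); rewrite XY => -[].
move=> oA oB AB; split; first exact: F.
by rewrite setIC; apply: F => //; rewrite setIC.
Qed.

Context {N m : nat} {D : open_book_diagram R N} (H : hkm_data m D).

Lemma half_beta_interior h i (t : R) c : t \in `]0, 1[ -> atlas c ->
  chart_dom c (half_beta H h i t) -> (chart_map c (half_beta H h i t)).2 != 0.
Proof.
move=> t01 ac dc; apply/eqP => c0; have /(half_beta_bd H h i)[+ _] := itv01W t01.
have b : bd D (half_beta H h i t) by exists c.
by move=> /(_ b) [E|E]; move: t01; rewrite E in_itv/= ltxx ?andbF.
Qed.

(** This is [two_sides] in a chart, once the neighbourhood has been shrunk so as to avoid
the a-arcs, the other beta-arcs and the part of this arc that is far from t. *)
Lemma sides_at h i (t : R) c : let g := half_beta H h i in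
  t \in `]0, 1[ -> ~ arcs (g t) -> atlas c -> chart_dom c (g t) ->
  exists V L Rt : set D,
  [/\ nbhs (g t) V, connected L, connected Rt, L `|` Rt `<=` ~` page_curves H h &
     V `<=` (L `|` Rt) `|` page_curves H h] /\
  \forall s \near t, \forall e \near (0 : R)^'+,
    L (chart_inv c (chart_map c (g s) + e *: turn ('D_1 (chart_map c \o g) s))) /\
    Rt (chart_inv c (chart_map c (g s) - e *: turn ('D_1 (chart_map c \o g) s))).
Proof.
move=> g t01 nA ac dgt; have [sg rg] := half_beta_smooth H h i t01.
have [U [oU Ut Ud CU]] := sg c ac dgt.
have [d1 d10 Hd] := two_sides oU Ut (CU 1%N) (rg c ac dgt).
have [d2 d20 H2] := near_ball_norm (filterI (near_itv01 t01) (open_nbhs_nbhs (conj oU Ut))).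
pose d := Num.min d1 d2; have d0 : 0 < d by rewrite lt_min d10 d20.
have dd1 : d <= d1 by rewrite ge_min lexx.
have {}H2 s : `|s - t| < d -> (s \in `]0, 1[) /\ U s.
  by rewrite distrC => sd; apply: H2; apply: lt_le_trans sd _; rewrite ge_min lexx orbT.
(* the curves other than the part of the arc at distance less than d from t *)
pose C : set D := arcs `|` (\bigcup_j (if j == i then set0 else trace (half_beta H h j)))
   `|` (g @` `[0, t - d] `|` g @` `[t + d, 1]).
have t01' := itv01W t01.
have gin : {in `[0, 1] &, injective g} by exact: half_beta_inj.
have /andP[tp0 tp1] : 0 < t < 1 by move: t01; rewrite in_itv.
have cC : closed C.
  apply: closedU; first apply: closedU; first exact: arcs_closed.
    apply: closed_bigcup_ord => j; case: ifP => _; first exact: closed0.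
    by apply: trace_closed => //; exact: half_beta_within.
  by apply: closedU; apply: trace_closed; rewrite ?lexx//; try exact: half_beta_within; lra.
have nC : ~ C (g t).
  move=> [[//|[j _]]|].
    have [//|ji [s s01 E]] := eqVneq j i.
    by have [ji' _] := half_beta_disjoint s01 t01' E; rewrite ji' eqxx in ji.
  move=> [] [s]; rewrite /= in_itv/= => /andP[s1 s2] E.
    have s01 : s \in `[0, 1] by rewrite in_itv/=; lra.
    by have := gin _ _ s01 t01' E; lra.
  have s01 : s \in `[0, 1] by rewrite in_itv/=; lra.
  by have := gin _ _ s01 t01' E; lra.
have int := half_beta_interior t01 ac dgt.
pose Om : set (R * R) := [set u | (chart_map c @` chart_dom c) u /\ ~ C (chart_inv c u)].
have nOm : nbhs (chart_map c (g t)) Om.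
  apply: filterI (chart_image_near ac dgt int) _.
  have nn : nbhs (chart_inv c (chart_map c (g t))) (~` C).
    by rewrite chart_mapK//; apply: open_nbhs_nbhs; split => //; exact: closed_openC.
  exact: (chart_inv_continuous ac dgt int nn).
have OmK u : Om u -> page_curves H h (chart_inv c u) ->
    exists2 s, `|s - t| < d & u = chart_map c (g s).
  move=> [[q dq <-]]; rewrite chart_mapK// => nCq Kq.
  have [s s01 gs] : exists2 s : R, s \in `[0, 1] & g s = q.
    case: Kq => [Aq|[j _ [s s01 gs]]]; first by case: nCq; left; left.
    have ji : j = i.
      apply/eqP/negPn/negP => ji; case: nCq; left; right; exists j => //.
      by rewrite (negbTE ji); exists s.
    by exists s => //; rewrite -gs ji.
  exists s; last by rewrite gs.
  move: s01; rewrite in_itv/= => /andP[s0 s1].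
  rewrite ltNge; apply/negP; rewrite ler_normr => /orP[h1|h1]; case: nCq; right.
    by right; exists s => //=; rewrite in_itv/= s1 andbT; lra.
  by left; exists s => //=; rewrite in_itv/= s0/=; lra.
have [|V [L [Rt [[nV VOm LRV cL cR] [nLR cov off]]]]] := Hd d _ Om nOm.
  by rewrite d0 dd1.
have /surf_chart[_ _ _ ci _] := ac.
have sub (X : set (R * R)) : X `<=` V -> {within X, continuous (chart_inv c)}.
  by move=> XV; apply: continuous_subspaceW ci => u /XV/VOm[].
exists [set q | chart_dom c q /\ V (chart_map c q)], (chart_inv c @` L), (chart_inv c @` Rt).
split; [split|].
- by apply: filterI (chart_dom_near ac dgt) _; exact: (chart_map_continuous ac dgt nV).
- apply: connected_continuous_connected => //; apply: sub => u Lu; apply: LRV; by left.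
- apply: connected_continuous_connected => //; apply: sub => u Lu; apply: LRV; by right.
- move=> _ [[u Lu <-]|[u Ru <-]] Ku.
    have [s sd us] := OmK u (VOm _ (LRV _ (or_introl Lu))) Ku.
    by have [nL _] := nLR s sd; apply: nL; rewrite /= -us.
  have [s sd us] := OmK u (VOm _ (LRV _ (or_intror Ru))) Ku.
  by have [_ nR] := nLR s sd; apply: nR; rewrite /= -us.
- move=> q [dq Vq]; have [Lq|Rq|[s sd qs]] := cov _ Vq.
  + by left; left; exists (chart_map c q) => //; exact: chart_mapK.
  + by left; right; exists (chart_map c q) => //; exact: chart_mapK.
  + right; right; exists i => //; exists s; first exact: itv01W (H2 _ sd).1.
    rewrite -/g -(chart_mapK ac dq) qs /= chart_mapK//.
    exact: Ud (H2 _ sd).2.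
apply: filterS off => s; apply: near_rightS => e [Le Re].
by split; [exists (chart_map c (g s) + e *: turn ('D_1 (chart_map c \o g) s))|
  exists (chart_map c (g s) - e *: turn ('D_1 (chart_map c \o g) s))].
Qed.

End Sides.

(** * Propagation of vanishing jumps along a beta-arc *)

Section ZeroJump.
Context {R : realType} {N m : nat} {D : open_book_diagram R N} (H : hkm_data m D).
Variable h : bool.
Variable q : D -> int.
Hypothesis q_const : forall (E : set D) p p', connected E ->
  E `<=` ~` page_curves H h -> E p -> E p' -> q p = q p'.

(** For q the difference of the multiplicities of two chains, this says that they have the
same coefficient on the arc at time s, see [coefs_zero_jump] below. *)
Definition zero_jump i (s : R) := forall c v, velocity (half_beta H h i) s c v ->
  \forall e \near (0 : R)^'+,
    q (chart_inv c (chart_map c (half_beta H h i s) + e *: turn v)) =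
    q (chart_inv c (chart_map c (half_beta H h i s) - e *: turn v)).

Lemma half_beta_velocity i (t : R) c v : t \in `]0, 1[ ->
  velocity (half_beta H h i) t c v -> v = 'D_1 (chart_map c \o half_beta H h i) t.
Proof.
move=> t01; apply: velocity_derive => //.
by apply: smooth_at_continuous; exact: (half_beta_smooth H h i t01).1.
Qed.

Lemma half_beta_has_velocity i (t : R) : t \in `]0, 1[ -> exists c v,
  velocity (half_beta H h i) t c v.
Proof.
move=> t01; have [c ac dc] := surf_cover (half_beta H h i t).
exists c, ('D_1 (chart_map c \o half_beta H h i) t).
by apply: derive_velocity => //; exact: (half_beta_smooth H h i t01).1.
Qed.

Definition const_near (p : D) := exists n, \forall p' \near p, ~ page_curves H h p' -> q p' = n.

Lemma const_near_zero_jump i (t : R) : t \in `]0, 1[ ->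
  ~ arcs (half_beta H h i t) -> const_near (half_beta H h i t) -> zero_jump i t.
Proof.
move=> t01 nA [n Hn] c v vel; have [ac dc _] := vel.
rewrite (half_beta_velocity t01 vel).
have [V [L [Rt [[nV cL cR LRK _] off]]]] := sides_at t01 nA ac dc.
have int := half_beta_interior t01 ac dc.
have o1 := offset_near (turn ('D_1 (chart_map c \o half_beta H h i) t)) ac dc int Hn.
have o2 := offset_near (- turn ('D_1 (chart_map c \o half_beta H h i) t)) ac dc int Hn.
apply: near_rightS (near_rightI (near_rightI o1 o2) (nbhs_singleton off)).
move=> e [[m1 m2] [Le Re]]; rewrite scalerN in m2.
by rewrite m1 ?m2//; apply: LRK; [right|left].
Qed.

(** Near the point the complement of the curves has two sides, on each of which q is
constant. Either the two values agree, or q jumps at all nearby times. *)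
Lemma const_near_dichotomy i (t : R) : t \in `]0, 1[ -> ~ arcs (half_beta H h i t) ->
  const_near (half_beta H h i t) \/ \forall s \near t, ~ zero_jump i s.
Proof.
move=> t01 nA; have [c ac dc] := surf_cover (half_beta H h i t).
have [V [L [Rt [[nV cL cR LRK VLR] off]]]] := sides_at t01 nA ac dc.
have [e0 [L0 R0]] := right_proper (nbhs_singleton off).
set l := chart_inv _ _ in L0; set r := chart_inv _ _ in R0.
have LK : L `<=` ~` page_curves H h by move=> p Lp; apply: LRK; left.
have RK : Rt `<=` ~` page_curves H h by move=> p Rp; apply: LRK; right.
have [E|NE] := eqVneq (q l) (q r); [left|right].
  exists (q l); apply: filterS nV => p /VLR[[Lp|Rp]|//] _.
    exact: q_const cL LK Lp L0.
  by rewrite E; exact: q_const cR RK Rp R0.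
have [sm _] := half_beta_smooth H h i t01.
have nd : \forall s \near t, chart_dom c (half_beta H h i s).
  exact: (smooth_at_continuous sm (chart_dom_near ac dc)).
apply: filterS (filterI off (filterI nd (near_itv01 t01))) => s [offs [ds s01]] zj.
have vel := derive_velocity (half_beta_smooth H h i s01).1 ac ds.
have [e [[Le Re] Ee]] := right_proper (near_rightI offs (zj _ _ vel)).
move/eqP: NE; apply.
exact: (etrans (q_const cL LK L0 Le) (etrans Ee (q_const cR RK Re R0))).
Qed.

Lemma near_not_arcs (p : D) : ~ arcs p -> \forall p' \near p, ~ arcs p'.
Proof.
move=> nA; apply: (@open_nbhs_nbhs _ p (~` arcs)); split => //.
by apply: closed_openC; exact: arcs_closed.
Qed.

Lemma zero_jump_dichotomy i (t : R) : t \in `]0, 1[ -> ~ arcs (half_beta H h i t) ->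
  (\forall s \near t, zero_jump i s) \/ (\forall s \near t, ~ zero_jump i s).
Proof.
move=> t01 nA; have [[n Hn]|] := const_near_dichotomy t01 nA; [left|by right].
have [sm _] := half_beta_smooth H h i t01.
have cg := smooth_at_continuous sm.
have nnA : \forall s \near t, ~ arcs (half_beta H h i s).
  exact: (cts_near cg (near_not_arcs nA)).
have nH : \forall s \near t, const_near (half_beta H h i s).
  move: Hn; rewrite -nbhs_nearE => /nbhs_interior Hn.
  by apply: filterS (cts_near cg Hn) => s Hs; exists n.
apply: filterS (filterI (filterI nnA nH) (near_itv01 t01)) => s [[As Hs] s01].
exact: const_near_zero_jump.
Qed.

(** By the hypothesis at the vertices and [zero_jump_dichotomy] elsewhere, every time
has a punctured neighbourhood on which the jump is everywhere zero or nowhere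
zero. Both conditions are open, so that ]0, 1[ being connected, one of them holds
at all times. *)
Lemma zero_jump_propagates i :
  (forall t : R, t \in `]0, 1[ -> arcs (half_beta H h i t) ->
    (\forall s \near t, s != t -> zero_jump i s) \/
    (\forall s \near t, s != t -> ~ zero_jump i s)) ->
  (exists2 t : R, t \in `]0, 1[ & \forall s \near t, s != t -> zero_jump i s) ->
  forall t : R, t \in `]0, 1[ -> \forall s \near t, s != t -> zero_jump i s.
Proof.
move=> vert [t0 t001 H0].
have dich (t : R) : t \in `]0, 1[ -> (\forall s \near t, s != t -> zero_jump i s) \/
    (\forall s \near t, s != t -> ~ zero_jump i s).
  move=> t01; have [At|nAt] := pselect (arcs (half_beta H h i t)); first exact: vert.
  have [Z|Z] := zero_jump_dichotomy t01 nAt; [left|right]; exact: filterS Z => s Zs _.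
have F (Z : R -> Prop) : open [set t : R | \forall s \near t, s != t -> Z s].
  rewrite openE => t /near_ball_norm[r r0 Hr].
  suff : \forall t' \near t, (\forall s \near t', s != t' -> Z s) by [].
  apply: (ball_norm_near r0) => t' tt'.
  have [->|ne] := eqVneq t' t; first by apply: (ball_norm_near r0).
  have rr : 0 < Num.min (r - `|t - t'|) `|t - t'|.
    by rewrite lt_min subr_gt0 tt' normr_gt0 subr_eq0 eq_sym ne.
  apply: (ball_norm_near rr) => s; rewrite lt_min => /andP[s1 s2] _; apply: Hr.
    by rewrite (le_lt_trans (ler_distD t' _ _))// addrC -ltrBrDr.
  by apply: contraTneq s2 => ->; rewrite distrC ltxx.
pose A := [set t : R | \forall s \near t, s != t -> zero_jump i s].
pose B := [set t : R | \forall s \near t, s != t -> ~ zero_jump i s].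
have AB : A `&` B = set0.
  apply/eqP/negPn/negP => /set0P[t [At Bt]].
  have [r r0 Hr] := near_ball_norm (filterI At Bt).
  have tr : t + r / 2 != t by rewrite -subr_eq0 addrAC subrr add0r gt_eqF// divr_gt0.
  have [|z1 z2] := Hr (t + r / 2).
    rewrite opprD addrA subrr add0r normrN gtr0_norm ?divr_gt0//.
    by rewrite ltr_pdivrMr// ltr_pMr// ltr1n.
  exact: z2 (z1 _).
have sep := open_disjoint_separated (F _) (F _) AB.
have conn : connected (`]0, 1[%classic : set R).
  apply/connected_intervalP; exact: interval_is_interval.
have cov : `]0, 1[%classic `<=` A `|` B by move=> t; exact: dich.
have [sA|sB] := connected_subset sep cov conn; first by move=> t; exact: sA.
by exfalso; have : (A `&` B) t0; [split => //; exact: sB|rewrite AB].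
Qed.

Lemma zero_jump_const_near i (t : R) : t \in `]0, 1[ ->
  ~ arcs (half_beta H h i t) -> (\forall s \near t, s != t -> zero_jump i s) ->
  const_near (half_beta H h i t).
Proof.
move=> t01 nA Z; have [//|NZ] := const_near_dichotomy t01 nA.
have [r r0 Hr] := near_ball_norm (filterI Z NZ).
have tr : t + r / 2 != t by rewrite -subr_eq0 addrAC subrr add0r gt_eqF// divr_gt0.
have [|z1 z2] := Hr (t + r / 2).
  rewrite opprD addrA subrr add0r normrN gtr0_norm ?divr_gt0//.
  by rewrite ltr_pdivrMr// ltr_pMr// ltr1n.
by case: z2; exact: z1.
Qed.

End ZeroJump.

Lemma copy_sign_sq h : copy_sign h * copy_sign h = 1.
Proof. by case: h. Qed.

Lemma sub_eq_iff (n a1 a2 b1 b2 : int) : n = a1 - b1 -> n = a2 - b2 ->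
  (b1 = b2 <-> a1 = a2).
Proof. lia. Qed.

Section Difference.
Context {R : realType} {N m : nat} {D : open_book_diagram R N} (H : hkm_data m D).
Variables P1 P2 : set (doubled D) -> int.

Definition diff_mu h p := mu H P1 h p - mu H P2 h p.

Lemma diff_mu_const h (E : set D) p p' : connected E ->
  E `<=` ~` page_curves H h -> E p -> E p' -> diff_mu h p = diff_mu h p'.
Proof.
by move=> cE EK Ep Ep'; rewrite /diff_mu !(mu_connected _ cE EK Ep Ep').
Qed.

(** The coefficients are the jumps of the multiplicity, up to a sign that depends only
on the copy of the page. *)
Lemma coefs_zero_jump h i (s : R) n1 n2 : s \in `]0, 1[ ->
  beta_coef H P1 h i s n1 -> beta_coef H P2 h i s n2 ->
  (zero_jump H h (diff_mu h) i s <-> n1 = n2).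
Proof.
move=> s01 b1 b2; have sgn := copy_sign_sq h.
split=> [zj|nn c v vel].
  have [c [v vel]] := half_beta_has_velocity H h i s01.
  have [e [[E1 E2] E3]] := right_proper (near_rightI (near_rightI (b1 _ _ vel) (b2 _ _ vel)) (zj _ _ vel)).
  rewrite E1 E2; congr (_ * _); move: E3; rewrite /diff_mu /mu /= => E3.
  by apply/eqP; rewrite -subr_eq0; apply/eqP; move: E3; lia.
apply: near_rightS (near_rightI (b1 _ _ vel) (b2 _ _ vel)) => e [E1 E2].
have := congr1 (fun x => copy_sign h * x) (etrans (esym E1) (etrans nn E2)).
by rewrite /= !mulrA sgn !mul1r /diff_mu /mu; lia.
Qed.

(** Let a1, b1 be the coefficients of P1 on the edges entering and leaving the vertex,
and a2, b2 those of P2. As a1 - b1 = n = a2 - b2, P1 - P2 has zero jump before the vertex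
(a1 = a2) if and only if it has zero jump after it (b1 = b2). *)
Lemma vertex_dichotomy h i (t : R) n : t \in `]0, 1[ ->
  vertex_coef H P1 h i t n -> vertex_coef H P2 h i t n ->
  (\forall s \near t, s != t -> zero_jump H h (diff_mu h) i s) \/
  (\forall s \near t, s != t -> ~ zero_jump H h (diff_mu h) i s).
Proof.
move=> t01 [a1 [b1 [/near_leftP[r1 r10 A1] /near_rightP[r2 r20 B1] E1]]]
  [a2 [b2 [/near_leftP[r3 r30 A2] /near_rightP[r4 r40 B2] E2]]].
have [r5 r50 I01] := near_ball_norm (near_itv01 t01).
pose r := Num.min (Num.min r1 r2) (Num.min (Num.min r3 r4) r5).
have r0 : 0 < r by rewrite !lt_min r10 r20 r30 r40 r50.
have key s : `|t - s| < r -> s != t ->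
    (zero_jump H h (diff_mu h) i s <-> a1 = a2).
  rewrite !lt_min => /andP[/andP[s1 s2] /andP[/andP[s3 s4] /I01 s01]] st.
  have [lt|gt|E] := ltgtP s t; last by rewrite E eqxx in st.
    apply: coefs_zero_jump => //; [apply: A1|apply: A2]; rewrite lt andbT.
      by move: s1; rewrite ltr_norml; lra.
    by move: s3; rewrite ltr_norml; lra.
  apply: (iff_trans _ (sub_eq_iff E1 E2)).
  apply: coefs_zero_jump => //; [apply: B1|apply: B2]; rewrite gt /=.
    by move: s2; rewrite ltr_norml; lra.
  by move: s4; rewrite ltr_norml; lra.
have [E|NE] := eqVneq a1 a2; [left|right]; apply: (ball_norm_near r0) => s sr st.
  by apply/(key _ sr st).
by move=> /(key _ sr st) E; rewrite E eqxx in NE.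
Qed.

End Difference.

(** * Tubular coordinates and the thin strips *)

Section Tube.
Context {R : realType} {N m : nat} {D : open_book_diagram R N} (H : hkm_data m D).

Definition tube i : set D := nu H i @` band.

Lemma tube_open i : open (tube i).
Proof. by have [[]] := nu_tubular H i. Qed.

Lemma near_tube i p : tube i p -> \forall p' \near p, tube i p'.
Proof. by move=> tp; apply: open_nbhs_nbhs; split => //; exact: tube_open. Qed.

Lemma rhoK i u : band u -> rho H i (nu H i u) = u.
Proof. by move=> bu; have [[_ K] _ _ _ _] := nu_tubular H i; exact: (K u (mem_set bu)). Qed.

Lemma nuK i p : tube i p -> band (rho H i p) /\ nu H i (rho H i p) = p.
Proof. by move=> [u bu <-]; rewrite rhoK. Qed.

Lemma tube_nu i u : band u -> tube i (nu H i u). Proof. by exists u. Qed.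

Lemma tube_inj i j p : tube i p -> tube j p -> i = j.
Proof. exact: band_inj. Qed.

Lemma rho_continuous i p : tube i p -> {for p, continuous (rho H i)}.
Proof.
move=> tp; have [_ [_ sr] _ _ _] := nu_tubular H i.
have [c ac dp] := surf_cover p.
have [|g [U [oU Up Cg E]]] := sr c ac (chart_map c p); first by exists p.
have Eg q : chart_dom c q -> tube i q -> U (chart_map c q) -> g (chart_map c q) = rho H i q.
  by move=> dq tq Uq; rewrite -E//= ?chart_mapK//; exists q.
have cg : {for p, continuous (g \o chart_map c)}.
  apply: continuous_comp; first exact: chart_map_continuous.
  by apply: (Cg 0%N).1; rewrite inE.
have nU : \forall q \near p, U (chart_map c q).
  exact: (cts_near (chart_map_continuous ac dp) (open_nbhs_nbhs (conj oU Up))).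
have EE : \forall q \near p, (g \o chart_map c) q = rho H i q.
  apply: filterS (filterI (filterI (chart_dom_near ac dp) (near_tube tp)) nU) => q [[dq tq] Uq].
  exact: Eg.
move=> B; rewrite -(nbhs_singleton EE) => nB.
by apply: filterS (filterI EE (cts_near cg nB)) => q [qE Bq]; change (B (rho H i q)); rewrite -qE.
Qed.

Lemma nu_within i : {within band, continuous (nu H i)}.
Proof. by have [_ [[]]] := nu_tubular H i. Qed.

Lemma nu_bd i u : band u -> (bd D (nu H i u) <-> u.2 = 0 \/ u.2 = 1).
Proof. by have [_ _ _ E _] := nu_tubular H i; exact: E. Qed.

Lemma nu_arc i (t : R) : t \in `[0, 1] -> nu H i (0, t) = cut_arc D i t.
Proof. by have [_ _ _ _ E] := nu_tubular H i; exact: E. Qed.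

(** The arc b_i in tubular coordinates. *)
Definition bcoord i (t : R) : R * R := rho H i (barc H i t).

Lemma bcoord_band i (t : R) : t \in `[0, 1] -> band (bcoord i t).
Proof. by move=> /(barc_band H i)/nuK[]. Qed.

Lemma bcoordK i (t : R) : t \in `[0, 1] -> nu H i (bcoord i t) = barc H i t.
Proof. by move=> /(barc_band H i)/nuK[]. Qed.

Lemma bcoord_within i : {within `[0, 1]%classic, continuous (bcoord i)}.
Proof.
apply/withinP => t t01; have /withinP/(_ t t01) c := @barc_within _ _ _ _ H i.
exact: (cvg_comp _ _ c (rho_continuous (barc_band H i t01))).
Qed.

Lemma bcoord2_within i : {within `[0, 1]%classic, continuous (fun t => (bcoord i t).2)}.
Proof.
apply/withinP => t t01; have /withinP/(_ t t01) c := @bcoord_within i.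
exact: (cvg_comp _ _ c cvg_snd).
Qed.

Lemma bcoord_lt i (s t : R) : s \in `[0, 1] -> t \in `[0, 1] -> s < t ->
  (bcoord i s).2 < (bcoord i t).2.
Proof. exact: barc_graph. Qed.

Lemma bcoord2_inj i (s t : R) : s \in `[0, 1] -> t \in `[0, 1] ->
  (bcoord i s).2 = (bcoord i t).2 -> s = t.
Proof.
move=> s01 t01 E; have [lt|lt|//] := ltgtP s t.
  by have := bcoord_lt i s01 t01 lt; rewrite E ltxx.
by have := bcoord_lt i t01 s01 lt; rewrite E ltxx.
Qed.

Lemma mem0 : (0 : R) \in `[0, 1]. Proof. by rewrite in_itv/= lexx ler01. Qed.
Lemma mem1 : (1 : R) \in `[0, 1]. Proof. by rewrite in_itv/= lexx ler01. Qed.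

Lemma bcoord_ends i : (bcoord i 0).2 = 0 /\ (bcoord i 1).2 = 1.
Proof.
have F (t : R) : t \in `[0, 1] -> t = 0 \/ t = 1 -> (bcoord i t).2 = 0 \/ (bcoord i t).2 = 1.
  move=> t01 te; apply/(nu_bd i (bcoord_band i t01)); rewrite bcoordK//.
  exact/(half_beta_bd H true i t01).
have lt := bcoord_lt i mem0 mem1 ltr01.
have [E0|E0] := F 0 mem0 (or_introl erefl); have [E1|E1] := F 1 mem1 (or_intror erefl);
  by move: lt; rewrite ?E0 ?E1 // ?ltxx// ltr10.
Qed.

Lemma bcoord_surj i (y : R) : y \in `[0, 1] -> exists2 t : R, t \in `[0, 1] & (bcoord i t).2 = y.
Proof.
have [E0 E1] := bcoord_ends i; rewrite in_itv/= => /andP[y0 y1].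
have [|t t01 ty] := IVT (v := y) ler01 (@bcoord2_within i); last by exists t.
by rewrite E0 E1 ge_min le_max y0 y1 orbT.
Qed.

(** In tubular coordinates b_i is the graph of a function of the second coordinate. It is
defined on [0, 1], and it is extended to the line by constants for convenience;
the bound B < 1 leaves room between the graph and the sides of the band. *)
Lemma bcoord_graph i : exists b : R -> R,
  [/\ continuous b, forall t : R, t \in `[0, 1] -> b (bcoord i t).2 = (bcoord i t).1 &
      exists2 B : R, 0 <= B < 1 & forall y, `|b y| <= B].
Proof.
have [E0 E1] := bcoord_ends i.
pose tau (y : R) : R := xget 0 [set t : R | t \in `[0, 1] /\ (bcoord i t).2 = y].
have tauP y : y \in `[0, 1] -> tau y \in `[0, 1] /\ (bcoord i (tau y)).2 = y.
  by move=> /(bcoord_surj i)[t t01 ty]; apply: (@xgetPex R 0 [set t : R | t \in `[0, 1] /\ (bcoord i t).2 = y]); exists t.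
have tauK : {in `[0, 1], cancel (fun t => (bcoord i t).2) tau}.
  move=> t t01; have [|t1 t2] := tauP (bcoord i t).2.
    by have [_] := bcoord_band i t01; rewrite in_itv.
  exact: (@bcoord2_inj i _ _ t1 t01 t2).
have ctau : {within `[0, 1]%classic, continuous tau}.
  have := segment_can_le_continuous ler01 (@bcoord2_within i) tauK.
  by rewrite E0 E1.
pose clamp (y : R) : R := Num.max 0 (Num.min 1 y).
have clamp01 y : clamp y \in `[0, 1].
  by rewrite in_itv/= /clamp le_max lexx/= ge_max ler01 ge_min lexx.
have clampK z : 0 <= z <= 1 -> clamp z = z.
  by move=> /andP[z0 z1]; rewrite /clamp min_r// max_r.
have cclamp : continuous clamp.
  move=> y; apply: (@continuous_max R R (fun=> 0) (Num.min 1)); first exact: cvg_cst.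
  by apply: (@continuous_min R R (fun=> 1) id); [exact: cvg_cst|exact: cvg_id].
pose b y := (bcoord i (tau (clamp y))).1.
have cb : continuous b.
  move=> y V nV.
  have /withinP/(_ _ (tauP _ (clamp01 y)).1) c1 := @bcoord_within i.
  have c1' : \forall t \near tau (clamp y), t \in `[0, 1] -> V (bcoord i t).1.
    exact: (cvg_comp _ _ c1 cvg_fst _ nV).
  have /withinP/(_ _ (clamp01 y)) c2 := ctau.
  have c2' : \forall z \near clamp y, z \in `[0, 1] -> tau z \in `[0, 1] -> V (bcoord i (tau z)).1.
    exact: (c2 _ c1').
  apply: filterS (cts_near (@cclamp y) c2') => z /(_ (clamp01 z)).
  by apply; exact: (tauP _ (clamp01 z)).1.
have bb (t : R) : t \in `[0, 1] -> b (bcoord i t).2 = (bcoord i t).1.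
  move=> t01; have [_] := bcoord_band i t01; rewrite /b /clamp => /andP[y0 y1].
  by rewrite min_r// max_r// tauK.
exists b; split => //.
have cn : {within `[0, 1]%classic, continuous (fun y => `|b y|)}.
  apply: continuous_subspaceT => y.
  exact: (continuous_comp (@cb y) (@norm_continuous _ _ (b y))).
have [y0 y001 Hy] := EVT_max ler01 cn.
have bE y : b y = b (clamp y).
  rewrite /b; congr (bcoord i (tau _)).1; rewrite (clampK (clamp y))//.
  by have := clamp01 y; rewrite in_itv.
exists `|b y0|; last by move=> y; rewrite bE; apply: Hy.
rewrite normr_ge0/= /b; have [/andP[+ +] _] := bcoord_band i (tauP _ (clamp01 y0)).1.
by move=> h1 h2; rewrite ltr_norml h1 h2.
Qed.

Definition strip i : set D := [set p | tube i p /\ exists2 t : R, t \in `[0, 1] &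
      (rho H i (barc H i t)).2 = (rho H i p).2 /\
      (0 <= (rho H i p).1 <= (rho H i (barc H i t)).1 \/
       (rho H i (barc H i t)).1 <= (rho H i p).1 <= 0)].

Lemma barc_strip i (t : R) : t \in `[0, 1] -> strip i (barc H i t).
Proof.
move=> t01; split; first exact: barc_band.
by exists t => //; split => //; have [h|h] := lerP 0 (rho H i (barc H i t)).1; [left|right]; rewrite ?lexx ?h//= ltW.
Qed.

Lemma strip_nu i (b : R -> R) u : (forall t : R, t \in `[0, 1] -> b (bcoord i t).2 = (bcoord i t).1) ->
  band u -> strip i (nu H i u) <-> (0 <= u.1 <= b u.2 \/ b u.2 <= u.1 <= 0).
Proof.
move=> bb bu; rewrite /strip /= rhoK//; split.
  by move=> [_ [t t01 [E]]]; rewrite -/(bcoord i t) -bb// -E.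
have [t t01 E] : exists2 t : R, t \in `[0, 1] & (bcoord i t).2 = u.2.
  by apply: bcoord_surj; rewrite in_itv/=; have [_] := bu.
move=> h; split; first exact: tube_nu.
by exists t => //; split => //; rewrite -/(bcoord i t) -bb// E.
Qed.

Lemma arcs_nu i u : band u -> arcs (nu H i u) <-> u.1 = 0.
Proof.
move=> bu; split=> [[j _ [t t01 E]]|u0].
  have ij : j = i by apply: (@tube_inj j i (nu H i u)); [rewrite -E; exact: arc_band|exact: tube_nu].
  subst j; have : rho H i (nu H i (0, t)) = rho H i (nu H i u) by rewrite nu_arc// E.
  by rewrite !rhoK//; [move=> <-|exact: band0].
exists i => //; have u201 : u.2 \in `[0, 1] by rewrite in_itv/=; have [_] := bu.
by exists u.2 => //; rewrite -(nu_arc i u201) -u0 -surjective_pairing.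
Qed.

Lemma page_curves_true_strips p : page_curves H true p -> arcs p \/ strips H p.
Proof.
move=> [|[i _ [t t01 <-]]]; first by left.
by right; exists i; exact: barc_strip.
Qed.

Lemma page_curves_true_nu i (b : R -> R) u :
  (forall t : R, t \in `[0, 1] -> b (bcoord i t).2 = (bcoord i t).1) ->
  band u -> page_curves H true (nu H i u) <-> (u.1 = 0 \/ u.1 = b u.2).
Proof.
move=> bb bu; split.
  move=> [/(arcs_nu i bu)|[j _ [t t01 E]]]; first by left.
  have ij : j = i by apply: (@tube_inj j i (nu H i u)); [rewrite -E; exact: barc_band|exact: tube_nu].
  subst j; right; have : bcoord i t = u by rewrite /bcoord -[barc H i t]/(half_beta H true i t) E rhoK.
  by move=> <-; rewrite bb.
move=> [u0|u0]; first by left; exact/arcs_nu.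
have [t t01 E] : exists2 t : R, t \in `[0, 1] & (bcoord i t).2 = u.2.
  by apply: bcoord_surj; rewrite in_itv/=; have [_] := bu.
right; exists i => //; exists t => //=; rewrite -bcoordK//; congr (nu H i _).
by rewrite [LHS]surjective_pairing [RHS]surjective_pairing E -bb// E u0.
Qed.

(** This moves a point u off the a-arc {0} x [0, 1] horizontally, away from that arc, until
it is beyond the graph of b, with a margin eps * `|u.1|. *)
Definition push (b : R -> R) (eps : R) (u : R * R) : R * R :=
  (if 0 < u.1 then Num.max u.1 (b u.2 + eps * u.1)
   else Num.min u.1 (b u.2 + eps * u.1), u.2).

Definition push_page i b eps (p : D) : D :=
  if pselect (tube i p) is left _ then nu H i (push b eps (rho H i p)) else p.

Lemma push_band b eps B u : 0 < eps -> B + eps < 1 -> (forall y, `|b y| <= B) ->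
  band u -> u.1 != 0 -> band (push b eps u) /\ (push b eps u).1 != 0.
Proof.
case: u => x y /= e0 Be bB [/andP[/= x1 x2] y01] x0.
have := bB y; rewrite ler_norml => /andP[b1 b2].
rewrite /push /=; case: ifPn => [xp|]; last first.
  rewrite -leNgt le_eqVlt (negbTE x0)/= => xn.
  have ex : - eps <= eps * x by rewrite -mulrN1 ler_wpM2l ?ltW.
  split; last by rewrite lt_eqF// gt_min xn.
  by split => //=; rewrite lt_min x1 gt_min x2 andbT/=; lra.
have ex : eps * x <= eps by rewrite -[leRHS]mulr1 ler_wpM2l ?ltW.
split; last by rewrite gt_eqF// lt_max xp.
by split => //=; rewrite gt_max lt_max x1 x2 /=; lra.
Qed.

Lemma push_off b eps u : 0 < eps -> u.1 != 0 ->
  ~ (0 <= (push b eps u).1 <= b u.2 \/ b u.2 <= (push b eps u).1 <= 0).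
Proof.
case: u => x y /= e0 x0; rewrite /push /=; case: ifPn => [xp|].
  have ex : 0 < eps * x by rewrite mulr_gt0.
  by rewrite ge_max; case=> [/andP[_ /andP[_]]|/andP[_]]; [lra|rewrite ge_max; lra].
rewrite -leNgt le_eqVlt (negbTE x0)/= => xn.
have ex : eps * x < 0 by rewrite pmulr_rlt0.
by rewrite le_min; case=> [/andP[/andP[+ _] _]|/andP[+ _]]; [lra|rewrite le_min; lra].
Qed.

Lemma push_id b eps u : (0 < u.1 -> b u.2 + eps * u.1 <= u.1) ->
  (u.1 <= 0 -> u.1 <= b u.2 + eps * u.1) -> push b eps u = u.
Proof.
case: u => x y /= h1 h2; rewrite /push /=; case: ifPn => [xp|].
  by rewrite max_l// h1.
by rewrite -leNgt => /h2 h; rewrite min_l.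
Qed.

Lemma continuous_pair_at (T U V : topologicalType) (f : T -> U) (g : T -> V) (x : T) :
  {for x, continuous f} -> {for x, continuous g} ->
  {for x, continuous (fun w => (f w, g w))}.
Proof.
move=> cf cg B [[B1 B2] /= [n1 n2] sB].
suff : \forall w \near x, B (f w, g w) by [].
by apply: filterS (filterI (cts_near cf n1) (cts_near cg n2)) => w [w1 w2]; exact: sB.
Qed.

Lemma push_continuous (b : R -> R) (eps : R) (u : R * R) : continuous b -> u.1 != 0 -> {for u, continuous (push b eps)}.
Proof.
move=> cb u0.
have c1 : {for u, continuous (fst : R * R -> R)} by exact: cvg_fst.
have c2 : {for u, continuous (snd : R * R -> R)} by exact: cvg_snd.
have cl : {for u, continuous (fun w : R * R => b w.2 + eps * w.1)}.
  apply: (@cvgD _ _ _ _ _ (fun w : R * R => b w.2) (fun w : R * R => eps * w.1)).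
    exact: (continuous_comp c2 (@cb u.2)).
  exact: cvgMl_tmp.
have cM := @continuous_max R _ (fst : R * R -> R) _ u c1 cl.
have cm := @continuous_min R _ (fst : R * R -> R) _ u c1 cl.
have P (f : R * R -> R) : {for u, continuous f} ->
    {for u, continuous (fun w : R * R => (f w, w.2))}.
  by move=> cf; exact: continuous_pair_at.
have [up|un] := ltrP 0 u.1.
  apply: (@continuous_at_eq _ _ _ (fun w : R * R => (Num.max w.1 (b w.2 + eps * w.1), w.2))).
    have n1 : \forall w \near u, 0 < w.1 by exact: near_gt c1 up.
    by apply: filterS n1 => w wp; rewrite /push wp.
  exact: P cM.
have {}un : u.1 < 0 by rewrite lt_neqAle u0.
apply: (@continuous_at_eq _ _ _ (fun w : R * R => (Num.min w.1 (b w.2 + eps * w.1), w.2))).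
  have n1 : \forall w \near u, w.1 < 0 by exact: near_lt c1 un.
  by apply: filterS n1 => w wp; rewrite /push ltNge (ltW wp).
exact: P cm.
Qed.

Lemma push_page_tube i b eps p : tube i p ->
  push_page i b eps p = nu H i (push b eps (rho H i p)).
Proof. by rewrite /push_page; case: pselect. Qed.

Lemma push_page_out i b eps p : ~ tube i p -> push_page i b eps p = p.
Proof. by rewrite /push_page; case: pselect. Qed.

Lemma arcs_tube i p : tube i p -> ~ arcs p -> (rho H i p).1 != 0.
Proof.
move=> tp nA; apply/eqP => r0; apply: nA; have [bp <-] := nuK tp.
exact/(arcs_nu i bp).
Qed.

(** Next to the sides of the tube the push is the identity, so that it can be extended
by the identity outside the tube. *)
Lemma push_page_continuous i b (eps B : R) : continuous b ->
  (forall y, `|b y| <= B) -> 0 < eps -> B + eps < 1 ->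
  {within ~` arcs, continuous (push_page i b eps)}.
Proof.
move=> cb bB e0 Be; apply/withinP => p nA V.
have B0 : 0 <= B := le_trans (normr_ge0 _) (bB 0).
suff W : push_page i b eps p = p \/ tube i p -> nbhs (push_page i b eps p) V ->
    \forall p' \near p, ~ arcs p' -> V (push_page i b eps p').
  apply: W; have [tp|ntp] := pselect (tube i p); [by right|left].
  exact: push_page_out.
have [tp _|ntp _] := pselect (tube i p).
  have u0 := arcs_tube tp nA; have [bu _] := nuK tp.
  rewrite push_page_tube// => nV.
  have [bpu _] := push_band e0 Be bB bu u0.
  have n1 := within_near (@nu_within i) bpu nV.
  have n2 := cts_near (@push_continuous b eps _ cb u0) n1.
  have n3 := cts_near (rho_continuous tp) n2.
  apply: filterS (filterI n3 (near_tube tp)) => q [qV tq] nAq.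
  rewrite push_page_tube//; apply: qV.
  by have [bq _] := nuK tq; have [] := push_band e0 Be bB bq (arcs_tube tq nAq).
rewrite push_page_out// => nV.
have e1 : eps < 1 by lra.
(* the push is the identity where the first coordinate exceeds c in absolute value *)
pose c := B / (1 - eps); have c0 : 0 <= c by rewrite divr_ge0// subr_ge0 ltW.
have c1 : c < 1 by rewrite ltr_pdivrMr ?subr_gt0// mul1r ltrBrDr.
have cE : c * (1 - eps) = B by rewrite divfK// subr_eq0 gt_eqF.
pose Rc : set (R * R) := `[- c, c]%classic `*` `[0, 1]%classic.
have Rcb : Rc `<=` band.
  move=> [x y] [/=]; rewrite !in_itv/= => /andP[x1 x2] y01; split => //=.
  by apply/andP; split; lra.
have cK : closed (nu H i @` Rc).
  apply: compact_closed; first exact: surf_hausdorff.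
  apply: continuous_compact; first exact: continuous_subspaceW (@nu_within i).
  by apply: compact_setX; exact: segment_compact.
have nK : ~ (nu H i @` Rc) p by move=> [u /Rcb bu E]; apply: ntp; exists u.
have n1 : \forall q \near p, ~ (nu H i @` Rc) q.
  by apply: (@open_nbhs_nbhs _ p (~` (nu H i @` Rc))); split => //; exact: closed_openC.
apply: filterS (filterI n1 nV) => q [nq Vq] nAq.
have [tq|ntq] := pselect (tube i q); last by rewrite push_page_out.
rewrite push_page_tube// push_id; first by have [_ ->] := nuK tq.
  move=> u0; have [[ub y01] qE] := nuK tq.
  have := bB (rho H i q).2; rewrite ler_norml => /andP[_ b2].
  have uc : c < (rho H i q).1.
    rewrite ltNge; apply/negP => uc; apply: nq; exists (rho H i q) => //.
    by split; rewrite /= in_itv/= ?y01// uc andbT (le_trans _ (ltW u0))// oppr_le0.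
  have : c * (1 - eps) < (rho H i q).1 * (1 - eps) by rewrite ltr_pM2r// subr_gt0.
  by rewrite cE mulrBr mulr1 [_ * eps]mulrC; lra.
move=> u0; have [[ub y01] qE] := nuK tq.
have := bB (rho H i q).2; rewrite ler_norml => /andP[b1 _].
have uc : (rho H i q).1 < - c.
  rewrite ltNge; apply/negP => uc; apply: nq; exists (rho H i q) => //.
  by split; rewrite /= in_itv/= ?y01// uc (le_trans u0).
have : (rho H i q).1 * (1 - eps) < - c * (1 - eps) by rewrite ltr_pM2r// subr_gt0.
by rewrite mulNr cE mulrBr mulr1 [_ * eps]mulrC; lra.
Qed.

Lemma push_page_fix i b (eps : R) p : (forall t : R, t \in `[0, 1] -> b (bcoord i t).2 = (bcoord i t).1) ->
  ~ arcs p -> ~ strip i p ->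
  (tube i p -> eps <= `|(rho H i p).1 - b (rho H i p).2|) -> 0 < eps ->
  push_page i b eps p = p.
Proof.
move=> bb nA nS He e0; have [tp|] := pselect (tube i p); last exact: push_page_out.
have u0 := arcs_tube tp nA; have [bu uE] := nuK tp; have := He tp.
rewrite push_page_tube// -[in RHS]uE => {}He; congr (nu H i _).
have {}nS : ~ (0 <= (rho H i p).1 <= b (rho H i p).2 \/ b (rho H i p).2 <= (rho H i p).1 <= 0).
  by move=> /(strip_nu bb bu); rewrite uE.
move: u0 He nS bu; case: (rho H i p) => x y /= x0 He nS [/= /andP[x1 x2] _].
apply: push_id => /= xs.
  have bx : b y < x.
    by rewrite ltNge; apply/negP => h; apply: nS; left; rewrite (ltW xs).
  rewrite gtr0_norm ?subr_gt0// in He.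
  have : eps * x <= eps by rewrite -[leRHS]mulr1 ler_wpM2l ?ltW.
  by lra.
have {}xs : x < 0 by rewrite lt_neqAle x0.
have bx : x < b y.
  by rewrite ltNge; apply/negP => h; apply: nS; right; rewrite h ltW.
rewrite ltr0_norm ?subr_lt0// in He.
have : - eps <= eps * x by rewrite -mulrN1 ler_wpM2l ?ltW.
by lra.
Qed.

Lemma push_page_strip i b (eps B : R) q j : (forall t : R, t \in `[0, 1] -> b (bcoord i t).2 = (bcoord i t).1) ->
  (forall y, `|b y| <= B) -> 0 < eps -> B + eps < 1 -> ~ arcs q ->
  ~ arcs (push_page i b eps q) /\ (strip j (push_page i b eps q) -> i != j /\ strip j q).
Proof.
move=> bb bB e0 Be nA; have [tq|ntq] := pselect (tube i q); last first.
  rewrite push_page_out//; split => // sq; split => //.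
  by apply: contra_notN ntq => /eqP ->; case: sq.
rewrite push_page_tube//; have [bu uE] := nuK tq; have u0 := arcs_tube tq nA.
have [bpu pu0] := push_band e0 Be bB bu u0; split.
  by move=> /(arcs_nu i bpu)/eqP; rewrite (negbTE pu0).
move=> sj; have ij : i = j by apply: (@tube_inj i j _ (tube_nu i bpu)); case: sj.
by subst j; move/(strip_nu bb bpu): sj => /(push_off e0 u0).
Qed.

(** The set E is pushed out of the strips one after the other, with a margin eps small
enough to fix p and z. A push moves points inside one tube only, thus does not
bring back points into the other strips. *)
Lemma connected_off_strips p z (E : set D) : connected E -> E `<=` ~` arcs -> E p -> E z ->
  ~ strips H p -> ~ strips H z ->
  exists E', [/\ connected E', E' `<=` ~` arcs, E' p, E' z & forall q, E' q -> ~ strips H q].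
Proof.
move=> cE EA Ep Ez nSp nSz.
suff [E' [cE' EA' Ep' Ez' HE']] : exists E', [/\ connected E', E' `<=` ~` arcs, E' p, E' z &
    forall q i, i \in enum 'I_N -> E' q -> ~ strip i q].
  exists E'; split => // q Eq [i si]; apply: HE' Eq si; exact: mem_enum.
elim: (enum 'I_N) => [|i s [E' [cE' EA' Ep' Ez' HE']]]; first by exists E.
have [b [cb bb [B /andP[B0 B1] bB]]] := bcoord_graph i.
pose e p := if pselect (tube i p) is left _ then `|(rho H i p).1 - b (rho H i p).2| else 1 : R.
have e_gt0 p' : ~ arcs p' -> ~ strips H p' -> 0 < e p'.
  move=> nA' nS'; rewrite /e; case: pselect => //= tp; rewrite normr_gt0 subr_eq0.
  apply/eqP => E1; have [bu uE] := nuK tp; apply: nS'; exists i; rewrite -uE.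
  by apply/(strip_nu bb bu); rewrite -E1 lexx andbT; have [h|/ltW h] := lerP 0 (rho H i p').1; [left|right].
pose eps := Num.min ((1 - B) / 2) (Num.min (e p) (e z)).
have eps0 : 0 < eps by rewrite !lt_min divr_gt0 ?subr_gt0//= !e_gt0//; exact: EA'.
have Beps : B + eps < 1.
  have : eps <= (1 - B) / 2 by rewrite ge_min lexx.
  by move: B1; lra.
have fix_ p' : eps <= e p' -> ~ arcs p' -> ~ strips H p' -> push_page i b eps p' = p'.
  move=> ep nA' nS'; apply: push_page_fix => //; first by move=> si; apply: nS'; exists i.
  by move=> tp; move: ep; rewrite /e; case: pselect.
have fp : push_page i b eps p = p.
  by apply: fix_ => //; [rewrite !ge_min lexx orbT|exact: EA'].
have fz : push_page i b eps z = z.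
  by apply: fix_ => //; [rewrite !ge_min lexx !orbT|exact: EA'].
exists (push_page i b eps @` E'); split.
- apply: connected_continuous_connected => //.
  have C := @push_page_continuous i b eps B cb bB eps0 Beps.
  exact: (continuous_subspaceW EA' C).
- by move=> _ [q Eq <-]; have [] := push_page_strip i bb bB eps0 Beps (EA' _ Eq).
- by exists p.
- by exists z.
- move=> _ j jis [q Eq <-] sj.
  have [_ /(_ sj)[ij sjq]] := push_page_strip j bb bB eps0 Beps (EA' _ Eq).
  by apply: HE' Eq sjq; move: jis; rewrite inE eq_sym (negbTE ij).
Qed.

(** The component of p in the complement of the a-arcs contains a base point, and by
[connected_off_strips] the path to it may avoid the strips, hence also the arcs b_i,
which lie in the strips. *)
Lemma mu_off_strips P p : chain2 H P -> ~ arcs p -> ~ strips H p -> mu H P true p = 0.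
Proof.
move=> cP nA nS; have [j [cj _]] := basept_component H nA.
have [_ nAz nSz] := basept_interior H j.
set E := connected_component _ _ in cj.
have Ep : E p by exact: connected_component_refl.
have [E' [cE' EA' Ep' Ez' HE']] := connected_off_strips (@component_connected _ _ _)
  (@connected_component_sub _ _ _) Ep cj nS nSz.
apply: (mu_basept cP cE' _ Ep' Ez') => q Eq /page_curves_true_strips[|].
  exact: EA'.
exact: HE'.
Qed.

End Tube.

(** * The crossing at a contact point *)

Section Jacobian.
Context {R : realType}.

Lemma det2_comb (a b : R * R) (x1 x2 y1 y2 : R) :
  det2 (x1 *: a + x2 *: b) (y1 *: a + y2 *: b) = det2 a b * (x1 * y2 - x2 * y1).
Proof.
case: a b => [a1 a2] [b1 b2]; rewrite /det2.
rewrite -[(_ + _).1]/(x1 * a1 + x2 * b1) -[(x1 *: _ + _).2]/(x1 * a2 + x2 * b2).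
rewrite -[(_ + _).1]/(y1 * a1 + y2 * b1) -[(y1 *: _ + _).2]/(y1 * a2 + y2 * b2) /=.
ring.
Qed.

Lemma det2_e2 (w : R * R) : det2 e2 w = - w.1.
Proof. by rewrite /det2 /e2 /= mul0r mul1r sub0r. Qed.

Lemma dot_Ne1 (w : R * R) : dot (- e1) w = - w.1.
Proof. by rewrite /dot -[(- e1).1]/(- 1) -[(- e1).2]/(- 0); ring. Qed.

Lemma det2_Ne1 (w : R * R) : det2 (- e1) w = - w.2.
Proof. by rewrite /det2 -[(- e1).1]/(- 1) -[(- e1).2]/(- 0); ring. Qed.

Lemma turn_neq0 (w : R * R) : w != 0 -> turn w != 0.
Proof.
apply: contra_neq => /(congr1 turn); case: w => a b; rewrite /turn /= => -[/eqP + /eqP].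
by rewrite oppr0 !oppr_eq0 => /eqP -> /eqP ->.
Qed.

Lemma derive_det2 (T : R * R -> R * R) (p x y : R * R) : differentiable T p ->
  det2 ('D_x T p) ('D_y T p) = jac T p * det2 x y.
Proof.
move=> dT.
exact: (etrans (congr2 det2 (derive_basis x dT) (derive_basis y dT)) (det2_comb _ _ _ _ _ _)).
Qed.

Lemma det2_cvg2 (T : Type) (F : set_system T) {FF : Filter F} (f g : T -> R * R)
    (a b : R * R) : f @ F --> a -> g @ F --> b ->
  (fun x => det2 (f x) (g x)) @ F --> det2 a b.
Proof.
move=> fa gb.
have f1 : (fun x => (f x).1) @ F --> a.1 by exact: (cvg_comp _ _ fa cvg_fst).
have f2 : (fun x => (f x).2) @ F --> a.2 by exact: (cvg_comp _ _ fa cvg_snd).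
have g1 : (fun x => (g x).1) @ F --> b.1 by exact: (cvg_comp _ _ gb cvg_fst).
have g2 : (fun x => (g x).2) @ F --> b.2 by exact: (cvg_comp _ _ gb cvg_snd).
have h1 : (fun x => (f x).1 * (g x).2) @ F --> a.1 * b.2 by exact: cvgM.
have h2 : (fun x => (f x).2 * (g x).1) @ F --> a.2 * b.1 by exact: cvgM.
exact: (cvgB h1 h2).
Qed.

Lemma jac_continuous (U : set (R * R)) (T : R * R -> R * R) (p : R * R) :
  U p -> Ck 1 U T -> {for p, continuous (jac T)}.
Proof.
move=> Up [_ dT].
have [c1 _] := (dT e1).2; have [c2 _] := (dT e2).2.
have k1 : {for p, continuous ('D_e1 T)} by apply: c1; rewrite inE.
have k2 : {for p, continuous ('D_e2 T)} by apply: c2; rewrite inE.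
exact: (det2_cvg2 k1 k2).
Qed.

(** The Jacobians of G and of its inverse multiply to 1. *)
Lemma jac_inverse (T G : R * R -> R * R) (p : R * R) : differentiable G p ->
  differentiable T (G p) -> (\forall u \near p, T (G u) = u) ->
  0 < jac G p -> 0 < jac T (G p).
Proof.
move=> dG dT E jG.
have D v : 'D_('D_v G p) T (G p) = v.
  have <- := derive_comp v dG dT.
  by rewrite (near_eq_derive _ (E : \forall u \near p, (T \o G) u = id u)) derive_id.
have J : 1 = jac T (G p) * jac G p.
  have -> : 1 = det2 e1 e2 :> R by rewrite /det2 /e1 /e2 /= mulr1 mul0r subr0.
  exact: (etrans (congr2 det2 (esym (D e1)) (esym (D e2))) (derive_det2 _ _ dT)).
have : 0 < jac T (G p) * jac G p by rewrite -J ltr01.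
by rewrite pmulr_lgt0.
Qed.

End Jacobian.

Section AtContact.
Context {R : realType} {N m : nat} {D : open_book_diagram R N} (H : hkm_data m D).
Variable i : 'I_N.

Lemma contact_params : exists s0 t0 : R, [/\ s0 \in `]0, 1[, t0 \in `]0, 1[,
  cut_arc D i s0 = xi H i & barc H i t0 = xi H i].
Proof.
have : (trace (cut_arc D i) `&` trace (barc H i)) (xi H i) by rewrite xi_unique.
move=> [[s0 s01 Es] [t0 t01 Et]]; have nb := @xi_interior _ _ _ _ H i.
exists s0, t0; split => //.
  have [E|[E|//]] := itv01P s01; exfalso; apply: nb; rewrite -Es.
    by have [_ _ _ /(_ s0 s01) ba _] := arc_proper D i; apply/ba; left.
  by have [_ _ _ /(_ s0 s01) ba _] := arc_proper D i; apply/ba; right.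
have [E|[E|//]] := itv01P t01; exfalso; apply: nb; rewrite -Et.
  by apply/(half_beta_bd H true i t01); left.
by apply/(half_beta_bd H true i t01); right.
Qed.

(** rho read in a chart, near an interior point of the tube. *)
Lemma rho_ext c p : atlas c -> chart_dom c p -> (chart_map c p).2 != 0 -> tube H i p ->
  exists T : R * R -> R * R, exists2 U : set (R * R), open U /\ U (chart_map c p) &
    (forall n, Ck n U T) /\
    (forall u, U u -> [/\ (chart_map c @` chart_dom c) u, tube H i (chart_inv c u) &
       T u = rho H i (chart_inv c u)]).
Proof.
move=> ac dp p2 tp; have [_ [_ sr] _ _ _] := nu_tubular H i.
have [|T [U [oU Up CT E]]] := sr c ac (chart_map c p); first by exists p.
have ci := chart_inv_continuous ac dp p2.
have tp' : tube H i (chart_inv c (chart_map c p)) by rewrite chart_mapK.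
have n1 := cts_near ci (near_tube tp').
have [V [oV Vp VH]] := near_open (filterI (filterI (open_nbhs_nbhs (conj oU Up)) n1)
  (chart_image_near ac dp p2)).
exists T, V => //; split; first by move=> n; apply: Ck_sub (CT n) => u /VH[[]].
move=> u /VH[[Uu tu] [q dq qu]]; split => //; first by exists q.
rewrite -E//; exists q => //; split => //.
by move: tu; rewrite -qu chart_mapK.
Qed.

(** nu read in a chart, near an interior point of the band; it preserves the
orientation. *)
Lemma nu_ext c u0 : atlas c -> band u0 -> 0 < u0.2 < 1 -> chart_dom c (nu H i u0) ->
  exists G : R * R -> R * R, exists2 U : set (R * R), open U /\ U u0 &
    [/\ forall n, Ck n U G, 0 < jac G u0 &
    forall u, U u -> [/\ band u, chart_dom c (nu H i u) & G u = chart_map c (nu H i u)]].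
Proof.
move=> ac [u1 u2] u2' du; have [_ _ or _ _] := nu_tubular H i.
have bu : band u0 by [].
have [|G [U [oU Uu CG E]] jG] := or c ac u0; first by split.
have n1 := within_near (@nu_within _ _ _ _ H i) bu (chart_dom_near ac du).
have n2 : \forall u \near u0, band u.
  have c1 : {for u0, continuous (fst : R * R -> R)} by exact: cvg_fst.
  have c2 : {for u0, continuous (snd : R * R -> R)} by exact: cvg_snd.
  have /andP[a1 a2] := u1; have /andP[a3 a4] := u2'.
  have m1 : \forall u \near u0, -1 < u.1 by exact: near_gt c1 a1.
  have m2 : \forall u \near u0, u.1 < 1 by exact: near_lt c1 a2.
  have m3 : \forall u \near u0, 0 < u.2 by exact: near_gt c2 a3.
  have m4 : \forall u \near u0, u.2 < 1 by exact: near_lt c2 a4.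
  apply: filterS (filterI (filterI m1 m2) (filterI m3 m4)) => u [[k1 k2] [k3 k4]].
  by split; rewrite ?k1 ?k2 ?ltW.
have [V [oV Vp VH]] := near_open (filterI (filterI (open_nbhs_nbhs (conj oU Uu)) n1) n2).
exists G, V => //; split => //; first by move=> n; apply: Ck_sub (CG n) => u /VH[[]].
move=> u /VH[[Uu' /[swap] bu' /(_ bu') du']]; split => //.
by rewrite -E.
Qed.

(** T is the inverse of the tubular parametrization, read in the chart c. *)
Lemma bcoord_local c t : t \in `]0, 1[ -> atlas c -> chart_dom c (barc H i t) ->
  exists T : R * R -> R * R, exists2 d : R, 0 < d &
  (forall s, `|s - t| < d -> [/\ s \in `]0, 1[, chart_dom c (barc H i s),
     derivable (chart_map c \o barc H i) s 1, differentiable T (chart_map c (barc H i s)) &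
     bcoord H i s = T (chart_map c (barc H i s))]) /\
  [/\ forall s, `|s - t| < d -> derivable (bcoord H i) s 1 /\
       'D_1 (bcoord H i) s = 'D_('D_1 (chart_map c \o barc H i) s) T (chart_map c (barc H i s)),
     {for t, continuous ('D_1 (bcoord H i))},
     {for t, continuous (fun s => jac T (chart_map c (barc H i s)))} &
     forall s, `|s - t| < d -> \forall u \near chart_map c (barc H i s),
       tube H i (chart_inv c u) /\ T u = rho H i (chart_inv c u)].
Proof.
move=> t01 ac dc; have [sg _] := half_beta_smooth H true i t01.
have int := half_beta_interior (h := true) t01 ac dc.
have [T [U [oU Up] [CT ET]]] := rho_ext ac dc int (barc_band H i (itv01W t01)).
have [V [oV Vt Vd CV]] := sg c ac dc.
have cg : {for t, continuous (chart_map c \o barc H i)} := (CV 0%N).1 t (mem_set Vt).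
have nU : \forall s \near t, U (chart_map c (barc H i s)).
  exact: (cts_near cg (open_nbhs_nbhs (conj oU Up))).
have [W [oW Wt WH]] := near_open (filterI (filterI (near_itv01 t01) nU) (open_nbhs_nbhs (conj oV Vt))).
have WE s : W s -> bcoord H i s = T (chart_map c (barc H i s)).
  move=> /WH[[s01 Us] Vs]; have [_ _ ->] := ET _ Us.
  by rewrite chart_mapK//; exact: Vd.
have CgW n : Ck n W (chart_map c \o barc H i) by apply: Ck_sub (CV n) => s /WH[].
have CbW n : Ck n W (bcoord H i).
  have WU : W `<=` (chart_map c \o barc H i) @^-1` U by move=> s /WH[[]].
  have C := Ck_comp oW oU (CgW n.+1) (CT n.+1) WU.
  by apply: Ck_eq oW _ C => s Ws; rewrite WE.
have dT u : U u -> differentiable T u by move=> Uu; exact: (Ck1_differentiable oU Uu (CT 1%N)).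
have [d d0 Hd] := near_ball_norm (open_nbhs_nbhs (conj oW Wt)).
have {}Hd s : `|s - t| < d -> W s by rewrite distrC => /Hd.
have dgs s : W s -> derivable (chart_map c \o barc H i) s 1.
  by move=> Ws; exact: ((CgW 1%N).2 1).1.
exists T, d; first exact: d0.
split.
  move=> s /Hd Ws; have [[s01 Us] Vs] := WH _ Ws; split => //; first exact: Vd.
  - exact: dgs.
  - exact: dT.
  - exact: WE.
split.
- move=> s /Hd Ws; split; first exact: ((CbW 1%N).2 1).1.
  have E : \forall s' \near s, bcoord H i s' = (T \o (chart_map c \o barc H i)) s'.
    by apply: filterS (open_nbhs_nbhs (conj oW Ws)) => s'; exact: WE.
  rewrite (near_eq_derive _ E) derive_comp//.
    by apply/derivable1_diffP; exact: dgs.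
  by apply: dT; have [[]] := WH _ Ws.
- by have [c0 _] := ((CbW 1%N).2 1).2; apply: c0; rewrite inE.
- have cj := jac_continuous Up (CT 1%N).
  exact: (continuous_comp cg cj).
- move=> s /Hd Ws; have [[s01 Us] Vs] := WH _ Ws.
  by apply: filterS (open_nbhs_nbhs (conj oU Us)) => u /ET[_].
Qed.

(** At the contact point, a_i runs in the direction e2 in tubular coordinates, and
det2 e2 w = - w.1; so positivity of the crossing says that the first coordinate of b_i
decreases. By continuity this persists near t0, as does the positivity of the
Jacobian of the coordinate change T. *)
Lemma crossing : exists c (t0 : R) T, exists2 d : R, 0 < d &
  [/\ t0 \in `]0, 1[, barc H i t0 = xi H i, atlas c, (bcoord H i t0).1 = 0 &
  forall s, `|s - t0| < d -> [/\
    [/\ s \in `]0, 1[, chart_dom c (barc H i s) &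
        bcoord H i s = T (chart_map c (barc H i s))],
    [/\ derivable (chart_map c \o barc H i) s 1, differentiable T (chart_map c (barc H i s)) &
     derivable (bcoord H i) s 1],
    'D_1 (bcoord H i) s = 'D_('D_1 (chart_map c \o barc H i) s) T (chart_map c (barc H i s)),
    ('D_1 (bcoord H i) s).1 < 0 /\ 0 < jac T (chart_map c (barc H i s)) &
    \forall u \near chart_map c (barc H i s),
       tube H i (chart_inv c u) /\ T u = rho H i (chart_inv c u)]].
Proof.
have [s0 [t0 [s001 t001 Es Et]]] := contact_params.
have [c ac dc] := surf_cover (xi H i); rewrite -Et in dc.
have [T [d d0 [H1 [H2 cD cJ H4]]]] := bcoord_local t001 ac dc.
have rxi : bcoord H i t0 = (0, s0).
  rewrite /bcoord Et -Es -(nu_arc H i (itv01W s001)) rhoK//; exact: band0 (itv01W s001).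
have t0t0 : `|t0 - t0| < d by rewrite subrr normr0.
have [_ _ dg0 dT0 E0] := H1 _ t0t0; have [db0 Db0] := H2 _ t0t0.
have bs0 : band (0, s0) := band0 (itv01W s001).
have ds0 : chart_dom c (nu H i (0, s0)) by rewrite nu_arc ?itv01W// Es -Et.
have s0i : 0 < ((0, s0) : R * R).2 < 1 by move: s001; rewrite in_itv.
have [G [U [oU Us0] [CG jG EG]]] := nu_ext ac bs0 s0i ds0.
have dG : differentiable G (0, s0) by exact: (Ck1_differentiable oU Us0 (CG 1%N)).
have G0 : G (0, s0) = chart_map c (barc H i t0).
  by have [_ _ ->] := EG _ Us0; rewrite nu_arc ?itv01W// Es Et.
have nU := open_nbhs_nbhs (conj oU Us0).
have cG : {for (0, s0), continuous G} by exact: differentiable_continuous.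
(* G is nu read in the chart c, so that T is its inverse *)
have TG : \forall u \near ((0, s0) : R * R), T (G u) = u.
  have H4' : \forall w \near G (0, s0), tube H i (chart_inv c w) /\ T w = rho H i (chart_inv c w).
    by rewrite G0; exact: H4.
  apply: filterS (filterI nU (cts_near cG H4')) => u [/EG[bu du Gu] [_ ->]].
  by rewrite Gu chart_mapK// rhoK.
have dTG : differentiable T (G (0, s0)) by rewrite G0.
have jT := jac_inverse dG dTG TG jG; rewrite G0 in jT.
have neg : ('D_1 (bcoord H i) t0).1 < 0.
  have sa : smooth_at (cut_arc D i) s0.
    by have [sa _ _ _ _] := arc_proper D i; exact: smooth_into_at.
  have dca : chart_dom c (cut_arc D i s0) by rewrite Es -Et.
  have va := derive_velocity sa ac dca.
  have [sb _] := half_beta_smooth H true i t001.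
  have vb := derive_velocity sb ac dc.
  have := xi_positive (itv01W s001) (itv01W t001) Es Et va vb.
  have -> : 'D_1 (chart_map c \o cut_arc D i) s0 = 'D_e2 G (0, s0).
    have cl : {for s0, continuous (fun s : R => (0, s) : R * R)}.
      by apply: continuous_pair_at; [exact: cvg_cst|exact: cvg_id].
    have E : \forall s \near s0, (chart_map c \o cut_arc D i) s = G (s *: e2 + 0).
      have e2E s : s *: e2 + 0 = (0, s) :> R * R.
        by rewrite addr0; congr pair; rewrite -[LHS]/(s * _) ?mulr0 ?mulr1.
      apply: filterS (filterI (cts_near cl nU) (near_itv01 s001)) => s [/EG[bu du Gu] s01].
      by rewrite e2E Gu /= nu_arc// itv01W.
    rewrite (near_eq_derive _ E).
    have e2s0 : s0 *: e2 + 0 = (0, s0) :> R * R.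
      by rewrite addr0; congr pair; rewrite -[LHS]/(s0 * _) ?mulr0 ?mulr1.
    have dGs : derivable G (s0 *: e2 + 0) e2 by rewrite e2s0; exact: diff_derivable.
    by have [_ ->] := is_derive_line dGs; rewrite e2s0.
  have -> : 'D_1 (chart_map c \o half_beta H true i) t0 = 'D_('D_1 (bcoord H i) t0) G (0, s0).
    have cb : {for t0, continuous (bcoord H i)}.
      by apply: differentiable_continuous; apply/derivable1_diffP.
    have nUb : \forall s \near t0, U (bcoord H i s) by apply: (cts_near cb); rewrite rxi.
    have E : \forall s \near t0, (chart_map c \o half_beta H true i) s = (G \o bcoord H i) s.
      apply: filterS (filterI nUb (near_itv01 t001)) => s [/EG[bu du Gu] s01].
      by rewrite /= Gu bcoordK// itv01W.
    have dG' : differentiable G (bcoord H i t0) by rewrite rxi.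
    have db := (derivable1_diffP (bcoord H i) t0).1 db0.
    rewrite (near_eq_derive _ E).
    by rewrite -rxi; exact: (derive_comp (1 : R) db dG').
  set dl := 'D_1 (bcoord H i) t0.
  have := derive_det2 e2 dl dG => ->.
  by rewrite (pmulr_rgt0 _ jG) det2_e2 oppr_gt0.
have c1 : (fun s => ('D_1 (bcoord H i) s).1) @ t0 --> ('D_1 (bcoord H i) t0).1.
  exact: (cvg_comp _ _ cD cvg_fst).
have n1 : \forall s \near t0, ('D_1 (bcoord H i) s).1 < 0 by exact: near_lt c1 neg.
have n2 : \forall s \near t0, 0 < jac T (chart_map c (barc H i s)) by exact: near_gt cJ jT.
have [r r0 Hr] := near_ball_norm (filterI n1 n2).
exists c, t0, T, (Num.min d r); first by rewrite lt_min d0 r0.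
split; [exact: t001|exact: Et|exact: ac|by rewrite rxi|].
move=> s; rewrite lt_min => /andP[sd sr].
have [h1 h2 h3 h4 h5] := H1 _ sd; have [h6 h7] := H2 _ sd.
rewrite distrC in sr; have [h8 h9] := Hr _ sr.
split; [split; [exact: h1|exact: h2|exact: h5]|split; [exact: h3|exact: h4|exact: h6]|exact: h7|split; [exact: h8|exact: h9]|exact: H4].
Qed.

Definition off q := ~ arcs q /\ ~ strips H q.

(** Just before the contact point b_i has positive first coordinate, and it decreases.
A point q at the same first coordinate as b_i(s'), but above it, lies beyond the graph
of b_i, because at the height of q the arc has a smaller first coordinate.
The other case is symmetric. *)
Lemma off_of_coords q (t0 d s' : R) : t0 \in `]0, 1[ -> s' \in `[0, 1] -> `|s' - t0| < d ->
  (forall s t, `|s - t0| < d -> `|t - t0| < d -> s < t -> (bcoord H i t).1 < (bcoord H i s).1) ->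
  (forall t : R, t \in `[0, 1] -> t0 < t -> (bcoord H i t).1 < 0) ->
  (forall t : R, t \in `[0, 1] -> t < t0 -> 0 < (bcoord H i t).1) ->
  tube H i q -> (rho H i q).1 = (bcoord H i s').1 ->
  (s' < t0 /\ (bcoord H i s').2 < (rho H i q).2) \/
  (t0 < s' /\ (rho H i q).2 < (bcoord H i s').2) -> off q.
Proof.
move=> t001 s'01 s'd dec neg pos tq E1 side; have [bq qE] := nuK tq.
have r0 : (rho H i q).1 != 0.
  rewrite E1; case: side => -[lt _].
    by rewrite gt_eqF// pos.
  by rewrite lt_eqF// neg.
split; first by rewrite -qE => /(arcs_nu H i bq)/eqP; rewrite (negbTE r0).
move=> [j [tj [t t01 [E2 side2]]]].
have ij : i = j by exact: tube_inj tq tj.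
subst j; rewrite -/(bcoord H i t) in E2 side2.
have mono s : s \in `[0, 1] -> (bcoord H i s).2 < (bcoord H i t).2 -> s < t.
  move=> s01; apply: contraTT; rewrite -!leNgt le_eqVlt => /predU1P[->//|ts].
  by rewrite ltW// (bcoord_lt H i t01 s01 ts).
have mono' s : s \in `[0, 1] -> (bcoord H i t).2 < (bcoord H i s).2 -> t < s.
  move=> s01; apply: contraTT; rewrite -!leNgt le_eqVlt => /predU1P[->//|ts].
  by rewrite ltW// (bcoord_lt H i s01 t01 ts).
case: side => -[lt side].
  have p1 := pos _ s'01 lt; have s't : s' < t by apply: mono => //; rewrite E2.
  case: side2; last by rewrite E1; lra.
  move=> /andP[_]; rewrite E1 leNgt => /negP; apply.
  have [tt0|t0t] := lerP t t0; last by apply: lt_trans p1; exact: neg.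
  by apply: dec => //; move: s'd; rewrite !ltr_norml; lra.
have p1 := neg _ s'01 lt; have s't : t < s' by apply: mono' => //; rewrite E2.
case: side2; first by rewrite E1; lra.
move=> /andP[+ _]; rewrite E1 leNgt => /negP; apply.
have [t0t|tt0] := lerP t0 t; last by apply: lt_trans (pos _ t01 tt0).
by apply: dec => //; move: s'd; rewrite !ltr_norml; lra.
Qed.

(** By [crossing] and because b_i meets the a-arc only at t0, its first coordinate is
positive before t0 and negative after t0. A point slightly to the right of
b_i before t0 is, by [offset], above the point of b_i with the same first coordinate;
a point slightly to its left after t0 is below it. In both cases [off_of_coords]
applies. *)
Lemma contact_offsets : exists2 t0 : R, (t0 \in `]0, 1[) /\ barc H i t0 = xi H i &
  (\forall s \near t0^'-, exists c v, velocity (barc H i) s c v /\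
     \forall e \near (0 : R)^'+, off (chart_inv c (chart_map c (barc H i s) - e *: turn v))) /\
  (\forall s \near t0^'+, exists c v, velocity (barc H i) s c v /\
     \forall e \near (0 : R)^'+, off (chart_inv c (chart_map c (barc H i s) + e *: turn v))).
Proof.
have [c [t0 [T [d d0 [t001 Et ac b0 Hd]]]]] := crossing.
have itvE x : (x \in `]t0 - d, t0 + d[) = (`|x - t0| < d) by rewrite in_itv/= ltr_distl.
have dec s t : `|s - t0| < d -> `|t - t0| < d -> s < t -> (bcoord H i t).1 < (bcoord H i s).1.
  rewrite -!itvE => sd td st.
  have db x : x \in `]t0 - d, t0 + d[ -> derivable (fun s => (bcoord H i s).1) x 1 /\
      'D_1 (fun s => (bcoord H i s).1) x < 0.
    by rewrite itvE => /Hd[_ [_ _ db] _ [neg _] _]; have [? ->] := derivable_fst db.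
  apply: (@ltr0_derive1_lt_oo _ (fun s => (bcoord H i s).1) (t0 - d) (t0 + d)) => //.
  - by move=> x /db[].
  - by move=> x /db[_]; rewrite derive1E.
  - move=> x; rewrite inE /= => /db[/derivable1_diffP/differentiable_continuous c1 _].
    exact: c1.
have t001' := itv01W t001.
have zero (t : R) : t \in `[0, 1] -> (bcoord H i t).1 = 0 -> t = t0.
  move=> t01 bt0; have : arcs (nu H i (bcoord H i t)) by apply/(arcs_nu H i (bcoord_band H i t01)).
  rewrite bcoordK// => -[j _ [s s01 E]].
  have [_] := arc_barc_disjoint s01 t01 E; have [ji Ex] := arc_barc_disjoint s01 t01 E.
  by move=> _; subst j; apply: (barc_inj (H := H) (i := i)) => //; rewrite Ex Et.
have cb1 : {within `[0, 1]%classic, continuous (fun t => (bcoord H i t).1)}.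
  apply/withinP => t t01; have /withinP/(_ t t01) cc := @bcoord_within _ _ _ _ H i.
  exact: (cvg_comp _ _ cc cvg_fst).
have t0d : `|t0 - t0| < d by rewrite subrr normr0.
have ivt (a b : R) : a \in `[0, 1] -> b \in `[0, 1] -> a <= b ->
    Num.min (bcoord H i a).1 (bcoord H i b).1 <= 0 <= Num.max (bcoord H i a).1 (bcoord H i b).1 ->
    a <= t0 <= b.
  rewrite !in_itv/= => /andP[a0 a1] /andP[bb0 bb1] ab.
  have cab : {within `[a, b], continuous (fun t => (bcoord H i t).1)}.
    apply: continuous_subspaceW cb1 => t; rewrite /= !in_itv/= => /andP[t1 t2].
    by rewrite (le_trans a0)// (le_trans t2).
  move=> mm; have [t] := IVT (v := 0) ab cab mm.
  rewrite in_itv/= => /andP[t1 t2] /zero <-; first by rewrite t1 t2.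
  by rewrite in_itv/= (le_trans a0)// (le_trans t2).
have d2 : d / 2 < d by rewrite ltr_pdivrMr// ltr_pMr// ltr1n.
have d20 : 0 < d / 2 by rewrite divr_gt0.
have neg (t : R) : t \in `[0, 1] -> t0 < t -> (bcoord H i t).1 < 0.
  move=> t01 t0t; have [td|td] := ltrP t (t0 + d).
    by rewrite -b0; apply: dec => //; rewrite ltr_norml; lra.
  have sd : `|t0 + d / 2 - t0| < d by rewrite addrAC subrr add0r gtr0_norm.
  have [[s01 _ _] _ _ _ _] := Hd _ sd.
  have sn : (bcoord H i (t0 + d / 2)).1 < 0 by rewrite -b0; apply: dec => //; lra.
  rewrite ltNge; apply/negP => bt.
  have st : t0 + d / 2 <= t by lra.
  have [|h _] := andP (ivt _ _ (itv01W s01) t01 st _); last by move: h; lra.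
  by rewrite ge_min le_max (ltW sn) bt orbT.
have pos (t : R) : t \in `[0, 1] -> t < t0 -> 0 < (bcoord H i t).1.
  move=> t01 t0t; have [td|td] := ltrP (t0 - d) t.
    by rewrite -b0; apply: dec => //; rewrite ltr_norml; lra.
  have sd : `|t0 - d / 2 - t0| < d by rewrite addrAC subrr add0r normrN gtr0_norm.
  have [[s01 _ _] _ _ _ _] := Hd _ sd.
  have sn : 0 < (bcoord H i (t0 - d / 2)).1 by rewrite -b0; apply: dec => //; lra.
  rewrite ltNge; apply/negP => bt.
  have st : t <= t0 - d / 2 by lra.
  have [|_ h] := andP (ivt _ _ t01 (itv01W s01) st _); last by move: h; lra.
  by rewrite ge_min le_max (ltW sn) bt orbT.
have main s (sg : R) : `|s - t0| < d -> (s < t0 /\ sg = -1) \/ (t0 < s /\ sg = 1) ->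
    \forall e \near (0 : R)^'+, off (chart_inv c (chart_map c (barc H i s) +
      e *: (sg *: turn ('D_1 (chart_map c \o barc H i) s)))).
  move=> sd side.
  have [[s01 dcs Eb] [dg dT db] Db [neg1 jT] nT] := Hd _ sd.
  set w := sg *: turn _; pose cs := chart_map c (barc H i s).
  have rho0 : 0 < Num.min (d - `|s - t0|) `|s - t0|.
    rewrite lt_min subr_gt0 sd normr_gt0 subr_eq0.
    by case: side => -[lt _]; [rewrite (lt_eqF lt)|rewrite (gt_eqF lt)].
  pose z e := T (e *: w + cs).
  have dz : is_derive (0 : R) 1 z ('D_w T cs).
    have dT' : derivable T (0 *: w + cs) w by rewrite scale0r add0r; exact: diff_derivable.
    by have := is_derive_line dT'; rewrite scale0r add0r.
  have z0 : z 0 = bcoord H i s by rewrite /z scale0r add0r -Eb.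
  have [dz0 Dz0] := dz.
  have A0 : 0 < dot (- e1) ('D_1 (bcoord H i) s).
    by rewrite dot_Ne1 oppr_gt0.
  have D0 : 0 < sg * det2 ('D_1 (bcoord H i) s) ('D_1 z 0).
    rewrite Dz0 Db.
    have := derive_det2 ('D_1 (chart_map c \o barc H i) s) w dT => ->.
    rewrite mulrCA; apply: mulr_gt0 => //.
    rewrite /w det2_dot dotZ -det2_dot mulrA; apply: mulr_gt0.
      by case: side => -[_ ->]; rewrite ?mulrNN mulr1.
    rewrite det2_dot dot_self_gt0// turn_neq0//.
    apply: contraTneq neg1 => g0; rewrite Db g0 derive0.
    by rewrite ltxx.
  have cc s' : `|s' - s| < Num.min (d - `|s - t0|) `|s - t0| -> {for s', continuous (bcoord H i)}.
    rewrite lt_min => /andP[h _]; have s'd : `|s' - t0| < d.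
      by apply: (le_lt_trans (ler_distD s _ _)); rewrite -ltrBrDr.
    by have [_ [_ _ /derivable1_diffP/differentiable_continuous]] := Hd _ s'd.
  have o1 := offset db dz0 z0 A0 D0 rho0 cc.
  have n2 : \forall e \near (0 : R), tube H i (chart_inv c (e *: w + cs)) /\
      T (e *: w + cs) = rho H i (chart_inv c (e *: w + cs)).
    by have c0 := @cvg_line R _ cs w; exact: (c0 _ nT).
  have o2 : \forall e \near (0 : R)^'+, tube H i (chart_inv c (e *: w + cs)) /\
      T (e *: w + cs) = rho H i (chart_inv c (e *: w + cs)).
    have [r r0 Hr] := near_ball_norm n2; apply/near_rightP; exists r => // e.
    by rewrite add0r => /andP[e0 er]; apply: Hr; rewrite sub0r normrN gtr0_norm.
  apply: near_rightS (near_rightI o1 o2) => e [[s' [s'1 s'2 s'3]] [tq Tq]].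
  rewrite addrC -/cs; move: s'1; rewrite lt_min => /andP[h1 h2].
  have s'd : `|s' - t0| < d.
    by apply: (le_lt_trans (ler_distD s _ _)); rewrite -ltrBrDr.
  have [[s'01 _ _] _ _ _ _] := Hd _ s'd.
  move: s'2 s'3; rewrite !dot_Ne1 !det2_Ne1 /z Tq => /oppr_inj s'2 s'3.
  apply: (off_of_coords t001 (itv01W s'01) s'd dec neg pos tq); first by rewrite s'2.
  case: side => -[lt sgE]; [left|right]; split.
  - by move: h2; rewrite ltr_norml (ltr0_norm (_ : s - t0 < 0)) ?subr_lt0//; lra.
  - by move: s'3; rewrite sgE mulN1r opprB opprK addrC subr_gt0.
  - by move: h2; rewrite ltr_norml (gtr0_norm (_ : 0 < s - t0)) ?subr_gt0//; lra.
  - by move: s'3; rewrite sgE mul1r opprK addrC subr_gt0.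
have vel s : `|s - t0| < d -> velocity (barc H i) s c ('D_1 (chart_map c \o barc H i) s).
  move=> /Hd[[s01 dcs _] _ _ _ _]; apply: derive_velocity => //.
  exact: (half_beta_smooth H true i s01).1.
exists t0 => //; split.
- apply/near_leftP; exists d => // s /andP[s1 s2].
  have sd : `|s - t0| < d by rewrite ltr_norml; lra.
  exists c, ('D_1 (chart_map c \o barc H i) s); split; first exact: vel.
  apply: near_rightS (main s (-1) sd _) => [e|]; last by left.
  by rewrite scaleN1r scalerN.
- apply/near_rightP; exists d => // s /andP[s1 s2].
  have sd : `|s - t0| < d by rewrite ltr_norml; lra.
  exists c, ('D_1 (chart_map c \o barc H i) s); split; first exact: vel.
  apply: near_rightS (main s 1 sd _) => [e|]; last by right.
  by rewrite scale1r.
Qed.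

End AtContact.

(** * The coefficient entering a contact point *)

Section Incoming.
Context {R : realType} {N m : nat} {D : open_book_diagram R N} (H : hkm_data m D).
Implicit Types P : set (doubled D) -> int.

Lemma mu_ge0 P h p : chain2 H P -> positive H P -> 0 <= mu H P h p.
Proof.
move=> [_ cP] pP; rewrite /mu; set r := region_at _ _.
by have [->//|/cP/pP] := eqVneq (P r) 0.
Qed.

(** The coefficient of P on the edge of beta_i entering the contact point. *)
Definition incoming P i (n : int) := exists t : R, [/\ t \in `]0, 1[, barc H i t = xi H i &
  \forall s \near t^'-, beta_coef H P true i s n].

Lemma contact_param_unique i (s t : R) : s \in `]0, 1[ -> t \in `]0, 1[ ->
  barc H i s = xi H i -> barc H i t = xi H i -> s = t.
Proof.
move=> s01 t01 Es Et; apply: (barc_inj (H := H) (i := i)); rewrite ?Es ?Et//; exact: itv01W.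
Qed.

Lemma near_left01 (t : R) : t \in `]0, 1[ -> \forall s \near t^'-, s \in `]0, 1[.
Proof.
rewrite in_itv/= => /andP[t0 t1]; apply: filterS (near_left_lt t0) => s /andP[s0 st].
by rewrite in_itv/= s0 (lt_trans st).
Qed.

Lemma incoming_unique P i n n' : incoming P i n -> incoming P i n' -> n = n'.
Proof.
move=> [t [t01 Et It]] [t' [t'01 Et' It']].
have E := contact_param_unique t'01 t01 Et' Et; subst t'.
have [s [[b b'] s01]] := left_proper (filterI (filterI It It') (near_left01 t01)).
have [c [v vel]] := half_beta_has_velocity H true i s01.
by have [e [-> ->]] := right_proper (near_rightI (b _ _ vel) (b' _ _ vel)).
Qed.

Lemma incoming_zero_jump P1 P2 i n (t : R) : t \in `]0, 1[ -> barc H i t = xi H i ->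
  incoming P1 i n -> incoming P2 i n ->
  \forall s \near t^'-, zero_jump H true (diff_mu H P1 P2 true) i s.
Proof.
move=> t01 Et [t1 [t101 Et1 I1]] [t2 [t201 Et2 I2]].
have E1 := contact_param_unique t101 t01 Et1 Et; subst t1.
have E2 := contact_param_unique t201 t01 Et2 Et; subst t2.
apply: filterS (filterI (filterI I1 I2) (near_left01 t01)) => s [[b1 b2] s01].
exact/(coefs_zero_jump (H := H) s01 b1 b2).
Qed.

Lemma contact_alpha i : (\bigcup_j @alpha R N D j) (contact H i).
Proof.
exists i => //; left; exists (xi H i) => //.
by have [] : (trace (cut_arc D i) `&` trace (barc H i)) (xi H i) by rewrite xi_unique.
Qed.

(** By [contact_offsets] the multiplicity vanishes on the right of the entering edge and
on the left of the leaving edge. With multiplicities at least 0 this gives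
n_in >= 0 and n_out <= 0, where n_in - n_out is prescribed by x and y. *)
Lemma incoming_exists P x y i : pi2hat H x y P -> positive H P ->
  exists2 n : int, incoming P i n &
    0 <= n <= ((contact H i \in y) && (contact H i \notin x))%:Z.
Proof.
move=> [cP vP] pP; have [t0 [t01 Et] [offl offr]] := contact_offsets H i.
have := vP true i t0 t01; rewrite /= Et => /(_ (contact_alpha i)).
move=> [n_in [n_out [I1 I2 E]]].
have in_ge0 : 0 <= n_in.
  have [s [b [c [v [vel off_]]]]] := left_proper (filterI I1 offl).
  have [e [-> [nA nS]]] := right_proper (near_rightI (b _ _ vel) off_).
  have -> : P (region_at H (copy true (chart_inv c (chart_map c (half_beta H true i s) - e *: turn v)))) = 0.
    exact: mu_off_strips.
  by rewrite subr0 mul1r; exact: (mu_ge0 true _ cP pP).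
have out_le0 : n_out <= 0.
  have [s [b [c [v [vel off_]]]]] := right_proper (near_rightI I2 offr).
  have [e [-> [nA nS]]] := right_proper (near_rightI (b _ _ vel) off_).
  have -> : P (region_at H (copy true (chart_inv c (chart_map c (half_beta H true i s) + e *: turn v)))) = 0.
    exact: mu_off_strips.
  by rewrite sub0r mul1r oppr_le0; exact: (mu_ge0 true _ cP pP).
exists n_in; first by exists t0.
rewrite in_ge0/=; move: E; rewrite -/(contact H i).
by case: (contact H i \in y); case: (contact H i \in x) => /=; lia.
Qed.

End Incoming.

(** * Intervals and boxes *)

Section Intervals.
Context {R : realType}.
Implicit Types a c d e r u w x y z : R.

Lemma dist_between u r a c w : u - r < a -> c < u + r -> a <= w <= c -> `|u - w| < r.
Proof. by rewrite ltr_norml; lra. Qed.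

Lemma minmax_dist e w d : `|e - w| < d -> e - d < Num.min e w /\ Num.max e w < e + d.
Proof. by rewrite ltr_norml lt_min gt_max; lra. Qed.

Lemma half_lt r : 0 < r -> r / 2 < r. Proof. lra. Qed.

Lemma right_window u r x : 0 < r -> u + r / 2 <= x -> x < u + r ->
  [/\ u - r < x, `|u - x| < r & forall y, `|u - y| < r / 2 -> y < x].
Proof.
move=> r0 rx xr; split; [lra|by rewrite ltr_norml; lra|].
by move=> y; rewrite ltr_norml; lra.
Qed.

Lemma left_window u r x : 0 < r -> x <= u - r / 2 -> u - r < x ->
  [/\ x < u + r, `|u - x| < r & forall y, `|u - y| < r / 2 -> x < y].
Proof.
move=> r0 rx xr; split; [lra|by rewrite ltr_norml; lra|].
by move=> y; rewrite ltr_norml; lra.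
Qed.

Lemma pair_dist_lt (p q : R * R) r :
  (`|p - q| < r) = (`|p.1 - q.1| < r) && (`|p.2 - q.2| < r).
Proof. by case: p q => p1 p2 [q1 q2]; rewrite prod_normE /= gt_max. Qed.

Lemma outer_pos b e : 0 < b -> 0 < e -> e < 1 - b ->
  [/\ -1 < b + e < 1, b + e != 0, b + e != b & ~ (0 <= b + e <= b \/ b <= b + e <= 0)].
Proof.
move=> b0 e0 eb; split; [lra|by rewrite gt_eqF; lra|by rewrite gt_eqF; lra|].
by case=> /andP[]; lra.
Qed.

Lemma inner_pos x b e r : 0 < x < b -> b < 1 -> 0 < e -> e < r -> exists z,
  [/\ x <= z < b, `|b - z| < r, -1 < z < 1, z != 0 & z != b].
Proof.
move=> /andP[x0 xb] b1 e0 er; exists (Num.max x (b - e)).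
have zb : Num.max x (b - e) < b by rewrite gt_max xb gtrBl e0.
have zx : x <= Num.max x (b - e) by rewrite le_max lexx.
have ze : b - e <= Num.max x (b - e) by rewrite le_max lexx orbT.
move: zb zx ze; move: (Num.max _ _) => z zb zx ze.
split; [by rewrite zx|by rewrite gtr0_norm; lra|lra|by rewrite gt_eqF; lra|by rewrite lt_eqF].
Qed.

Lemma outer_neg b e : b < 0 -> 0 < e -> e < 1 + b ->
  [/\ -1 < b - e < 1, b - e != 0, b - e != b & ~ (0 <= b - e <= b \/ b <= b - e <= 0)].
Proof.
move=> b0 e0 eb; split; [lra|by rewrite lt_eqF; lra|by rewrite lt_eqF; lra|].
by case=> /andP[]; lra.
Qed.

Lemma inner_neg x b e r : b < x < 0 -> -1 < b -> 0 < e -> e < r -> exists z,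
  [/\ b < z <= x, `|b - z| < r, -1 < z < 1, z != 0 & z != b].
Proof.
move=> /andP[bx x0] b1 e0 er; exists (Num.min x (b + e)).
have zb : b < Num.min x (b + e) by rewrite lt_min bx ltrDl e0.
have zx : Num.min x (b + e) <= x by rewrite ge_min lexx.
have ze : Num.min x (b + e) <= b + e by rewrite ge_min lexx orbT.
move: zb zx ze; move: (Num.min _ _) => z zb zx ze.
split; [by rewrite zb|by rewrite ltr0_norm; lra|lra|by rewrite lt_eqF; lra|by rewrite gt_eqF].
Qed.

Lemma between_convex a b x y l : a <= x <= b -> a <= y <= b -> 0 <= l <= 1 ->
  a <= l * (y - x) + x <= b.
Proof.
move=> /andP[ax xb] /andP[ay yb] /andP[l0 l1].
have l1' : 0 <= 1 - l by rewrite subr_ge0.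
have -> : l * (y - x) + x = l * y + (1 - l) * x by ring.
have E z : z = l * z + (1 - l) * z by ring.
by rewrite {1}(E a) [X in _ && (_ <= X)](E b) !lerD ?ler_wpM2l.
Qed.

Lemma near_open01 y r : 0 <= y <= 1 -> 0 < r -> exists y', 0 < y' < 1 /\ `|y - y'| < r.
Proof.
move=> /andP[y0 y1] r0.
have [e [e0 er e1]] : exists e, [/\ 0 < e, e < r & e < 1 / 2].
  exists (Num.min r (1 / 2) / 2).
  have k1 : Num.min r (1 / 2) <= r by rewrite ge_min lexx.
  have k2 : Num.min r (1 / 2) <= 1 / 2 by rewrite ge_min lexx orbT.
  have k3 : 0 < Num.min r (1 / 2) by rewrite lt_min r0 divr_gt0.
  by move: (Num.min _ _) k1 k2 k3 => e k1 k2 k3; split; lra.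
have [h|h] := lerP y (1 / 2).
  by exists (y + e); rewrite opprD addrA subrr add0r normrN gtr0_norm//; split; lra.
by exists (y - e); rewrite opprD addrA subrr add0r opprK gtr0_norm//; split; lra.
Qed.

End Intervals.

Section Boxes.
Context {R : realType} {N m : nat} {D : open_book_diagram R N} (H : hkm_data m D).

Definition box (a b c d : R) : set (R * R) := [set w | a <= w.1 <= b /\ c <= w.2 <= d].

Lemma box_connected a b c d : connected (box a b c d).
Proof.
apply: convex_connected => x y [x1 x2] [y1 y2] l l01; split.
  by rewrite -[(_ + _).1]/(l * (y.1 - x.1) + x.1); exact: between_convex.
by rewrite -[(_ + _).2]/(l * (y.2 - x.2) + x.2); exact: between_convex.
Qed.

Lemma box_band (a b c d : R) : -1 < a -> b < 1 -> 0 <= c -> d <= 1 -> box a b c d `<=` band.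
Proof.
move=> a1 b1 c0 d1 w [/andP[w1 w2] /andP[w3 w4]]; split.
  by rewrite (lt_le_trans a1)// (le_lt_trans w2).
by rewrite (le_trans c0)// (le_trans w4).
Qed.

Lemma nu_box_connected i (a b c d : R) : -1 < a -> b < 1 -> 0 <= c -> d <= 1 ->
  connected (nu H i @` box a b c d).
Proof.
move=> a1 b1 c0 d1; apply: connected_continuous_connected; first exact: box_connected.
by apply: continuous_subspaceW (@nu_within _ _ _ _ H i); exact: box_band.
Qed.

End Boxes.

(** * Vanishing on the first copy of the page *)

Section TrueSide.
Context {R : realType} {N m : nat} {D : open_book_diagram R N} (H : hkm_data m D).
Variables P1 P2 : set (doubled D) -> int.
Hypotheses (c1 : chain2 H P1) (c2 : chain2 H P2).

Lemma diff_mu_off_strips p : ~ arcs p -> ~ strips H p -> diff_mu H P1 P2 true p = 0.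
Proof. by move=> nA nS; rewrite /diff_mu !mu_off_strips ?subr0. Qed.

Lemma nu_off_strips i (b : R -> R) u :
  (forall t : R, t \in `[0, 1] -> b (bcoord H i t).2 = (bcoord H i t).1) ->
  band u -> u.1 != 0 -> ~ (0 <= u.1 <= b u.2 \/ b u.2 <= u.1 <= 0) ->
  diff_mu H P1 P2 true (nu H i u) = 0.
Proof.
move=> bb bu u0 nS; apply: diff_mu_off_strips.
  by move=> /(arcs_nu H i bu)/eqP; rewrite (negbTE u0).
move=> [j sj]; have ij : i = j by apply: (tube_inj (H := H) (tube_nu H i bu)); case: sj.
by subst j; move/(strip_nu bb bu): sj.
Qed.

Hypothesis zj : forall i (t : R), t \in `]0, 1[ ->
  \forall s \near t, s != t -> zero_jump H true (diff_mu H P1 P2 true) i s.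

(** Suppose that u is in the strip. At the height of u, the arc b_i is not on the a-arc, and
P1 - P2 is constant near it by
[zero_jump_const_near]. The constant is 0, as seen on the outer side of b_i, and the
horizontal segment from the inner side of b_i to u meets no curve. *)
Lemma strip_diff_zero i u : band u -> 0 < u.2 < 1 -> ~ page_curves H true (nu H i u) ->
  diff_mu H P1 P2 true (nu H i u) = 0.
Proof.
move=> bu u2 nK; have [b [cb bb _]] := bcoord_graph H i.
have Kn w : band w -> page_curves H true (nu H i w) <-> (w.1 = 0 \/ w.1 = b w.2).
  exact: page_curves_true_nu.
have u10 : u.1 != 0 by apply/eqP => E; apply: nK; apply/(Kn _ bu); left.
have u1b : u.1 != b u.2 by apply/eqP => E; apply: nK; apply/(Kn _ bu); right.
have [nS|S] := pselect (~ (0 <= u.1 <= b u.2 \/ b u.2 <= u.1 <= 0)).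
  exact: nu_off_strips bb bu u10 nS.
have {}S : 0 < u.1 < b u.2 \/ b u.2 < u.1 < 0.
  by case: (contrapT S) => /andP[h1 h2]; [left|right]; rewrite !lt_neqAle h1 h2 ?u10 ?u1b ?andbT ?(eq_sym 0) ?u10// eq_sym.
have u2' : u.2 \in `[0, 1] by have [_] := bu; rewrite in_itv.
have [t t01 Et] := bcoord_surj H i u2'.
have {}t01 : t \in `]0, 1[.
  have [E0 E1] := bcoord_ends H i; have [E|[E|//]] := itv01P t01.
    by move: u2; rewrite -Et E E0 ltxx.
  by move: u2; rewrite -Et E E1 ltxx andbF.
have t01' := itv01W t01.
(* t is the time at which b_i is at the height of u *)
have bt : bcoord H i t = (b u.2, u.2) by rewrite -Et bb// -surjective_pairing.
have nut : nu H i (b u.2, u.2) = barc H i t by rewrite -bt bcoordK.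
have bbt : band (b u.2, u.2) by rewrite -bt; exact: bcoord_band.
have nA : ~ arcs (half_beta H true i t).
  rewrite /= -nut => /(arcs_nu H i bbt) /= E; case: S; rewrite E => /andP[]; lra.
have qc := @diff_mu_const _ _ _ _ H P1 P2 true.
have [n Hn] := zero_jump_const_near qc t01 nA (@zj i t t01).
have cz : {for b u.2, continuous (fun z : R => (z, u.2))}.
  by apply: continuous_pair_at; [exact: cvg_id|exact: cvg_cst].
rewrite -[half_beta H true i t]nut in Hn.
have nn := within_near (@nu_within _ _ _ _ H i) bbt Hn.
have [r r0 Hr] := near_ball_norm (cts_near cz nn).
have [/andP[bm bp] _] := bbt; rewrite /= in bm bp.
have bandz z : -1 < z < 1 -> band (z, u.2) by move=> z1; split => //; have [] := bu.
have HrK z : `|b u.2 - z| < r -> -1 < z < 1 -> z != 0 -> z != b u.2 ->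
    diff_mu H P1 P2 true (nu H i (z, u.2)) = n.
  move=> zr z1 z0 zb; apply: (Hr z zr (bandz _ z1)) => /(Kn _ (bandz _ z1)) /= [E|E].
    by rewrite E eqxx in z0.
  by rewrite E eqxx in zb.
have seg (a c x y : R) : -1 < a -> c < 1 -> (c < 0 \/ 0 < a) -> (c < b u.2 \/ b u.2 < a) ->
    a <= x <= c -> a <= y <= c ->
    diff_mu H P1 P2 true (nu H i (x, u.2)) = diff_mu H P1 P2 true (nu H i (y, u.2)).
  move=> a1 cc1 ac0 acb xac yac.
  have u2l : 0 <= u.2 by have [_ /andP[]] := bu.
  have u2r : u.2 <= 1 by have [_ /andP[]] := bu.
  have in_box z : a <= z <= c -> box a c u.2 u.2 (z, u.2) by move=> zz; split; rewrite //= lexx.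
  apply: (qc _ _ _ (@nu_box_connected _ _ _ _ H i a c u.2 u.2 a1 cc1 u2l u2r)); last 2 first.
  - by exists (x, u.2) => //; exact: in_box.
  - by exists (y, u.2) => //; exact: in_box.
  move=> _ [w bw <-] /(Kn _ (box_band a1 cc1 u2l u2r bw)).
  case: bw => /andP[w1 w2] w34.
  have -> : w.2 = u.2 by apply/eqP; rewrite eq_sym eq_le.
  move=> [E|E].
    by case: ac0 => h; [have := le_lt_trans w2 h|have := lt_le_trans h w1]; rewrite E ltxx.
  by case: acb => h; [have := le_lt_trans w2 h|have := lt_le_trans h w1]; rewrite E ltxx.
pose e : R := Num.min r (1 - `|b u.2|) / 2.
have room : 0 < Num.min r (1 - `|b u.2|) by rewrite lt_min r0 subr_gt0 ltr_norml bm bp.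
have e0 : 0 < e by rewrite divr_gt0.
have er : e < r by apply: lt_le_trans (half_lt room) _; rewrite ge_min lexx.
have e1 : e < 1 - `|b u.2| by apply: lt_le_trans (half_lt room) _; rewrite ge_min lexx orbT.
rewrite [u in nu H i u]surjective_pairing.
have [/andP[um up] _] := bu.
case: S => S; have /andP[h1 h2] := S.
  have b0 := lt_trans h1 h2; rewrite (gtr0_norm b0) in e1.
  have [z1 z0 zb zS] := outer_pos b0 e0 e1.
  have n0 : n = 0.
    rewrite -(HrK _ _ z1 z0 zb); last by rewrite opprD addrA subrr add0r normrN gtr0_norm.
    exact: (nu_off_strips bb (bandz _ z1)).
  have [z [/andP[xz zlt] zr {}z1 {}z0 {}zb]] := inner_pos S bp e0 er.
  rewrite (seg u.1 z u.1 z) ?lexx ?xz//; [|by case/andP: z1|by right|by left].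
  by rewrite (HrK z).
have b0 := lt_trans h1 h2; rewrite (ltr0_norm b0) opprK in e1.
have [z1 z0 zb zS] := outer_neg b0 e0 e1.
have n0 : n = 0.
  rewrite -(HrK _ _ z1 z0 zb); last by rewrite opprD addrA subrr add0r opprK gtr0_norm.
  exact: (nu_off_strips bb (bandz _ z1)).
have [z [/andP[zlt xz] zr {}z1 {}z0 {}zb]] := inner_neg S bm e0 er.
rewrite (seg z u.1 u.1 z) ?lexx ?xz//; [|by case/andP: z1|by left|by right].
by rewrite (HrK z).
Qed.

(** Points of the strips on the boundary of the page are not covered by
[strip_diff_zero]; there the multiplicity is the one at a nearby interior point. *)
Lemma diff_mu_true_zero p : ~ page_curves H true p -> diff_mu H P1 P2 true p = 0.
Proof.
move=> nK; have nA : ~ arcs p by move=> Ap; apply: nK; left.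
have [[i [tp _]]|nS] := pselect (strips H p); last exact: diff_mu_off_strips.
have nKc : nbhs p (~` page_curves H true).
  apply: open_nbhs_nbhs; split => //.
  exact: (closed_openC (@page_curves_closed _ _ _ _ H true)).
have [E [nE cE EK]] := locally_connected nKc.
have [bu pE] := nuK tp; set u := rho H i p in bu pE.
rewrite -pE in nE.
have nn := within_near (@nu_within _ _ _ _ H i) bu nE.
have [r r0 Hr] := near_ball_norm nn.
have [u1 /andP[u2 u3]] := bu.
have [y [/andP[y0 y1] yr]] : exists y : R, 0 < y < 1 /\ `|u.2 - y| < r.
  by apply: near_open01 => //; rewrite u2.
have by_ : band (u.1, y) by split => //=; rewrite !ltW.
have Ey : E (nu H i (u.1, y)).
  by apply: Hr => //; rewrite pair_dist_lt /= subrr normr0 r0.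
have Ep : E p by rewrite -pE; exact: nbhs_singleton nE.
rewrite (diff_mu_const _ _ cE EK Ep Ey); apply: strip_diff_zero => //=.
  by rewrite y0 y1.
exact: EK.
Qed.

End TrueSide.

(** * Vanishing near the ends of the beta-arcs *)

Section FalseSide.
Context {R : realType} {N m : nat} {D : open_book_diagram R N} (H : hkm_data m D).

Lemma page_curves_collar : exists U : set D, [/\ open U, bd D `<=` U &
  forall p, U p -> page_curves H false p <-> page_curves H true p].
Proof.
have [U [oU bU idU]] := monodromy_id D; exists U; split => // p Up.
split=> -[Ap|[i _ [t t01 E]]]; try (by left); right; exists i => //; exists t => //.
  by apply: (diffeo_inj (monodromy_diffeo D)); rewrite (idU p Up).
by rewrite /= -[barc H i t]/(half_beta H true i t) E idU.
Qed.

(** An end of b_i on an a-arc would be the contact point, which is interior. *)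
Lemma bcoord_end_neq0 i (e : R) : e = 0 \/ e = 1 -> (bcoord H i e).1 != 0.
Proof.
move=> e01; have e01' : e \in `[0, 1] by case: e01 => ->; [exact: mem0|exact: mem1].
apply/eqP => /(arcs_nu H i (bcoord_band H i e01')); rewrite bcoordK// => -[j _ [s s01 E]].
have [_ X] := arc_barc_disjoint s01 e01' E.
by have [] := @xi_interior _ _ _ _ H j; rewrite -X; apply/(half_beta_bd H true i e01').
Qed.

Variables P1 P2 : set (doubled D) -> int.
Hypothesis true0 : forall p, ~ page_curves H true p -> diff_mu H P1 P2 true p = 0.

Lemma diff_mu_bd p : bd D p -> ~ page_curves H false p -> diff_mu H P1 P2 false p = 0.
Proof.
move=> bp nK; rewrite /diff_mu -!mu_bd//; apply: true0 => Kp; apply: nK.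
exact: page_curves_bd bp Kp.
Qed.

(** In a small box around the end, in tubular coordinates, the only curve is the graph of
b_i. A point of the box off the graph is joined to the boundary off the graph by a
horizontal segment away from the graph followed by a vertical one; on the boundary
the difference is the one on the other copy of the page, that is 0. *)
Lemma diff_mu_near_end i (e : R) : e = 0 \/ e = 1 ->
  \forall p \near half_beta H false i e, ~ page_curves H false p -> diff_mu H P1 P2 false p = 0.
Proof.
move=> e01; have e01' : e \in `[0, 1] by case: e01 => ->; [exact: mem0|exact: mem1].
have b0 := bcoord_end_neq0 i e01.
have [b [cb bb _]] := bcoord_graph H i.
have be2 : (bcoord H i e).2 = e.
  by have [E0 E1] := bcoord_ends H i; case: e01 => ->.
have bbd : bd D (barc H i e) by apply/(half_beta_bd H true i e01').
have [U [oU bU KU]] := page_curves_collar.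
have pE : half_beta H false i e = barc H i e.
  have [U' [_ bU' idU']] := monodromy_id D.
  by rewrite /= idU'//; exact: bU'.
rewrite pE; set u0 := bcoord H i e in b0 be2.
have bu0 : band u0 := bcoord_band H i e01'.
have nu0 : nu H i u0 = barc H i e := bcoordK H i e01'.
have nU : nbhs (nu H i u0) U by rewrite nu0; apply: open_nbhs_nbhs; split => //; exact: bU.
have nUw := within_near (@nu_within _ _ _ _ H i) bu0 nU.
have [r1 r10 Hr1] := near_ball_norm nUw.
have b_e : b e = u0.1 by rewrite -be2 bb.
have [/andP[um up] _] := bu0.
have u0lt : `|u0.1| < 1 by rewrite ltr_norml um up.
have [r [r0 rr1 rr2 rr3]] : exists r : R, [/\ 0 < r, r <= r1, r <= `|u0.1| & r <= 1 - `|u0.1|].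
  exists (Num.min (Num.min r1 `|u0.1|) (1 - `|u0.1|)).
  by rewrite !lt_min r10 normr_gt0 b0 subr_gt0 u0lt !ge_min !lexx !orbT.
have r2 : 0 < r / 2 by rewrite divr_gt0.
have nb : \forall y \near e, `|b e - b y| < r / 2.
  by have /cvgrPdist_lt := cb e; exact.
have [d1 d10 Hd1] := near_ball_norm nb.
have [d [d0 dr dd1]] : exists d : R, [/\ 0 < d, d <= r & d <= d1].
  by exists (Num.min r d1); rewrite lt_min r0 d10 !ge_min !lexx orbT.
(* the box is small enough to avoid the a-arc, on which w.1 = 0 *)
have boxP w : `|u0.1 - w.1| < r -> `|e - w.2| < d -> 0 <= w.2 <= 1 ->
    [/\ band w, U (nu H i w) & page_curves H false (nu H i w) -> w.1 = b w.2].
  move=> w1 w2 w01.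
  have bw : band w.
    split=> //; rewrite -ltr_norml.
    have -> : w.1 = u0.1 - (u0.1 - w.1) by rewrite subKr.
    by apply: (le_lt_trans (ler_normB _ _)); rewrite -ltrBrDl; exact: lt_le_trans rr3.
  have Uw : U (nu H i w).
    apply: Hr1 => //; rewrite pair_dist_lt be2.
    by rewrite (lt_le_trans w1)//= (lt_le_trans w2)// (le_trans dr).
  split => // /(KU _ Uw) /(page_curves_true_nu bb bw)[E|//].
  by move: w1; rewrite E subr0 ltNge rr2.
have by_ y : `|e - y| < d -> `|u0.1 - b y| < r / 2.
  by move=> ed; rewrite -b_e; apply: Hd1; exact: lt_le_trans dd1.
have qc := @diff_mu_const _ _ _ _ H P1 P2 false.
have step (a c l h : R) x y : u0.1 - r < a -> c < u0.1 + r ->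
    e - d < l -> h < e + d -> 0 <= l -> h <= 1 ->
    (forall w, box a c l h w -> w.1 != b w.2) ->
    box a c l h x -> box a c l h y ->
    diff_mu H P1 P2 false (nu H i x) = diff_mu H P1 P2 false (nu H i y).
  move=> a1 cc1 l1 h1 l0 h0 nb_ bx by__.
  have inb w : box a c l h w -> [/\ band w, U (nu H i w) & page_curves H false (nu H i w) -> w.1 = b w.2].
    move=> [/andP[w1 w2] /andP[w3 w4]]; apply: boxP.
    - by apply: dist_between a1 cc1 _; rewrite w1.
    - by apply: dist_between l1 h1 _; rewrite w3.
    - by rewrite (le_trans l0 w3) (le_trans w4 h0).
  have cE : connected (nu H i @` box a c l h).
    apply: connected_continuous_connected; first exact: box_connected.
    by apply: continuous_subspaceW (@nu_within _ _ _ _ H i) => w /inb[].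
  apply: (qc _ _ _ cE); last 2 first.
  - by exists x.
  - by exists y.
  by move=> _ [w bw <-] Kw; have [_ _ /(_ Kw) E] := inb w bw; have := nb_ w bw; rewrite E eqxx.
have main w : `|u0.1 - w.1| < r -> `|e - w.2| < d -> 0 <= w.2 <= 1 ->
    ~ page_curves H false (nu H i w) -> diff_mu H P1 P2 false (nu H i w) = 0.
  move=> w1 w2 w01 nK; have [bw Uw _] := boxP _ w1 w2 w01.
  have wb : w.1 != b w.2.
    apply/eqP => E; apply: nK; apply/(KU _ Uw).
    by apply/(page_curves_true_nu bb bw); right.
  have e_01 : 0 <= e <= 1 by move: e01'; rewrite in_itv.
  pose l := Num.min e w.2; pose h := Num.max e w.2.
  have [l1 h1] : e - d < l /\ h < e + d := minmax_dist w2.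
  have lh z : l <= z <= h -> `|e - z| < d := dist_between l1 h1.
  have l0 : 0 <= l by rewrite le_min; move/andP: e_01 => [-> _]; case/andP: w01.
  have h0 : h <= 1 by rewrite ge_max; move/andP: e_01 => [_ ->]; case/andP: w01.
  have le_ : l <= e <= h by rewrite ge_min le_max lexx.
  have lw : l <= w.2 <= h by rewrite ge_min le_max lexx !orbT.
  have end0 x' : `|u0.1 - x'| < r -> x' != b e -> diff_mu H P1 P2 false (nu H i (x', e)) = 0.
    move=> x'r x'b; have ee : `|e - ((x', e) : R * R).2| < d by rewrite subrr normr0.
    have [bx' Ux' Kx'] := boxP (x', e) x'r ee e_01.
    apply: diff_mu_bd; first by apply/(nu_bd H i bx').
    by move=> /Kx' /= E; rewrite E eqxx in x'b.
  have eq_box (x x' z : R) v : box x x' z z v -> v.2 = z.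
    by move=> [_ z12]; apply/eqP; rewrite eq_sym eq_le.
  have /andP[w11 w12] : u0.1 - r < w.1 < u0.1 + r by rewrite -ltr_distlC.
  have be_ : `|u0.1 - b e| < r / 2 by apply: by_; rewrite subrr normr0.
  rewrite [w in nu H i w]surjective_pairing.
  have [lt|gt|E] := ltgtP (b w.2) w.1; last by rewrite E eqxx in wb.
    pose x' := Num.max w.1 (u0.1 + r / 2).
    have x'r : x' < u0.1 + r by rewrite gt_max w12 ltrD2l half_lt.
    have x'w : w.1 <= x' by rewrite le_max lexx.
    have x'r2 : u0.1 + r / 2 <= x' by rewrite le_max lexx orbT.
    have [x'l x'd x'b] := right_window r0 x'r2 x'r.
    rewrite (step w.1 x' w.2 w.2 _ (x', w.2)); rewrite ?w11 ?(lt_le_trans l1) ?(le_lt_trans _ h1)//.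
    - rewrite (step x' x' l h _ (x', e)); rewrite ?x'r ?l1 ?h1//.
      + by apply: end0 => //; rewrite gt_eqF// x'b.
      + move=> v [/andP[v1 v2] /lh/by_ v3].
        by rewrite gt_eqF// (lt_le_trans (x'b _ v3)).
      + by split; rewrite //= lexx.
      + by split; rewrite //= lexx.
    - by have /andP[] := lw.
    - by have /andP[] := lw.
    - by case/andP: w01.
    - by case/andP: w01.
    - move=> v bv; rewrite (eq_box _ _ _ _ bv) gt_eqF//.
      by case: bv => /andP[v1 _] _; exact: lt_le_trans v1.
    - by split; rewrite //= !lexx.
    - by split; rewrite //= !lexx ?x'w.
  pose x' := Num.min w.1 (u0.1 - r / 2).
  have x'r : u0.1 - r < x' by rewrite lt_min w11 ltrD2l ltrN2 half_lt.
  have x'w : x' <= w.1 by rewrite ge_min lexx.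
  have x'r2 : x' <= u0.1 - r / 2 by rewrite ge_min lexx orbT.
  have [x'l x'd x'b] := left_window r0 x'r2 x'r.
  rewrite (step x' w.1 w.2 w.2 _ (x', w.2)); rewrite ?w12 ?(lt_le_trans l1) ?(le_lt_trans _ h1)//.
  - rewrite (step x' x' l h _ (x', e)); rewrite ?x'r ?l1 ?h1//.
    + by apply: end0 => //; rewrite lt_eqF// x'b.
    + move=> v [/andP[v1 v2] /lh/by_ v3].
      by rewrite lt_eqF// (le_lt_trans v2)// x'b.
    + by split; rewrite //= lexx.
    + by split; rewrite //= lexx.
  - by have /andP[] := lw.
  - by have /andP[] := lw.
  - by case/andP: w01.
  - by case/andP: w01.
  - move=> v bv; rewrite (eq_box _ _ _ _ bv) lt_eqF//.
    by case: bv => /andP[_ v1] _; exact: le_lt_trans gt.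
  - by split; rewrite //= !lexx ?x'w.
  - by split; rewrite //= !lexx ?x'w.
have tp : tube H i (barc H i e) := barc_band H i e01'.
have cr := rho_continuous tp.
have n1 : \forall p \near barc H i e, `|u0 - rho H i p| < d.
  by have /cvgrPdist_lt := cr; exact.
apply: filterS (filterI n1 (near_tube tp)) => p [pd tp'] nK; have [bu uE] := nuK tp'.
rewrite -uE in nK *; have [_ u01] := bu.
move: pd; rewrite pair_dist_lt be2.
by move=> /andP[q1 q2]; apply: main => //; exact: lt_le_trans dr.
Qed.

End FalseSide.

(** * Vanishing on the second copy of the page *)

Section Components.
Context {R : realType} {N m : nat} {D : open_book_diagram R N} (H : hkm_data m D).

Lemma connected_clopen (T : topologicalType) (A C : set T) : connected A ->
  open C -> closed C -> A `&` C !=set0 -> A `<=` C.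
Proof.
move=> cA oC cC [z [Az Cz]].
have sep := open_disjoint_separated oC (closed_openC cC) (setICr C).
have cov : A `<=` C `|` ~` C by rewrite setUCr.
by have [//|/(_ z Az)] := connected_subset sep cov cA.
Qed.

Lemma disk_connected : connected (disk : set (R * R)).
Proof.
apply: convex_connected => x y; rewrite /disk /= => dx dy l /andP[l0 l1].
rewrite -[l *: (y.1 - x.1)]/(l * (y.1 - x.1)) -[l *: (y.2 - x.2)]/(l * (y.2 - x.2)).
case: x y dx dy => [x1 x2] [y1 y2] /= dx dy.
have -> : (l * (y1 - x1) + x1) ^+ 2 + (l * (y2 - x2) + x2) ^+ 2 =
    l * (y1 ^+ 2 + y2 ^+ 2) + (1 - l) * (x1 ^+ 2 + x2 ^+ 2) -
    l * (1 - l) * ((x1 - y1) ^+ 2 + (x2 - y2) ^+ 2) by ring.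
have h1 : l * (y1 ^+ 2 + y2 ^+ 2) <= l by rewrite -[leRHS]mulr1 ler_wpM2l.
have h2 : (1 - l) * (x1 ^+ 2 + x2 ^+ 2) <= 1 - l by rewrite -[leRHS]mulr1 ler_wpM2l ?subr_ge0.
have h3 : 0 <= l * (1 - l) * ((x1 - y1) ^+ 2 + (x2 - y2) ^+ 2).
  by rewrite !mulr_ge0 ?subr_ge0// addr_ge0// sqr_ge0.
by lra.
Qed.

Lemma component_open (p : D) : open (connected_component (~` @arcs R N D) p).
Proof.
rewrite openE => q Cq; have nAq : ~ @arcs R N D q := connected_component_sub Cq.
have [E [nE cE EA]] := locally_connected (near_not_arcs nAq).
have Eq := nbhs_singleton nE.
apply: filterS nE => z Ez; rewrite (same_connected_component Cq).
exact: (connected_component_max Eq EA cE).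
Qed.

(** A component C that meets a tube contains a vertical segment of it, whose ends are on
the boundary. A component that meets no tube is closed as well as open, so that it
contains the whole image of one of the disks of the cut-open page. The circle of that
disk is sent to the boundary or to the arcs, and the latter are outside C. *)
Lemma component_meets_bd (p : D) : ~ @arcs R N D p ->
  exists2 z, connected_component (~` @arcs R N D) p z & bd D z.
Proof.
move=> nAp; set C := connected_component _ p.
have Cp : C p by exact: connected_component_refl.
have CA q : C q -> ~ @arcs R N D q := @connected_component_sub _ _ _ q.
have [[i [q [Cq tq]]]|NT] := pselect (exists i q, C q /\ tube H i q).
  have [bu qE] := nuK tq; set u := rho H i q in bu qE.
  have [/andP[u1 u2] /andP[u3 u4]] := bu.
  have u0 : u.1 != 0 := arcs_tube tq (CA _ Cq).
  have bb : band (u.1, 0) by split => /=; rewrite ?u1 ?u2 ?lexx ?ler01.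
  exists (nu H i (u.1, 0)); last by apply/(nu_bd H i bb); left.
  rewrite /C (same_connected_component Cq).
  apply: (connected_component_max _ _ (@nu_box_connected _ _ _ _ H i u.1 u.1 0 u.2 u1 u2 (lexx _) u4)).
  - by exists u => //; split; rewrite ?lexx ?u3.
  - move=> _ [w [/andP[w1 w2] w34] <-] /(arcs_nu H i) w0.
    have E : w.1 = u.1 by apply/eqP; rewrite eq_le w2 w1.
    have bw : band w by split; rewrite ?E ?u1 ?u2//; have /andP[-> /le_trans->] := w34.
    by move/eqP: u0; apply; rewrite -E w0.
  - by exists (u.1, 0) => //; split; rewrite /= ?lexx ?u3.
have oC : open C by exact: component_open.
have cC : closed C.
  move=> z clz; have [Az|nAz] := pselect (@arcs R N D z).
    exfalso; case: Az => i _ [t t01 Ez].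
    have tz : tube H i z by rewrite -Ez; exact: arc_band.
    by have [q [Cq tq]] := clz _ (near_tube tz); apply: NT; exists i, q.
  have [E [nE cE EA]] := locally_connected (near_not_arcs nAz).
  have [q [Cq Eq]] := clz _ nE.
  rewrite /C (same_connected_component Cq).
  exact: (connected_component_max Eq EA cE (nbhs_singleton nE)).
have [n [q [cq surj circ _ _]]] := arc_cut D.
have [j [u du qu]] := surj p.
have sub : q j @` disk `<=` C.
  apply: (connected_clopen _ oC cC).
    by apply: connected_continuous_connected; [exact: disk_connected|exact: cq].
  by exists p; split => //; exists u.
have d1 : disk ((1, 0) : R * R) by rewrite /disk /= expr1n expr0n addr0.
have Cq1 : C (q j (1, 0)) by apply: sub; exists (1, 0).
exists (q j (1, 0)) => //.
have [|//|/(CA _ Cq1)//] := (circ j _ d1).1.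
by rewrite /circle /= expr1n expr0n addr0.
Qed.

Variables P1 P2 : set (doubled D) -> int.
Hypothesis true0 : forall p, ~ page_curves H true p -> diff_mu H P1 P2 true p = 0.
Hypothesis vert : forall i (t : R), t \in `]0, 1[ -> arcs (half_beta H false i t) ->
    (\forall s \near t, s != t -> zero_jump H false (diff_mu H P1 P2 false) i s) \/
    (\forall s \near t, s != t -> ~ zero_jump H false (diff_mu H P1 P2 false) i s).

Lemma near_half_beta_end h i (B : set D) : nbhs (half_beta H h i 0) B ->
  \forall s \near (0 : R)^'+, (s \in `]0, 1[) /\ B (half_beta H h i s).
Proof.
move=> nB; have /withinP/(_ 0 (mem0 (R := R)) B nB) := @half_beta_within _ _ _ _ H h i.
move=> /near_ball_norm[r r0 Hr]; apply/near_rightP.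
exists (Num.min r 1); first by rewrite lt_min r0 ltr01.
move=> e; rewrite add0r lt_min => /andP[e0 /andP[er e1]].
have e01 : e \in `]0, 1[ by rewrite in_itv/= e0 e1.
by split => //; apply: Hr; [rewrite sub0r normrN gtr0_norm|exact: itv01W].
Qed.

Lemma near_half_beta_end1 h i (B : set D) : nbhs (half_beta H h i 1) B ->
  \forall s \near (1 : R)^'-, (s \in `]0, 1[) /\ B (half_beta H h i s).
Proof.
move=> nB; have /withinP/(_ 1 (mem1 (R := R)) B nB) := @half_beta_within _ _ _ _ H h i.
move=> /near_ball_norm[r r0 Hr]; apply/near_leftP.
exists (Num.min r 1); first by rewrite lt_min r0 ltr01.
move=> e; rewrite ltrBlDr -ltrBlDl lt_min => /andP[/andP[er e1] e0].
have e01 : e \in `]0, 1[ by rewrite in_itv/=; move: e0 e1; lra.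
by split => //; apply: Hr; [rewrite gtr0_norm ?subr_gt0|exact: itv01W].
Qed.

Lemma end_not_arcs h i (e : R) : e = 0 \/ e = 1 -> ~ arcs (half_beta H h i e).
Proof.
move=> e01; have e01' : e \in `[0, 1] by case: e01 => ->; [exact: mem0|exact: mem1].
have bE : half_beta H h i e = barc H i e.
  have [U [_ bU idU]] := monodromy_id D; case: h => //=; rewrite idU//; apply: bU.
  by apply/(half_beta_bd H true i e01').
rewrite bE -(bcoordK H i e01') => /(arcs_nu H i (bcoord_band H i e01'))/eqP.
by rewrite (negbTE (bcoord_end_neq0 H i e01)).
Qed.

(** Next to an interior point of a beta-arc the offsets to its left lie off the curves, and
an end of a beta-arc is a limit of interior points. *)
Lemma off_curves_dense h (p : D) (B : set D) : ~ arcs p -> nbhs p B ->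
  exists2 q, B q & ~ page_curves H h q.
Proof.
move=> nA nB.
have inner i (t : R) B' : t \in `]0, 1[ -> ~ arcs (half_beta H h i t) ->
    nbhs (half_beta H h i t) B' -> exists2 q, B' q & ~ page_curves H h q.
  move=> t01 nAt nB'; have [c ac dc] := surf_cover (half_beta H h i t).
  have [V [L [Rt [[_ _ _ LRK _] off_]]]] := sides_at t01 nAt ac dc.
  have o1 := offset_near (turn ('D_1 (chart_map c \o half_beta H h i) t)) ac dc
    (half_beta_interior t01 ac dc) nB'.
  have [e [B'e [Le _]]] := right_proper (near_rightI o1 (nbhs_singleton off_)).
  by exists (chart_inv c (chart_map c (half_beta H h i t) +
    e *: turn ('D_1 (chart_map c \o half_beta H h i) t))) => //; apply: LRK; left.
have [Kp|nK] := pselect (page_curves H h p); last by exists p => //; exact: nbhs_singleton nB.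
case: Kp => [//|[i _ [t t01 tp]]]; subst p.
have nBA : nbhs (half_beta H h i t) (interior (B `&` ~` @arcs R N D)).
  by apply: nbhs_interior; apply: filterI => //; exact: near_not_arcs.
have ends s : (s \in `]0, 1[) /\ interior (B `&` ~` @arcs R N D) (half_beta H h i s) ->
    exists2 q, B q & ~ page_curves H h q.
  move=> [s01 nBs]; have [_ nAs] := nbhs_singleton nBs.
  by have [q [Bq _] Kq] := inner i s _ s01 nAs nBs; exists q.
have [E|[E|t01']] := itv01P t01; last by have [] := inner i t _ t01' nA nB => q; exists q.
  by subst t; have [s] := right_proper (near_half_beta_end nBA); exact: ends.
by subst t; have [s] := left_proper (near_half_beta_end1 nBA); exact: ends.
Qed.

Let qc := @diff_mu_const _ _ _ _ H P1 P2 false.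

(** The propagation starts at the end of time 0, where the difference vanishes by
[diff_mu_near_end]. *)
Lemma zero_jump_false i (t : R) : t \in `]0, 1[ ->
  \forall s \near t, s != t -> zero_jump H false (diff_mu H P1 P2 false) i s.
Proof.
apply: (zero_jump_propagates qc) => //; first exact: vert.
have e0 : (0 : R) = 0 \/ (0 : R) = 1 by left.
have n0 := nbhs_interior (diff_mu_near_end true0 i e0).
have nA := near_not_arcs (@end_not_arcs false i 0 e0).
have [r r0 Hr] := (near_rightP _ _).1 (near_half_beta_end (filterI n0 nA)).
have in_r s : s \in `]0, r[ -> 0 < s < 0 + r by rewrite in_itv/= add0r.
have r2 : r / 2 \in `]0, r[ by rewrite in_itv/= divr_gt0// half_lt.
exists (r / 2); first by have [] := Hr _ (in_r _ r2).
apply: filterS (near_in_itvoo r2) => s sr _; have [s01 [n0s nAs]] := Hr _ (in_r _ sr).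
by apply: (const_near_zero_jump s01 nAs); exists 0.
Qed.

Lemma const_near_false (p : D) : ~ arcs p -> const_near H false (diff_mu H P1 P2 false) p.
Proof.
move=> nA; have [Kp|nK] := pselect (page_curves H false p); last first.
  have nKc : nbhs p (~` page_curves H false).
    apply: open_nbhs_nbhs; split => //.
    exact: (closed_openC (@page_curves_closed _ _ _ _ H false)).
  have [E [nE cE EK]] := locally_connected nKc.
  have Ep := nbhs_singleton nE.
  by exists (diff_mu H P1 P2 false p); apply: filterS nE => z Ez _; exact: (qc cE EK Ez Ep).
case: Kp => [//|[i _ [t t01 tp]]]; subst p.
have [E|[E|t01']] := itv01P t01.
- by exists 0; apply: (diff_mu_near_end true0); left.
- by exists 0; apply: (diff_mu_near_end true0); right.
- by apply: (zero_jump_const_near qc t01' nA); exact: zero_jump_false.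
Qed.

(** By [const_near_false] the component of p in the complement of the arcs is the union
of the open set where the difference is locally 0 and of the open set where it is
locally another constant. They are disjoint because the complement of the curves is
dense, and the first one contains a boundary point. *)
Lemma diff_mu_false_zero (p : D) : ~ page_curves H false p -> diff_mu H P1 P2 false p = 0.
Proof.
move=> nKp; have nAp : ~ arcs p by move=> Ap; apply: nKp; left.
pose G n := [set q : D | \forall z \near q, ~ page_curves H false z -> diff_mu H P1 P2 false z = n].
have oG n : open (G n) by rewrite openE => q /nbhs_interior.
have [z Cz bz] := component_meets_bd nAp.
have nAz : ~ arcs z := connected_component_sub Cz.
have G0z : G 0 z.
  have [Kz|nKz] := pselect (page_curves H false z).
    case: Kz => [//|[i _ [t t01 tz]]].
    rewrite /G /= -tz; apply: (diff_mu_near_end true0).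
    by apply/(half_beta_bd H false i t01); rewrite tz.
  have [n Hn] := const_near_false nAz.
  have n0 : n = 0 by rewrite -(nbhs_singleton Hn nKz); exact: diff_mu_bd.
  by rewrite /G /= -n0.
pose Gx := \bigcup_(n in [set n : int | n != 0]) G n.
have oGx : open Gx by apply: bigcup_open => n _; exact: oG.
pose C := connected_component (~` @arcs R N D) p.
have dis : (G 0 `&` C) `&` (Gx `&` C) = set0.
  apply/eqP/negPn/negP => /set0P[q [[G0q Cq] [[n n0 Gnq] _]]].
  have nAq : ~ arcs q := connected_component_sub Cq.
  have [w [w0 wn] Kw] := off_curves_dense false nAq (filterI G0q Gnq).
  by move/eqP: n0; apply; rewrite -(wn Kw) w0.
have oC : open C by exact: component_open.
have sep := open_disjoint_separated (openI (oG 0) oC) (openI oGx oC) dis.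
have cov : C `<=` (G 0 `&` C) `|` (Gx `&` C).
  move=> q Cq; have [n Hn] := const_near_false (@connected_component_sub _ _ _ q Cq).
  have [n0|n0] := eqVneq n 0; [left|right]; split => //; first by rewrite /G /= -n0.
  by exists n.
have Cp : C p by exact: connected_component_refl.
have [sub|sub] := connected_subset sep cov (@component_connected _ _ _).
  by have [G0p _] := sub p Cp; exact: (nbhs_singleton G0p).
have [Gxz _] := sub z Cz.
by exfalso; suff : (G 0 `&` C `&` (Gx `&` C)) z by rewrite dis.
Qed.

End Components.

(** * Counting *)

Section Counting.
Context {R : realType} {N m : nat} {D : open_book_diagram R N} (H : hkm_data m D).
Implicit Types (P : set (doubled D) -> int) (x y : set (doubled D)).

Lemma xi_inj : injective (xi H).
Proof.
have tx i : tube H i (xi H i).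
  have [_ [t t01 <-]] : (trace (cut_arc D i) `&` trace (barc H i)) (xi H i) by rewrite xi_unique.
  exact: barc_band.
by move=> i j E; apply: (tube_inj (tx i)); rewrite E.
Qed.

Lemma contact_inj : injective (contact H).
Proof. by move=> i j /copy_eq[/xi_inj]. Qed.

Lemma pi2hat_vertex_dichotomy x y P1 P2 h i (t : R) :
  pi2hat H x y P1 -> pi2hat H x y P2 -> t \in `]0, 1[ -> arcs (half_beta H h i t) ->
  (\forall s \near t, s != t -> zero_jump H h (diff_mu H P1 P2 h) i s) \/
  (\forall s \near t, s != t -> ~ zero_jump H h (diff_mu H P1 P2 h) i s).
Proof.
move=> [_ v1] [_ v2] t01 [j _ tj].
have qa : (\bigcup_j @alpha R N D j) (copy h (half_beta H h i t)).
  exists j => //; case: h tj => tj.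
    by left; exists (half_beta H true i t).
  by right; exists (half_beta H false i t).
exact: (vertex_dichotomy t01 (v1 h i t t01 qa) (v2 h i t t01 qa)).
Qed.

(** The vanishing of the jumps on the first copy starts at the contact points, where
the coefficients are the same by hypothesis; the rest is [diff_mu_true_zero] and
[diff_mu_false_zero]. *)
Lemma domain_eq x y P1 P2 : pi2hat H x y P1 -> pi2hat H x y P2 ->
  (forall i, exists2 n, incoming H P1 i n & incoming H P2 i n) -> P1 = P2.
Proof.
move=> p1 p2 inc; have [[c1 _] [c2 _]] := (p1, p2).
have zj i (t : R) : t \in `]0, 1[ ->
    \forall s \near t, s != t -> zero_jump H true (diff_mu H P1 P2 true) i s.
  apply: (zero_jump_propagates (@diff_mu_const _ _ _ _ H P1 P2 true)).
    by move=> s s01 As; exact: pi2hat_vertex_dichotomy p1 p2 s01 As.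
  have [n I1 I2] := inc i; have [t0 [t01 Et _]] := I1.
  exists t0 => //; have Z := incoming_zero_jump t01 Et I1 I2.
  have At : arcs (half_beta H true i t0).
    have [A _] : (trace (cut_arc D i) `&` trace (barc H i)) (xi H i) by rewrite xi_unique.
    by exists i => //; rewrite /= Et.
  have [//|NZ] := pi2hat_vertex_dichotomy p1 p2 t01 At.
  have [r r0 Hr] := near_ball_norm NZ.
  have rt : t0 - r < t0 by rewrite gtrBl.
  have [s [zs /andP[s1 s2]]] := left_proper (filterI Z (near_left_lt rt)).
  exfalso; apply: (Hr s) zs; last by rewrite lt_eqF.
  by rewrite gtr0_norm ?subr_gt0// ltrBlDr -ltrBlDl.
have true0 := diff_mu_true_zero c1 c2 zj.
have false0 := diff_mu_false_zero true0
  (fun i t => @pi2hat_vertex_dichotomy x y P1 P2 false i t p1 p2).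
apply/funext => r; have [[q nKq ->]|nr] := pselect (region H r); last first.
  by rewrite !(@chain2_not_region _ _ _ _ H _ r).
have [h [p qE]] := copy_surj q; subst q.
have nK : ~ page_curves H h p by move=> Kp; apply: nKq; exact/curves_copy.
have : diff_mu H P1 P2 h p = 0 by case: h nK {nKq} => nK; [exact: true0|exact: false0].
by move=> /eqP; rewrite subr_eq0 => /eqP.
Qed.

End Counting.

Lemma card_le_subsets (T U : Type) (A : set T) (B : set U) (k : nat) (e : T -> set U) :
  B #<= `I_k -> (forall a, A a -> e a `<=` B) ->
  (forall a b, A a -> A b -> e a = e b -> a = b) -> A #<= `I_(2 ^ k)%N.
Proof.
move=> /pcard_leP[f] eB e_inj.
pose c a : {set 'I_k} := finset (fun j : 'I_k => `[< exists2 z, e a z & f z = j >]).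
have c_sub a b : A a -> A b -> c a = c b -> e a `<=` e b.
  move=> Aa Ab cab z az; have zB := eB a Aa z az.
  have fz : (f z < k)%N := @funS _ _ _ _ f z zB.
  have : Ordinal fz \in c b by rewrite -cab inE; apply/asboolP; exists z.
  rewrite inE => /asboolP[z' bz' fz']; suff -> : z = z' by [].
  by apply: (inj (f := f)); rewrite ?inE//; exact: eB bz'.
pose code a : nat := enum_rank (c a).
have code_inj : {in A &, injective code}.
  move=> a b /set_mem Aa /set_mem Ab /val_inj/enum_rank_inj cab.
  by apply: e_inj => //; apply/seteqP; split; apply: c_sub.
have : code @` A #= A by exact: inj_card_eq.
rewrite card_eq_le => /andP[_ le1]; apply: card_le_trans le1 _.
apply: subset_card_le => _ [a _ <-] /=; rewrite /code.
have cardk : #|{: {set 'I_k}}| = (2 ^ k)%N.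
  by rewrite -cardsT -powersetT card_powerset cardsT card_ord.
by rewrite -[ltnRHS]cardk; exact: ltn_ord.
Qed.

Local Close Scope ring_scope.

Theorem lemma1 (R : realType) (N m : nat) (D : open_book_diagram R N)
    (H : hkm_data m D) (x y : set (doubled D)) (k : nat)
    (gen_x : generator H x) (gen_y : generator H y)
    (nonempty : pi2hat H x y !=set0)
    (kE : range (contact H) `&` y `\` x #= `I_k) :
  pi2hat H x y `&` [set P | positive H P] #<= `I_(2 ^ k).
Proof.
set T := _ `\` x in kE.
pose e (P : set (doubled D) -> int) : set (doubled D) :=
  [set z | T z /\ exists2 i, z = contact H i & incoming H P i 1%R].
have kle : T #<= `I_k by move: kE; rewrite card_eq_le => /andP[].
apply: (card_le_subsets (e := e) kle); first by move=> P _ z [].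
move=> P1 P2 [d1 pos1] [d2 pos2] eE; apply: (domain_eq d1 d2) => i.
have [n1 I1 b1] := incoming_exists i d1 pos1.
have [n2 I2 b2] := incoming_exists i d2 pos2.
suff E : n1 = n2 by exists n1 => //; rewrite E.
have [Ti|nTi] := pselect (T (contact H i)).
  have mem_e P n : incoming H P i n -> n = 1%R <-> e P (contact H i).
    move=> I; split=> [n_1|[_ [j /contact_inj <- I']]]; last exact: incoming_unique I I'.
    by split => //; exists i => //; rewrite -n_1.
  have same : n1 = 1%R <-> n2 = 1%R.
    by rewrite (mem_e _ _ I1) (mem_e _ _ I2) eE.
  by move: b1 b2 same; case: (contact H i \in y); case: (contact H i \notin x) => /=; lia.
suff b0 : (contact H i \in y) && (contact H i \notin x) = false.
  by move: b1 b2; rewrite b0 /=; lia.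
apply/negbTE/negP => /andP[/set_mem iy /negP ix]; apply: nTi.
by split; [split => //; exists i|move=> xi_; apply: ix; rewrite inE].
Qed.
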